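(* Let $X$ be a $K$-affinoid and let $q\in\mathcal{Q}_1(X)$ be not a root of unity. Then the natural restriction functor $$\bigcup_U\mathrm{Res}^U_q:\ \bigcup_U\ \sigma\text{-}\mathrm{Mod}(\mathcal{H}_K(X))_U^{\mathrm{adm}}\longrightarrow\sigma_q\text{-}\mathrm{Mod}(\mathcal{H}_K(X))^{\mathrm{adm}}$$ is an equivalence of categories, where $U$ runs over the set of all open neighborhoods of $q$. The analogous fact is true for $(\sigma,\delta)$-modules without supposing that $q$ is not a root of unity: for every $q\in\mathcal{Q}_1(X)$ the restriction functor $\bigcup_U(\sigma,\delta)\text{-}\mathrm{Mod}(\mathcal{H}_K(X))_U^{\mathrm{adm}}\to(\sigma_q,\delta_q)\text{-}\mathrm{Mod}(\mathcal{H}_K(X))^{\mathrm{adm}}$ is an equivalence.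
   Context: $K$ is a complete ultrametric valued field of mixed characteristic $(0,p)$. A $K$-affinoid is $X=\mathrm{D}^+(c_0,R_0)-\bigcup_{i=1}^n\mathrm{D}^-(c_i,R_i)$ (closed disc minus open discs) with $R_i>0$, $c_i\in K$, $c_1,\dots,c_n\in\mathrm{D}^+(c_0,R_0)$; $\mathcal{H}_K(X)$ is the completion for the sup-norm on $X$ of the ring of rational functions in $K(T)$ without poles in $X(K^{\mathrm{alg}})$; $r_X:=\min(R_0,\dots,R_n)$; $\sigma_q:f(T)\mapsto f(qT)$; $\delta_1:=T\frac{d}{dT}$; $\mathcal{Q}(X)$ is the (topological) group of $q\in K$ such that $\sigma_q$ is an automorphism of $\mathcal{H}_K(X)$; $\mathcal{Q}_1(X)=\mathcal{Q}(X)\cap\mathrm{D}^-(1,1)$; $\mathcal{U}_R:=\{(x,y)\in X\times X:|x-y|<R\}$. For $S\subseteq\mathcal{Q}(X)$, $\langle S\rangle$ is the generated subgroup and $S^\circ$ is the set of elements of $S$ that are not roots of unity. Discrete modules. A discrete $\sigma$-module over $S$ is a finite free $\mathcal{H}_K(X)$-module $\mathrm{M}$ with a group morphism $\sigma^{\mathrm{M}}:\langle S\rangle\to\mathrm{Aut}_K^{\mathrm{cont}}(\mathrm{M})$, $q\mapsto\sigma_q^{\mathrm{M}}$, with $\sigma_q^{\mathrm{M}}(fm)=\sigma_q(f)\sigma_q^{\mathrm{M}}(m)$. Morphisms are $\mathcal{H}_K(X)$-linear maps commuting with $\sigma_q$ for all $q\in S$. A discrete $(\sigma,\delta)$-module over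 $S$ has in addition a connection $\delta_1^{\mathrm{M}}:\mathrm{M}\to\mathrm{M}$, $\delta_1^{\mathrm{M}}(fm)=\delta_1(f)m+f\delta_1^{\mathrm{M}}(m)$, and morphisms must also commute with $\delta_1$. In a basis $(e_i)$ write $\sigma_q^{\mathrm{M}}(e_i)=\sum_ja_{ij}(q,T)e_j$, $A(q,T)=(a_{ij})$, and $\delta_1^{\mathrm{M}}(e_i)=\sum_jg_{ij}e_j$, $G(1,T)=(g_{ij})$; the associated equations are $\sigma_q(Y)=A(q,T)Y$ and $\delta_1(Y)=G(1,T)Y$. Taylor solutions. For $q$ not a root of unity: $d_q=\frac{\sigma_q-1}{(q-1)T}$, $H_0=\mathrm{Id}$, $H_1=\frac{A(q,T)-\mathrm{Id}}{(q-1)T}$, $H_{n+1}=d_q(H_n)+\sigma_q(H_n)H_1$, and $Y_{A(q,T)}(x,y)=\sum_{n\ge0}H_n(y)\frac{(x-y)_{q,n}}{[n]^!_q}$ with $(x-y)_{q,n}=\prod_{i=0}^{n-1}(x-q^iy)$, $[n]^!_q=\prod_{i=1}^n\frac{q^i-1}{q-1}$. For differential equations: $Y_{G(1,T)}(x,y)=\sum_{n\ge0}G_{[n]}(y)\frac{(x-y)^n}{n!}$, $G_{[0]}=\mathrm{Id}$, $G_{[1]}=G(1,T)/T$, $G_{[n+1]}=G_{[n]}'+G_{[n]}G_{[1]}$. Taylor admissibility. Let $S\subseteq\mathcal{Q}_1(X)$ with $S^\circ\ne\emptyset$, and $r>0$. $\sigma\text{-}\mathrm{Mod}(\mathcal{H}_K(X))^{[r]}_S$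 is the full subcategory of discrete $\sigma$-modules over $S$ such that: (1) $S\subseteq\mathrm{D}^-(1,r/\max(|c_0|,R_0))$; (2) there is a matrix $Y(x,y)$, convergent (analytic) on $\mathcal{U}_R$ for some $R$ with $r\le R\le r_X$; (3) $Y(x,y)$ is a simultaneous Taylor solution of all the equations, that is $Y=Y_{A(q,T)}$ for all $q\in S^\circ$ and $Y(qx,y)=A(q,x)Y(x,y)$ for all $q\in S$. For $(\sigma,\delta)$-modules one drops the assumption $S^\circ\neq\emptyset$ and requires (1), that $Y:=Y_{G(1,T)}(x,y)$ converges on $\mathcal{U}_R$ for some $r\le R\le r_X$, and that $Y(qx,y)=A(q,x)Y(x,y)$ for all $q\in S$; this gives $(\sigma,\delta)\text{-}\mathrm{Mod}(\mathcal{H}_K(X))^{[r]}_S$. Set $\sigma\text{-}\mathrm{Mod}(\mathcal{H}_K(X))^{\mathrm{adm}}_S:=\bigcup_r\sigma\text{-}\mathrm{Mod}(\mathcal{H}_K(X))^{[r]}_S$, the union over $r\le r_X$ with $S\subseteq\mathrm{D}^-(1,r/\max(|c_0|,R_0))$, and similarly for $(\sigma,\delta)$. When $S=\{q\}$ one writes $\sigma_q\text{-}\mathrm{Mod}(\cdot)^{\mathrm{adm}}$, $(\sigma_q,\delta_q)\text{-}\mathrm{Mod}(\cdot)^{\mathrm{adm}}$. $\mathrm{Res}^U_q$ forgets the operators $\sigma_{q'}^{\mathrm{M}}$ for $q'\notin\langle q\rangle$. The union over $U$ is the direct limit of categories along the restriction functors $\mathrm{Res}^U_{U'}$ for $U'\subseteq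 U$. *)

(* Defs.v *)
From HB Require Import structures.
From mathcomp Require Import all_boot all_order all_algebra.
From mathcomp Require Import all_classical all_reals.

Set Implicit Arguments.
Unset Strict Implicit.
Unset Printing Implicit Defensive.

Import Order.TTheory GRing.Theory Num.Theory.

Local Open Scope classical_set_scope.
Local Open Scope ring_scope.

Record ultrametric_abs (R : realType) (F : fieldType) (v : F -> R) : Prop :=
  UltrametricAbs {
    abs_ge0 : forall x, 0 <= v x;
    abs_eq0 : forall x, v x = 0 <-> x = 0;
    absM : forall x y, v (x * y) = v x * v y;
    abs_ultra : forall x y, v (x + y) <= Num.max (v x) (v y) }.

Definition abs_complete (R : realType) (F : fieldType) (v : F -> R) : Prop :=
  forall u : nat -> F,
    (forall e, 0 < e -> exists N, forall m n, (N <= m)%N -> (N <= n)%N ->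
       v (u m - u n) < e) ->
    exists l, forall e, 0 < e -> exists N, forall n, (N <= n)%N ->
       v (u n - l) < e.

(* For an ultrametric absolute value the residue field has characteristic p
   iff |p| < 1. *)
Record mixedCharField (R : realType) (p : nat) := MixedCharField {
  mcf_sort :> fieldType;
  mcf_abs : mcf_sort -> R;
  mcf_absP : ultrametric_abs mcf_abs;
  mcf_complete : abs_complete mcf_abs;
  mcf_pchar0 : [pchar mcf_sort] =i pred0;
  mcf_prime : prime p;
  mcf_residue : mcf_abs p%:R < 1 }.

(* K^alg, with the (unique) extension of the absolute value of K. *)
Record algClosure (R : realType) (p : nat) (K : mixedCharField R p) :=
  AlgClosure {
    acl_sort :> closedFieldType;
    acl_emb : {rmorphism K -> acl_sort};
    acl_abs : acl_sort -> R;
    acl_absP : ultrametric_abs acl_abs;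
    acl_abs_emb : forall x : K, acl_abs (acl_emb x) = mcf_abs x;
    acl_alg : forall z : acl_sort, algebraicOver acl_emb z }.

Record affinoid (R : realType) (p : nat) (K : mixedCharField R p) := Affinoid {
  aff_c0 : K;
  aff_r0 : R;
  aff_n : nat;
  aff_c : 'I_aff_n -> K;
  aff_r : 'I_aff_n -> R;
  aff_r0_gt0 : 0 < aff_r0;
  aff_r_gt0 : forall i, 0 < aff_r i;
  aff_c_in : forall i, mcf_abs (aff_c i - aff_c0) <= aff_r0 }.

Arguments aff_c {R p K} a i.
Arguments aff_r {R p K} a i.

Section Affinoid.
Variables (R : realType) (p : nat) (K : mixedCharField R p).
Variables (L : algClosure K) (X : affinoid K).

Local Notation absK := (@mcf_abs R p K).
Local Notation absL := (@acl_abs R p K L).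
Local Notation emb := (acl_emb L).

Definition r_X : R := \big[Num.min/aff_r0 X]_(i < aff_n X) aff_r X i.

(* max(|c_0|, R_0) is at least |x| for x in X. *)
Definition rho_X : R := Num.max (absK (aff_c0 X)) (aff_r0 X).

Definition in_aff (x : L) : bool :=
  (absL (x - emb (aff_c0 X)) <= aff_r0 X) &&
  [forall i : 'I_(aff_n X), aff_r X i <= absL (x - emb (aff_c X i))].

Definition pts := {x : L | in_aff x}.

Definition rational_fun (f : pts -> L) : Prop :=
  exists P Q : {poly K}, forall x : pts,
    (map_poly emb Q).[val x] != 0 /\
    f x = (map_poly emb P).[val x] / (map_poly emb Q).[val x].

(* A sup-norm limit of elements of K(T) takes at x in X(K^alg) a value in the
   complete field K(x), a subfield of K^alg; hence the completion of the ring
   of rational functions for the sup-norm on X(K^alg) is its uniform closure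
   in the ring of all functions X(K^alg) -> K^alg. *)
Definition is_HK (f : pts -> L) : Prop :=
  forall e : R, 0 < e ->
    exists2 g, rational_fun g & forall x, absL (f x - g x) < e.

Definition HK_pred : {pred (pts -> L)} := fun f => `[< is_HK f >].

Let vL := acl_absP L.

Lemma vL0 : absL (0 : L) = 0. Proof. exact/(abs_eq0 vL). Qed.

Lemma vL1 : absL (1 : L) = 1.
Proof.
have h : absL (1 : L) != 0.
  by apply/eqP => /(abs_eq0 vL)/eqP; rewrite oner_eq0.
by apply: (mulfI h); rewrite -(absM vL) !mulr1.
Qed.

Lemma vLN (x : L) : absL (- x) = absL x.
Proof.
have h : absL (-1 : L) = 1.
  have : absL (-1 : L) ^+ 2 = 1 by rewrite expr2 -(absM vL) mulrNN mulr1 vL1.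
  move/eqP; rewrite sqrf_eq1 => /orP[/eqP//|/eqP h1].
  by have := abs_ge0 vL (-1); rewrite h1 oppr_ge0 ler10.
by rewrite -mulN1r (absM vL) h mul1r.
Qed.

Lemma vL_gt0 (x : L) : x != 0 -> 0 < absL x.
Proof.
move=> x0; rewrite lt_def (abs_ge0 vL) andbT.
by apply: contra x0 => /eqP/(abs_eq0 vL)/eqP.
Qed.

Lemma vLV (x : L) : absL x^-1 = (absL x)^-1.
Proof.
have [->|x0] := eqVneq x 0; first by rewrite invr0 vL0 invr0.
have h : absL x != 0 by rewrite gt_eqF // vL_gt0.
by apply: (mulfI h); rewrite -(absM vL) !mulfV // vL1.
Qed.

Lemma vLD (x y : L) : absL (x + y) <= absL x + absL y.
Proof.
apply: (le_trans (abs_ultra vL x y)).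
by rewrite ge_max lerDl lerDr !(abs_ge0 vL).
Qed.

Lemma pts_bounded : exists2 B : R, 0 < B & forall x : pts, absL (val x) <= B.
Proof.
exists (aff_r0 X + absL (emb (aff_c0 X))).
  by rewrite ltr_pwDl ?aff_r0_gt0 ?(abs_ge0 vL).
case=> x /= /andP[hx _]; rewrite -{1}(subrK (emb (aff_c0 X)) x).
by apply: (le_trans (vLD _ _)); rewrite lerD2r.
Qed.

Lemma poly_bounded (P : {poly L}) :
  exists2 B : R, 0 < B & forall x : pts, absL (P.[val x]) <= B.
Proof.
have [B B0 hB] := pts_bounded.
elim/poly_ind: P => [|P c [M M0 hM]].
  by exists 1 => // x; rewrite horner0 vL0.
exists (M * B + absL c); first by rewrite ltr_pwDl ?mulr_gt0 ?(abs_ge0 vL).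
move=> x; rewrite hornerMXaddC; apply: (le_trans (vLD _ _)).
by rewrite lerD2r (absM vL) ler_pM ?(abs_ge0 vL).
Qed.

Lemma root_away (z : L) : ~~ in_aff z ->
  exists2 m : R, 0 < m & forall x : pts, m <= absL (val x - z).
Proof.
rewrite /in_aff negb_and -ltNge => /orP[hz|].
  exists (aff_r0 X) => [|[x /= /andP[hx _]]]; first exact: aff_r0_gt0.
  rewrite leNgt; apply/negP => h; move: hz; rewrite ltNge => /negP; apply.
  rewrite -(subrKA x) addrC; apply: (le_trans (abs_ultra vL _ _)).
  by rewrite ge_max hx -opprB vLN ltW.
rewrite negb_forall => /existsP[i]; rewrite -ltNge => hz.
exists (aff_r X i) => [|[x /= /andP[_ /forallP/(_ i) hx]]].
  exact: aff_r_gt0.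
rewrite leNgt; apply/negP => h; move: hx; rewrite leNgt => /negP; apply.
rewrite -(subrKA z); apply: (le_lt_trans (abs_ultra vL _ _)).
by rewrite gt_max h hz.
Qed.

Lemma poly_away (Q : {poly L}) : (forall x : pts, Q.[val x] != 0) ->
  exists2 m : R, 0 < m & forall x : pts, m <= absL (Q.[val x]).
Proof.
have [[x0]|nopt] := pselect (inhabited pts); last first.
  by move=> _; exists 1 => // x; case: nopt; exists.
have [r ->] := closed_field_poly_normal Q.
set a := lead_coef Q => hQ.
have a0 : a != 0.
  by apply/eqP => a0; have := hQ x0; rewrite a0 scale0r horner0 eqxx.
have hr (z : L) : z \in r -> ~~ in_aff z.
  move=> zr; apply/negP => hz; have := hQ (Sub z hz).
  rewrite hornerZ SubK; suff -> : (\prod_(w <- r) ('X - w%:P)).[z] = 0.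
    by rewrite mulr0 eqxx.
  by apply/rootP; rewrite root_prod_XsubC.
suff [m m0 hm] : exists2 m : R, 0 < m &
    forall x : pts, m <= absL ((\prod_(w <- r) ('X - w%:P)).[val x]).
  exists (absL a * m); first by rewrite mulr_gt0 ?vL_gt0.
  by move=> x; rewrite hornerZ (absM vL) ler_wpM2l ?(abs_ge0 vL).
elim: r hr {hQ} => [|z r IH] hr.
  by exists 1 => // x; rewrite big_nil hornerC vL1.
have [|m m0 hm] := IH; first by move=> w wr; apply: hr; rewrite inE wr orbT.
have [|k k0 hk] := @root_away z; first by apply: hr; rewrite inE eqxx.
exists (k * m); first exact: mulr_gt0.
move=> x; rewrite big_cons hornerM hornerXsubC (absM vL).
by apply: ler_pM => //; exact: ltW.
Qed.

Lemma rational_bounded (f : pts -> L) : rational_fun f ->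
  exists2 B : R, 0 < B & forall x, absL (f x) <= B.
Proof.
case=> P [Q hf].
have [B B0 hB] := poly_bounded (map_poly emb P).
have [|m m0 hm] := @poly_away (map_poly emb Q); first by move=> x; case: (hf x).
exists (B / m); first exact: divr_gt0.
move=> x; case: (hf x) => _ ->; rewrite (absM vL) vLV.
apply: ler_pM; rewrite ?(abs_ge0 vL) ?invr_ge0 ?(abs_ge0 vL) //.
by rewrite lef_pV2 ?posrE ?(lt_le_trans m0 (hm x)).
Qed.

Lemma rational_is_HK (f : pts -> L) : rational_fun f -> is_HK f.
Proof. by move=> hf e e0; exists f => // x; rewrite subrr vL0. Qed.

Lemma rational_polyC (a : K) : rational_fun (fun=> emb a).
Proof.
by exists a%:P, 1%:P => x; rewrite !map_polyC /= rmorph1 !hornerC oner_eq0 divr1.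
Qed.

Lemma rational_id : rational_fun val.
Proof.
by exists 'X, 1%:P => x; rewrite map_polyX map_polyC /= rmorph1 hornerX hornerC oner_eq0 divr1.
Qed.

Lemma HK_subring : subring_closed HK_pred.
Proof.
split=> [|f g|f g].
- apply/asboolP/rational_is_HK; have [P [Q h]] := rational_polyC 1.
  by exists P, Q => x; case: (h x) => h1 <-; rewrite rmorph1.
- move=> /asboolP hf /asboolP hg; apply/asboolP => e e0.
  have [f1 [P [Q rf]] hf1] := hf _ e0; have [g1 [P' [Q' rg]] hg1] := hg _ e0.
  exists (fun x => f1 x - g1 x).
    exists (P * Q' - P' * Q), (Q * Q') => x.
    case: (rf x) (rg x) => q0 -> [q0' ->].
    rewrite rmorphB !rmorphM /= hornerD hornerN !hornerM mulf_neq0 //.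
    by split=> //; rewrite -mulNr addf_div // mulNr.
  move=> x; have -> : (f - g) x - (f1 x - g1 x) = (f x - f1 x) - (g x - g1 x).
    by rewrite /= !opprB addrACA [RHS]addrACA [- g x + _]addrC.
  apply: (le_lt_trans (abs_ultra vL _ _)).
  by rewrite gt_max hf1 vLN hg1.
- move=> /asboolP hf /asboolP hg; apply/asboolP => e e0.
  have [g0 rg0 hg0] := hg _ ltr01; have [B B0 hB] := rational_bounded rg0.
  have hgB x : absL (g x) <= 1 + B.
    rewrite -(subrK (g0 x) (g x)); apply: (le_trans (vLD _ _)).
    by apply: lerD => //; exact: ltW.
  have B1 : 0 < 1 + B by exact: addr_gt0.
  have [f1 rf hf1] := hf _ (divr_gt0 e0 B1).
  have [C C0 hC] := rational_bounded rf.
  have [g1 rg hg1] := hg _ (divr_gt0 e0 C0).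
  exists (fun x => f1 x * g1 x).
    case: rf rg => P [Q rf] [P' [Q' rg]].
    exists (P * P'), (Q * Q') => x.
    case: (rf x) (rg x) => q0 -> [q0' ->].
    by rewrite !rmorphM /= !hornerM mulf_neq0 // mulf_div.
  move=> x; have -> : (f * g) x - f1 x * g1 x =
      (f x - f1 x) * g x + f1 x * (g x - g1 x).
    by rewrite mulrBl mulrBr addrA subrK.
  apply: (le_lt_trans (abs_ultra vL _ _)); rewrite gt_max !(absM vL).
  apply/andP; split.
    apply: (@le_lt_trans _ _ (absL (f x - f1 x) * (1 + B))).
      by rewrite ler_wpM2l ?(abs_ge0 vL).
    by rewrite -ltr_pdivlMr.
  apply: (@le_lt_trans _ _ (C * absL (g x - g1 x))).
    by rewrite ler_wpM2r ?(abs_ge0 vL).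
  by rewrite mulrC -ltr_pdivlMr.
Qed.

Definition HK := {f : pts -> L | HK_pred f}.
HB.instance Definition _ := SubChoice.on HK.
HB.instance Definition _ :=
  GRing.SubChoice_isSubComPzRing.Build _ HK_pred HK HK_subring.

Definition ev (x : pts) (f : HK) : L := val f x.

Definition HK_const (a : K) : HK :=
  Sub (fun=> emb a) (asboolT (rational_is_HK (rational_polyC a))).

Definition HK_T : HK := Sub val (asboolT (rational_is_HK rational_id)).

(* The point q x; junk when q x is not in X. *)
Definition dilate (q : K) (x : pts) : pts := insubd x (emb q * val x).

(* f(T) |-> f(qT); junk outside of Q(X). *)
Definition sigma (q : K) (f : HK) : HK := insubd f (val f \o dilate q).

Definition Q_X : set K := [set q | [/\ q != 0,
  forall x : pts, in_aff (emb q * val x),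
  forall f : HK, is_HK (val f \o dilate q)
  & bijective (sigma q)]].

Definition discK (a : K) (rho : R) : set K := [set x | absK (x - a) < rho].

Definition Q1_X : set K := Q_X `&` discK 1 1.

Definition openK (U : set K) : Prop :=
  forall x, U x -> exists2 e : R, 0 < e & discK x e `<=` U.

Definition is_root_of_unity (q : K) : Prop :=
  exists n : nat, (0 < n)%N /\ q ^+ n = 1.

Definition nonroots (S : set K) : set K := [set q | S q /\ ~ is_root_of_unity q].

Definition gen (S : set K) : set K :=
  smallest (fun G : set K => [/\ G 1, forall a b, G a -> G b -> G (a * b)
                                & forall a, G a -> G a^-1]) S.

Definition is_derivative (f : pts -> L) (x : pts) (l : L) : Prop :=
  forall e : R, 0 < e -> exists2 d : R, 0 < d &
    forall y : pts, y != x -> absL (val y - val x) < d ->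
      absL ((f y - f x) / (val y - val x) - l) < e.

Definition ddT (f : HK) : HK :=
  insubd 0 (fun x : pts => xget 0 [set l | is_derivative (val f) x l]).

Definition delta1 (f : HK) : HK := HK_T * ddT f.

Definition tube (rho : R) (x y : pts) : Prop := absL (val x - val y) < rho.

Definition series_to (u : nat -> L) (s : L) : Prop :=
  forall e : R, 0 < e -> exists N, forall n, (N <= n)%N ->
    absL (\sum_(i < n) u i - s) < e.

(* For rho <= r_X the map (x, y) |-> (y, x - y) identifies U_rho with
   X * D^-(0, rho), so the analytic functions on U_rho are the power series
   in x - y over H_K(X) that converge for the sup-norm on |x - y| <= rho',
   for all rho' < rho. *)
Definition analytic_on_tube (rho : R) (F : pts -> pts -> L) : Prop :=
  exists a : nat -> HK,
    (forall rho', 0 < rho' -> rho' < rho -> forall e : R, 0 < e ->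
       exists N, forall n, (N <= n)%N -> forall y,
         absL (ev y (a n)) * rho' ^+ n < e) /\
    (forall x y, tube rho x y ->
       series_to (fun n => ev y (a n) * (val x - val y) ^+ n) (F x y)).

Definition analytic_mx_on_tube (n : nat) (rho : R) (Y : pts -> pts -> 'M[L]_n) :=
  forall i j, analytic_on_tube rho (fun x y => Y x y i j).

Definition qpoch (q : K) (x y : L) (n : nat) : L :=
  \prod_(i < n) (x - emb q ^+ i * y).

Definition qfact (q : K) (n : nat) : K :=
  \prod_(1 <= i < n.+1) ((q ^+ i - 1) / (q - 1)).

Definition qT (q : K) : HK := HK_const (q - 1) * HK_T.

(* D = d_q(B); multiplication by (q - 1)T is injective on H_K(X) for q <> 1, but
   not invertible if 0 is in X. *)
Definition is_dq (n : nat) (q : K) (B D : 'M[HK]_n) : Prop :=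
  qT q *: D = map_mx (sigma q) B - B.

Definition is_qTaylor_coef (n : nat) (q : K) (A : 'M[HK]_n)
    (H : nat -> 'M[HK]_n) : Prop :=
  [/\ H 0%N = 1%:M, qT q *: H 1%N = A - 1%:M &
      forall k, exists2 D, is_dq q (H k) D &
        H k.+1 = D + map_mx (sigma q) (H k) *m H 1%N].

Definition is_Taylor_coef (n : nat) (G : 'M[HK]_n)
    (H : nat -> 'M[HK]_n) : Prop :=
  [/\ H 0%N = 1%:M, HK_T *: H 1%N = G &
      forall k, H k.+1 = map_mx ddT (H k) + H k *m H 1%N].

(* Y is the sum on U_rho of the Taylor series Y_{A(q,T)}, and likewise of
   Y_{G(1,T)} below. *)
Definition is_qTaylor_sol (n : nat) (rho : R) (q : K) (A : 'M[HK]_n)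
    (Y : pts -> pts -> 'M[L]_n) : Prop :=
  exists2 H, is_qTaylor_coef q A H &
    forall x y, tube rho x y -> forall i j,
      series_to (fun k => ev y (H k i j) *
                          (qpoch q (val x) (val y) k / emb (qfact q k)))
                (Y x y i j).

Definition is_Taylor_sol (n : nat) (rho : R) (G : 'M[HK]_n)
    (Y : pts -> pts -> 'M[L]_n) : Prop :=
  exists2 H, is_Taylor_coef G H &
    forall x y, tube rho x y -> forall i j,
      series_to (fun k => ev y (H k i j) *
                          ((val x - val y) ^+ k / (k`!)%:R))
                (Y x y i j).

Definition solves_at (n : nat) (rho : R) (q : K) (A : 'M[HK]_n)
    (Y : pts -> pts -> 'M[L]_n) : Prop :=
  forall x y, tube rho x y -> Y (dilate q x) y = map_mx (ev x) A *m Y x y.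

Definition is_basis (M : lmodType HK) (n : nat) (e : 'I_n -> M) : Prop :=
  forall m, exists! c : 'rV[HK]_n, m = \sum_i c 0 i *: e i.

Definition is_matrix_of (M : lmodType HK) (n : nat) (e : 'I_n -> M)
    (f : M -> M) (A : 'M[HK]_n) : Prop :=
  forall i, f (e i) = \sum_j A i j *: e j.

Definition mod_close (M : lmodType HK) (n : nat) (e : 'I_n -> M) (eps : R)
    (m m' : M) : Prop :=
  exists2 c : 'rV[HK]_n, m - m' = \sum_i c 0 i *: e i &
    forall i x, absL (ev x (c 0 i)) <= eps.

(* Continuity for the topology of M, which does not depend on the basis *)
Definition mod_continuous (M : lmodType HK) (f : M -> M) : Prop :=
  forall (n : nat) (e : 'I_n -> M), is_basis e ->
    forall m (eps : R), 0 < eps -> exists2 d : R, 0 < d &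
      forall m', mod_close e d m m' -> mod_close e eps (f m) (f m').

(* The values of the action outside of <S> are junk.  The K-linearity of the
   operators is the case of constant f in semilinearity, and they are
   bijective because <S> is a group. *)
Record sigma_module (S : set K) := SigmaModule {
  sm_mod :> lmodType HK;
  sm_act : K -> sm_mod -> sm_mod;
  sm_free : exists n (e : 'I_n -> sm_mod), is_basis e;
  sm_actD : forall q, gen S q -> {morph sm_act q : m m' / m + m'};
  sm_act_semilin : forall q, gen S q -> forall (f : HK) m,
    sm_act q (f *: m) = sigma q f *: sm_act q m;
  sm_act_cont : forall q, gen S q -> mod_continuous (sm_act q);
  sm_act1 : forall m, sm_act 1 m = m;
  sm_actM : forall q q', gen S q -> gen S q' -> forall m,
    sm_act (q * q') m = sm_act q (sm_act q' m) }.

Record sd_module (S : set K) := SDModule {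
  sd_sigma :> sigma_module S;
  sd_conn : sd_sigma -> sd_sigma;
  sd_connD : {morph sd_conn : m m' / m + m'};
  sd_leibniz : forall (f : HK) m,
    sd_conn (f *: m) = delta1 f *: m + f *: sd_conn m }.

Definition is_sigma_hom (S : set K) (M N : sigma_module S) (f : M -> N) : Prop :=
  linear f /\ forall q, S q -> forall m, f (sm_act q m) = sm_act q (f m).

Definition is_sd_hom (S : set K) (M N : sd_module S) (f : M -> N) : Prop :=
  is_sigma_hom f /\ forall m, f (sd_conn m) = sd_conn (f m).

(* sigma-Mod^[r]_S, for S included in Q_1(X) with an element that is not a
   root of unity; admissibility does not depend on the basis e. *)
Definition sigma_adm_r (S : set K) (r : R) (M : sigma_module S) : Prop :=
  S `<=` discK 1 (r / rho_X) /\
  exists n (e : 'I_n -> M) (A : K -> 'M[HK]_n) (rho : R)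
         (Y : pts -> pts -> 'M[L]_n),
    [/\ is_basis e,
        forall q, S q -> is_matrix_of e (sm_act q) (A q),
        r <= rho <= r_X /\ analytic_mx_on_tube rho Y,
        forall q, nonroots S q -> is_qTaylor_sol rho q (A q) Y &
        forall q, S q -> solves_at rho q (A q) Y].

Definition sd_adm_r (S : set K) (r : R) (M : sd_module S) : Prop :=
  S `<=` discK 1 (r / rho_X) /\
  exists n (e : 'I_n -> M) (A : K -> 'M[HK]_n) (G : 'M[HK]_n) (rho : R)
         (Y : pts -> pts -> 'M[L]_n),
    [/\ is_basis e,
        (forall q, S q -> is_matrix_of e (sm_act q) (A q)) /\
        is_matrix_of e (@sd_conn S M) G,
        r <= rho <= r_X /\ analytic_mx_on_tube rho Y,
        is_Taylor_sol rho G Y &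
        forall q, S q -> solves_at rho q (A q) Y].

Definition sigma_adm (S : set K) (M : sigma_module S) : Prop :=
  exists r : R, 0 < r <= r_X /\ sigma_adm_r r M.

Definition sd_adm (S : set K) (M : sd_module S) : Prop :=
  exists r : R, 0 < r <= r_X /\ sd_adm_r r M.

Lemma sub_gen (S S' : set K) : S' `<=` S -> gen S' `<=` gen S.
Proof. by move=> sS x hx G [GG SG]; apply: hx; split=> // y /sS/SG. Qed.

Section Restriction.
Variables (S S' : set K) (sS : S' `<=` S).

Definition sigma_res (M : sigma_module S) : sigma_module S' :=
  @SigmaModule S' M (@sm_act S M) (sm_free M)
    (fun q h => sm_actD (sub_gen sS h))
    (fun q h => sm_act_semilin (sub_gen sS h))
    (fun q h => sm_act_cont (sub_gen sS h))
    (@sm_act1 S M)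
    (fun q q' h h' => sm_actM (sub_gen sS h) (sub_gen sS h')).

Definition sd_res (M : sd_module S) : sd_module S' :=
  @SDModule S' (sigma_res M) (@sd_conn S M) (@sd_connD S M) (@sd_leibniz S M).

Lemma sigma_res_adm (M : sigma_module S) : sigma_adm M -> sigma_adm (sigma_res M).
Proof.
move=> [r [hr [Sr [n [e [A [rho [Y [he hA hY h1 h2]]]]]]]]].
exists r; split=> //; split; first exact: (subset_trans sS Sr).
exists n, e, A, rho, Y; split=> // q.
- by move=> /sS; apply: hA.
- by move=> [/sS Sq nq]; apply: h1; split.
- by move=> /sS; apply: h2.
Qed.

Lemma sd_res_adm (M : sd_module S) : sd_adm M -> sd_adm (sd_res M).
Proof.
move=> [r [hr [Sr [n [e [A [G [rho [Y [he [hA hG] hY h1 h2]]]]]]]]]].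
exists r; split=> //; split; first exact: (subset_trans sS Sr).
exists n, e, A, G, rho, Y; split=> //; last by move=> q /sS; apply: h2.
by split=> // q /sS; apply: hA.
Qed.

Lemma sigma_res_hom (M N : sigma_module S) (f : M -> N) :
  is_sigma_hom f -> @is_sigma_hom S' (sigma_res M) (sigma_res N) f.
Proof. by move=> [fl fs]; split=> // q /sS; apply: fs. Qed.

Lemma sd_res_hom (M N : sd_module S) (f : M -> N) :
  is_sd_hom f -> @is_sd_hom S' (sd_res M) (sd_res N) f.
Proof. by move=> [fs fd]; split=> //; apply: sigma_res_hom. Qed.

End Restriction.

End Affinoid.

Record category := Category {
  cat_obj :> Type;
  cat_hom : cat_obj -> cat_obj -> Type;
  cat_id : forall a, cat_hom a a;
  cat_comp : forall a b c, cat_hom b c -> cat_hom a b -> cat_hom a c;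
  cat_comp1m : forall a b (f : cat_hom a b), cat_comp (cat_id b) f = f;
  cat_compm1 : forall a b (f : cat_hom a b), cat_comp f (cat_id a) = f;
  cat_compA : forall a b c d (h : cat_hom c d) (g : cat_hom b c) (f : cat_hom a b),
    cat_comp h (cat_comp g f) = cat_comp (cat_comp h g) f }.

Record functor (C D : category) := Functor {
  fobj :> C -> D;
  fmap : forall a b, cat_hom a b -> cat_hom (fobj a) (fobj b);
  fmap1 : forall a, fmap (cat_id a) = cat_id (fobj a);
  fmapM : forall a b c (g : cat_hom b c) (f : cat_hom a b),
    fmap (cat_comp g f) = cat_comp (fmap g) (fmap f) }.

Definition functor_id (C : category) : functor C C :=
  @Functor C C id (fun _ _ f => f) (fun _ => erefl) (fun _ _ _ _ _ => erefl).

Definition functor_comp (C D E : category) (G : functor D E) (F : functor C D) :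
  functor C E :=
  @Functor C E (fun a => G (F a)) (fun _ _ f => fmap G (fmap F f))
    (fun a => etrans (congr1 (fun f => fmap G f) (fmap1 F a)) (fmap1 G (F a)))
    (fun a b c g f => etrans (congr1 (fun h => fmap G h) (fmapM F g f))
                             (fmapM G (fmap F g) (fmap F f))).

Record nat_iso (C D : category) (F G : functor C D) := NatIso {
  ni_fun : forall a, cat_hom (F a) (G a);
  ni_inv : forall a, cat_hom (G a) (F a);
  ni_funK : forall a, cat_comp (ni_inv a) (ni_fun a) = cat_id (F a);
  ni_invK : forall a, cat_comp (ni_fun a) (ni_inv a) = cat_id (G a);
  ni_nat : forall a b (f : cat_hom a b),
    cat_comp (fmap G f) (ni_fun a) = cat_comp (ni_fun b) (fmap F f) }.

Definition is_equivalence (C D : category) (F : functor C D) : Prop :=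
  exists G : functor D C,
    inhabited (nat_iso (functor_id C) (functor_comp G F)) /\
    inhabited (nat_iso (functor_comp F G) (functor_id D)).

Section SigCategory.
Variables (T : Type) (car : T -> Type) (P : forall a b, (car a -> car b) -> Prop).
Hypothesis P1 : forall a, @P a a id.
Hypothesis PM : forall a b c (g : car b -> car c) (f : car a -> car b),
  P g -> P f -> P (g \o f).

Lemma sig_fun_inj a b (f g : {f | @P a b f}) : sval f = sval g -> f = g.
Proof. by case: f g => f Pf [g Pg] /= h; apply: eq_exist. Qed.

Definition sig_id a : {f | @P a a f} := exist _ id (P1 a).

Definition sig_comp a b c (g : {f | @P b c f}) (f : {f | @P a b f}) :
  {f | @P a c f} := exist _ (sval g \o sval f) (PM (svalP g) (svalP f)).

Lemma sig_comp1m a b (f : {f | @P a b f}) : sig_comp (sig_id b) f = f.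
Proof. exact: sig_fun_inj. Qed.

Lemma sig_compm1 a b (f : {f | @P a b f}) : sig_comp f (sig_id a) = f.
Proof. exact: sig_fun_inj. Qed.

Lemma sig_compA a b c d (h : {f | @P c d f}) (g : {f | @P b c f})
    (f : {f | @P a b f}) :
  sig_comp h (sig_comp g f) = sig_comp (sig_comp h g) f.
Proof. exact: sig_fun_inj. Qed.

Definition sig_category : category :=
  Category sig_comp1m sig_compm1 sig_compA.

End SigCategory.

Section ModuleCategories.
Variables (R : realType) (p : nat) (K : mixedCharField R p).
Variables (L : algClosure K) (X : affinoid K).

Lemma sigma_hom1 (S : set K) (M : sigma_module L X S) :
  @is_sigma_hom _ _ _ L X S M M id.
Proof. by split=> // ? ? ?. Qed.

Lemma sigma_homM (S : set K) (M N P : sigma_module L X S) (g : N -> P) (f : M -> N) :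
  is_sigma_hom g -> is_sigma_hom f -> is_sigma_hom (g \o f).
Proof.
move=> [gl gs] [fl fs]; split=> [a u v|q Sq m] /=; first by rewrite fl gl.
by rewrite fs // gs.
Qed.

Lemma sd_hom1 (S : set K) (M : sd_module L X S) : @is_sd_hom _ _ _ L X S M M id.
Proof. by split=> //; apply: sigma_hom1. Qed.

Lemma sd_homM (S : set K) (M N P : sd_module L X S) (g : N -> P) (f : M -> N) :
  is_sd_hom g -> is_sd_hom f -> is_sd_hom (g \o f).
Proof.
move=> [gs gd] [fs fd]; split; first exact: sigma_homM.
by move=> m /=; rewrite fd gd.
Qed.

Definition sigma_adm_cat (S : set K) : category :=
  @sig_category {M : sigma_module L X S | sigma_adm M} (fun M => sval M)
    (fun M N f => is_sigma_hom f) (fun M => sigma_hom1 (sval M))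
    (fun M N P g f => @sigma_homM S (sval M) (sval N) (sval P) g f).

Definition sd_adm_cat (S : set K) : category :=
  @sig_category {M : sd_module L X S | sd_adm M} (fun M => sval M)
    (fun M N f => is_sd_hom f) (fun M => sd_hom1 (sval M))
    (fun M N P g f => @sd_homM S (sval M) (sval N) (sval P) g f).

Definition open_nbhd (q : K) (U : set K) : Prop :=
  [/\ U `<=` Q1_X L X, openK U & U q].

Lemma open_nbhdI (q : K) (U V : set K) :
  open_nbhd q U -> open_nbhd q V -> open_nbhd q (U `&` V).
Proof.
move=> [UQ Uo Uq] [_ Vo Vq]; split=> // [x [/UQ//]|x [Ux Vx]].
have [e e0 he] := Uo _ Ux; have [d d0 hd] := Vo _ Vx.
exists (Num.min e d); first by rewrite lt_min e0 d0.
move=> y; rewrite /discK /= lt_min => /andP[ye yd].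
by split; [apply: he|apply: hd].
Qed.

Variable q : K.

(* The direct limit of the categories over the open neighborhoods U of q: the
   objects are the pairs (U, M), and the morphisms are the direct limit over V
   of the morphisms between the restrictions to V; as restriction does not
   change the underlying maps, this limit is a union. *)
Record sigma_germ := SigmaGerm {
  sg_set : set K;
  sg_nbhd : open_nbhd q sg_set;
  sg_mod :> sigma_module L X sg_set;
  sg_adm : sigma_adm sg_mod }.

Record sd_germ := SDGerm {
  dg_set : set K;
  dg_nbhd : open_nbhd q dg_set;
  dg_mod :> sd_module L X dg_set;
  dg_adm : sd_adm dg_mod }.

Definition is_sigma_germ_hom (M N : sigma_germ) (f : M -> N) : Prop :=
  exists (V : set K) (VM : V `<=` sg_set M) (VN : V `<=` sg_set N),
    open_nbhd q V /\ @is_sigma_hom _ _ _ L X V (sigma_res VM M) (sigma_res VN N) f.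

Definition is_sd_germ_hom (M N : sd_germ) (f : M -> N) : Prop :=
  exists (V : set K) (VM : V `<=` dg_set M) (VN : V `<=` dg_set N),
    open_nbhd q V /\ @is_sd_hom _ _ _ L X V (sd_res VM M) (sd_res VN N) f.

Lemma sigma_germ_hom1 (M : sigma_germ) : @is_sigma_germ_hom M M id.
Proof.
exists (sg_set M), (@subset_refl _ _), (@subset_refl _ _).
by split; [exact: sg_nbhd | exact: sigma_hom1].
Qed.

Lemma sigma_germ_homM (M N P : sigma_germ) (g : N -> P) (f : M -> N) :
  is_sigma_germ_hom g -> is_sigma_germ_hom f -> is_sigma_germ_hom (g \o f).
Proof.
move=> [V [VN [VP [Vq [gl gs]]]]] [W [WM [WN [Wq [fl fs]]]]].
exists (V `&` W), (fun x h => WM x h.2), (fun x h => VP x h.1).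
split; first exact: open_nbhdI.
split=> [a u v|x [Vx Wx] m] /=; first by rewrite fl gl.
by have /= -> := fs _ Wx m; apply: gs.
Qed.

Lemma sd_germ_hom1 (M : sd_germ) : @is_sd_germ_hom M M id.
Proof.
exists (dg_set M), (@subset_refl _ _), (@subset_refl _ _).
by split; [exact: dg_nbhd | exact: sd_hom1].
Qed.

Lemma sd_germ_homM (M N P : sd_germ) (g : N -> P) (f : M -> N) :
  is_sd_germ_hom g -> is_sd_germ_hom f -> is_sd_germ_hom (g \o f).
Proof.
move=> [V [VN [VP [Vq [[gl gs] gd]]]]] [W [WM [WN [Wq [[fl fs] fd]]]]].
exists (V `&` W), (fun x h => WM x h.2), (fun x h => VP x h.1).
split; first exact: open_nbhdI.
split; last by move=> m /=; have /= -> := fd m; apply: gd.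
split=> [a u v|x [Vx Wx] m] /=; first by rewrite fl gl.
by have /= -> := fs _ Wx m; apply: gs.
Qed.

Definition sigma_germ_cat : category :=
  @sig_category sigma_germ (fun M => M) is_sigma_germ_hom
    sigma_germ_hom1 sigma_germ_homM.

Definition sd_germ_cat : category :=
  @sig_category sd_germ (fun M => M) is_sd_germ_hom
    sd_germ_hom1 sd_germ_homM.

Lemma nbhd_sub1 (U : set K) : open_nbhd q U -> [set q] `<=` U.
Proof. by move=> [_ _ Uq] x ->. Qed.

Definition sigma_Res_obj (M : sigma_germ) : sigma_adm_cat [set q] :=
  exist _ (sigma_res (nbhd_sub1 (sg_nbhd M)) M)
    (sigma_res_adm (nbhd_sub1 (sg_nbhd M)) (sg_adm M)).

Definition sd_Res_obj (M : sd_germ) : sd_adm_cat [set q] :=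
  exist _ (sd_res (nbhd_sub1 (dg_nbhd M)) M)
    (sd_res_adm (nbhd_sub1 (dg_nbhd M)) (dg_adm M)).

Lemma sigma_Res_hom (M N : sigma_germ) (f : M -> N) : is_sigma_germ_hom f ->
  is_sigma_hom (f : sval (sigma_Res_obj M) -> sval (sigma_Res_obj N)).
Proof.
move=> [V [VM [VN [[_ _ Vq] [fl fs]]]]]; split=> // x -> m; exact: fs.
Qed.

Lemma sd_Res_hom (M N : sd_germ) (f : M -> N) : is_sd_germ_hom f ->
  is_sd_hom (f : sval (sd_Res_obj M) -> sval (sd_Res_obj N)).
Proof.
move=> [V [VM [VN [[_ _ Vq] [[fl fs] fd]]]]]; split=> //; split=> // x -> m.
exact: fs.
Qed.

Definition sigma_Res_map (M N : sigma_germ_cat) (f : cat_hom M N) :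
  cat_hom (sigma_Res_obj M) (sigma_Res_obj N) :=
  exist _ (sval f) (sigma_Res_hom (svalP f)).

Lemma sigma_Res_map1 (M : sigma_germ_cat) :
  sigma_Res_map (cat_id M) = cat_id (sigma_Res_obj M).
Proof. exact: sig_fun_inj. Qed.

Lemma sigma_Res_mapM (M N P : sigma_germ_cat) (g : cat_hom N P) (f : cat_hom M N) :
  sigma_Res_map (cat_comp g f) = cat_comp (sigma_Res_map g) (sigma_Res_map f).
Proof. exact: sig_fun_inj. Qed.

Definition sigma_Res : functor sigma_germ_cat (sigma_adm_cat [set q]) :=
  @Functor sigma_germ_cat (sigma_adm_cat [set q]) sigma_Res_obj
    sigma_Res_map sigma_Res_map1 sigma_Res_mapM.

Definition sd_Res_map (M N : sd_germ_cat) (f : cat_hom M N) :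
  cat_hom (sd_Res_obj M) (sd_Res_obj N) :=
  exist _ (sval f) (sd_Res_hom (svalP f)).

Lemma sd_Res_map1 (M : sd_germ_cat) :
  sd_Res_map (cat_id M) = cat_id (sd_Res_obj M).
Proof. exact: sig_fun_inj. Qed.

Lemma sd_Res_mapM (M N P : sd_germ_cat) (g : cat_hom N P) (f : cat_hom M N) :
  sd_Res_map (cat_comp g f) = cat_comp (sd_Res_map g) (sd_Res_map f).
Proof. exact: sig_fun_inj. Qed.

Definition sd_Res : functor sd_germ_cat (sd_adm_cat [set q]) :=
  @Functor sd_germ_cat (sd_adm_cat [set q]) sd_Res_obj
    sd_Res_map sd_Res_map1 sd_Res_mapM.

End ModuleCategories.

(* Main.v *)
(** Put U = D^-(1, r / max(|c_0|, R_0)), a group of dilations of X that preserve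
    every disc of radius R >= r.  If Y(x, y) is the Taylor solution of an
    admissible module, analytic on U_R, then

      Y(x, y) Y(y, z) = Y(x, z),                                          (1)

    so the matrices A(q', T) := Y(q' T, T), q' in U, satisfy the cocycle
    relation A(q q', T) = A(q', q T) A(q, T) and extend the action from q to U;
    reading the Taylor coefficients of Y(., y) in the basis (x - y)_{q',n} shows
    that Y is also the Taylor solution for q'.  Likewise, if F is the matrix of
    a morphism between two admissible modules with solutions Y and Y', then

      F(x) Y'(x, y) = Y(x, y) F(y),                                       (2)

    and x = q' y gives the compatibility with sigma_{q'}.

    For q-difference equations, both sides of (1) and (2) are solutions, in x, of
    the same equation that agree at one point, and two such analytic functions
    agree on the orbit q^i y, hence coincide, as a function analytic on a disc
    around y is the sum of its Newton series with nodes q^i y.  For differential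
    equations, F(x) Y'(x, y) = sum_k D^k(F)(y) (x - y)^k / k! for every matrix F
    over H_K(X), where D(B) = B' + B H'_1; here D^k(H'_n) = H'_{n+k}, which gives
    (1), and D^k(F) = H_k F for the matrix F of a morphism, which gives (2). *)

Require Import Defs.
From HB Require Import structures.
From mathcomp Require Import all_boot all_order all_algebra.
From mathcomp Require Import all_classical all_reals.
From mathcomp Require Import cyclic separable cyclotomic.
From mathcomp Require Import ring zify.

Set Implicit Arguments.
Unset Strict Implicit.
Unset Printing Implicit Defensive.

Import Order.TTheory GRing.Theory Num.Theory.

Local Open Scope classical_set_scope.
Local Open Scope ring_scope.

(** * Series in ultrametric fields *)

(** Functions live on the points of X over K^alg, which need not be complete, and H_K(X) is a
    uniform closure, so its calculus has to be derived. Limits exist pointwise because the values at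
    x of all elements of H_K(X) lie in one finite-dimensional K-subspace of K^alg. Cauchy estimates
    for rational functions, with constants that survive uniform limits, then provide derivatives in
    H_K(X) and Taylor expansions on all discs of radius [r_X]. The radius of U is dictated by |q x -
    x| <= |q - 1| max(|c_0|, R_0): a dilation in U moves every point by less than r, so (q x, x)
    stays in the domain of Y. Division by (q - 1) T fails at 0 when 0 is in X. Identities involving
    d_q are therefore proved at nonzero points; at 0 they are trivial, as dilations fix 0 and Y(0,
    0) = 1. Restriction leaves the underlying map of a morphism unchanged, which makes faithfulness
    immediate; an extended module has the same underlying module, so the identity map is the
    required isomorphism. *)

Section UltrametricSeries.
Variables (R : realType) (p : nat) (K : mixedCharField R p) (L : algClosure K).

Local Notation v := (@acl_abs R p K L).
Local Notation emb := (acl_emb L).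
Let vL := acl_absP L.

Lemma v_ge0 (x : L) : 0 <= v x. Proof. exact: abs_ge0 vL x. Qed.

Lemma vM (x y : L) : v (x * y) = v x * v y. Proof. exact: absM vL x y. Qed.

Lemma vX (x : L) n : v (x ^+ n) = v x ^+ n.
Proof. by elim: n => [|n IH]; rewrite ?expr0 ?vL1// !exprS vM IH. Qed.

Lemma v_add_le (x y : L) e : v x <= e -> v y <= e -> v (x + y) <= e.
Proof. by move=> hx hy; apply: le_trans (abs_ultra vL x y) _; rewrite ge_max hx. Qed.

Lemma v_add_lt (x y : L) e : v x < e -> v y < e -> v (x + y) < e.
Proof. by move=> hx hy; apply: le_lt_trans (abs_ultra vL x y) _; rewrite gt_max hx. Qed.

Lemma v_sub_le (x y : L) e : v x <= e -> v y <= e -> v (x - y) <= e.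
Proof. by move=> hx hy; apply: v_add_le => //; rewrite vLN. Qed.

Lemma v_sub_lt (x y : L) e : v x < e -> v y < e -> v (x - y) < e.
Proof. by move=> hx hy; apply: v_add_lt => //; rewrite vLN. Qed.

Lemma v_distC (x y : L) : v (x - y) = v (y - x).
Proof. by rewrite -vLN opprB. Qed.

Lemma v_dist_le (z x y : L) e : v (x - z) <= e -> v (z - y) <= e -> v (x - y) <= e.
Proof. by move=> h1 h2; rewrite -(subrKA z); apply: v_add_le. Qed.

Lemma v_dist_lt (z x y : L) e : v (x - z) < e -> v (z - y) < e -> v (x - y) < e.
Proof. by move=> h1 h2; rewrite -(subrKA z); apply: v_add_lt. Qed.

Lemma v_sum_le (I : Type) (s : seq I) (P : pred I) (F : I -> L) e : 0 <= e ->
  (forall i, P i -> v (F i) <= e) -> v (\sum_(i <- s | P i) F i) <= e.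
Proof.
move=> e0 h; elim/big_ind: _ => [|x y|]; [by rewrite vL0 | exact: v_add_le | exact: h].
Qed.

Lemma v_sum_lt (I : Type) (s : seq I) (P : pred I) (F : I -> L) e : 0 < e ->
  (forall i, P i -> v (F i) < e) -> v (\sum_(i <- s | P i) F i) < e.
Proof.
move=> e0 h; elim/big_ind: _ => [|x y|]; [by rewrite vL0 | exact: v_add_lt | exact: h].
Qed.

Lemma v_eq0 (x : L) : v x = 0 -> x = 0. Proof. by move/(abs_eq0 vL). Qed.

Lemma v_small_eq0 (x : L) : (forall e, 0 < e -> v x < e) -> x = 0.
Proof.
move=> h; apply: v_eq0; apply/eqP; rewrite eq_le v_ge0 andbT leNgt.
by apply/negP => /h; rewrite ltxx.
Qed.

Lemma v_small_eq (x y : L) : (forall e, 0 < e -> v (x - y) < e) -> x = y.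
Proof. by move=> h; apply/eqP; rewrite -subr_eq0; apply/eqP/v_small_eq0. Qed.

Lemma v_nat_le1 n : v n%:R <= 1.
Proof.
elim: n => [|n IH]; first by rewrite vL0 ler01.
by rewrite -addn1 natrD; apply: v_add_le => //; rewrite vL1.
Qed.

Lemma emb_natr n : emb n%:R = n%:R. Proof. exact: rmorph_nat. Qed.

Lemma L_pchar0 : [pchar L] =i pred0.
Proof. by move=> i; rewrite (fmorph_pchar emb) (mcf_pchar0 K). Qed.

Lemma natL_eq0 n : (n%:R == 0 :> L) = (n == 0%N).
Proof. by rewrite ((pcharf0P L).1 L_pchar0). Qed.

Lemma fact_neq0 n : (n`!)%:R != 0 :> L.
Proof. by rewrite natL_eq0 -lt0n fact_gt0. Qed.

Lemma series_unique (u : nat -> L) s t : series_to u s -> series_to u t -> s = t.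
Proof.
move=> hs ht; apply: v_small_eq => e e0.
have [N1 h1] := hs _ e0; have [N2 h2] := ht _ e0.
apply: (v_dist_lt (z := \sum_(i < maxn N1 N2) u i)).
  by rewrite v_distC h1 ?leq_maxl.
by rewrite h2 ?leq_maxr.
Qed.

Lemma series_ext (u w : nat -> L) s : u =1 w -> series_to u s -> series_to w s.
Proof.
move=> uw h e /h[N hN]; exists N => n /hN.
by under eq_bigr do rewrite uw.
Qed.

Lemma seriesD (u w : nat -> L) s t : series_to u s -> series_to w t ->
  series_to (fun n => u n + w n) (s + t).
Proof.
move=> hs ht e e0; have [N1 h1] := hs _ e0; have [N2 h2] := ht _ e0.
exists (maxn N1 N2) => n; rewrite geq_max => /andP[n1 n2].
rewrite big_split /= opprD addrACA; apply: v_add_lt; [exact: h1 | exact: h2].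
Qed.

Lemma seriesZ (a : L) (u : nat -> L) s : series_to u s ->
  series_to (fun n => a * u n) (a * s).
Proof.
move=> hs e e0; have [->|a0] := eqVneq a 0.
  exists 0%N => n _; rewrite big1 ?mul0r ?subrr ?vL0// => i _; exact: mul0r.
have va : 0 < v a by exact: vL_gt0.
have [N h] := hs _ (divr_gt0 e0 va); exists N => n /h.
by rewrite ltr_pdivlMr // mulrC -vM mulrBr mulr_sumr.
Qed.

Lemma seriesMr (a : L) (u : nat -> L) s : series_to u s ->
  series_to (fun n => u n * a) (s * a).
Proof. by move=> /(@seriesZ a); rewrite mulrC; apply: series_ext => n; rewrite mulrC. Qed.

Lemma seriesN (u : nat -> L) s : series_to u s -> series_to (fun n => - u n) (- s).
Proof. by move=> /(seriesZ (-1)); rewrite mulN1r; apply: series_ext => n; rewrite mulN1r. Qed.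

Lemma seriesB (u w : nat -> L) s t : series_to u s -> series_to w t ->
  series_to (fun n => u n - w n) (s - t).
Proof. by move=> hu /seriesN; exact: seriesD. Qed.

Lemma series0 : series_to (fun=> 0 : L) 0.
Proof. by move=> e e0; exists 0%N => n _; rewrite big1 // subrr vL0. Qed.

Lemma series_sum (I : Type) (r : seq I) (P : pred I) (u : I -> nat -> L) (s : I -> L) :
  (forall i, P i -> series_to (u i) (s i)) ->
  series_to (fun n => \sum_(i <- r | P i) u i n) (\sum_(i <- r | P i) s i).
Proof.
move=> h; elim: r => [|i r IH].
  by rewrite big_nil; apply: series_ext series0 => n; rewrite big_nil.
rewrite big_cons; case: ifP => Pi.
  by apply: series_ext (seriesD (h i Pi) IH) => n; rewrite big_cons Pi.
by apply: series_ext IH => n; rewrite big_cons Pi.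
Qed.

Lemma series_finite (u : nat -> L) N : (forall n, (N <= n)%N -> u n = 0) ->
  series_to u (\sum_(i < N) u i).
Proof.
move=> h e e0; exists N => n Nn.
rewrite -(big_mkord xpredT) -[X in _ - X](big_mkord xpredT) (big_cat_nat (leq0n N) Nn) /=.
rewrite addrAC subrr add0r big_nat big1 ?vL0 // => i /andP[/h//].
Qed.

Lemma series_term0 (u : nat -> L) s : series_to u s ->
  forall e, 0 < e -> exists N, forall n, (N <= n)%N -> v (u n) < e.
Proof.
move=> h e /h[N hN]; exists N => n Nn.
have -> : u n = (\sum_(i < n.+1) u i - s) - (\sum_(i < n) u i - s).
  by rewrite big_ord_recr /=; ring.
by apply: v_sub_lt; apply: hN => //; exact: leqW.
Qed.

Lemma series_term_bounded (u : nat -> L) s : series_to u s ->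
  exists2 C, 0 < C & forall n, v (u n) <= C.
Proof.
move=> /series_term0/(_ 1 ltr01)[N hN].
exists (1 + \sum_(i < N) v (u i)).
  by rewrite ltr_pwDl // sumr_ge0 // => i _; exact: v_ge0.
move=> n; have [/hN/ltW h|nN] := leqP N n.
  by apply: le_trans h _; rewrite lerDl sumr_ge0 // => i _; exact: v_ge0.
rewrite (bigD1 (Ordinal nN)) //= addrCA lerDl addr_ge0 // sumr_ge0 // => i _.
exact: v_ge0.
Qed.

Lemma v_tail (u : nat -> L) n N e : (n <= N)%N -> 0 <= e ->
  (forall m, (n <= m)%N -> v (u m) <= e) ->
  v (\sum_(i < N) u i - \sum_(i < n) u i) <= e.
Proof.
move=> nN e0 h.
rewrite -(big_mkord xpredT) -[X in _ - X](big_mkord xpredT) (big_cat_nat (leq0n n) nN) /=.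
rewrite addrAC subrr add0r big_nat; apply: v_sum_le => // i /andP[/h//].
Qed.

Lemma series_tail (u : nat -> L) s n e : series_to u s -> 0 <= e ->
  (forall m, (n <= m)%N -> v (u m) <= e) -> v (\sum_(i < n) u i - s) <= e.
Proof.
move=> hs e0 h; rewrite leNgt; apply/negP => he.
have [N hN] := hs _ (le_lt_trans e0 he).
have := hN _ (leq_maxl N n); set m := maxn N n => hm.
have : v (\sum_(i < n) u i - s) < v (\sum_(i < n) u i - s).
  apply: (v_dist_lt (z := \sum_(i < m) u i)) => //.
  rewrite v_distC; apply: le_lt_trans he.
  by apply: v_tail => //; exact: leq_maxr.
by rewrite ltxx.
Qed.

(** Exchange of the orders of summation over pairs n <= k: [w n] is the sum of column n, the inner
    sums are the rows. Truncated at M, the two differ by tails of columns, whose terms all have k >=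
    M. The column sums are given beforehand because L need not be complete; both directions of the
    equivalence serve later. *)
Lemma series_rearr (u : nat -> nat -> L) (w : nat -> L) :
  (forall e, 0 < e -> exists N, forall k n, (N <= k)%N -> (n <= k)%N -> v (u k n) < e) ->
  (forall n, series_to (fun m => u (n + m)%N n) (w n)) ->
  forall S, series_to w S <-> series_to (fun k => \sum_(n < k.+1) u k n) S.
Proof.
move=> hu hw.
have key e : 0 < e -> exists N, forall M, (N <= M)%N ->
    v (\sum_(k < M) \sum_(n < k.+1) u k n - \sum_(n < M) w n) < e.
  move=> e0; have [N hN] := hu _ (divr_gt0 e0 (ltr0Sn _ 1)); exists N => M NM.
  have -> : \sum_(k < M) \sum_(n < k.+1) u k n =
            \sum_(n < M) \sum_(m < M - n) u (n + m)%N n.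
    elim: M {NM} => [|M IH]; first by rewrite !big_ord0.
    rewrite big_ord_recr /= IH [in RHS]big_ord_recr /= subSn // subnn big_ord1 addn0.
    rewrite [X in _ + X]big_ord_recr /= addrA -big_split /=; congr (_ + _).
    apply: eq_bigr => i _; rewrite (subSn (ltnW (ltn_ord i))) big_ord_recr /=.
    by rewrite subnKC // ltnW.
  have e2 : e / 2 < e by rewrite ltr_pdivrMr // mulr_natr mulr2n ltrDl.
  rewrite -sumrB; apply: le_lt_trans e2; apply: v_sum_le => [|i _].
    by rewrite ltW // divr_gt0.
  apply: (series_tail (hw i)) => [|m hm]; first by rewrite ltW // divr_gt0.
  apply/ltW/hN; last exact: leq_addr.
  by apply: leq_trans NM _; rewrite -leq_subLR.
move=> S; split=> h e e0; have [N hN] := key _ e0; have [N' hN'] := h _ e0;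
  exists (maxn N N') => n; rewrite geq_max => /andP[n1 n2].
  exact: v_dist_lt (hN _ n1) (hN' _ n2).
by apply: (v_dist_lt _ (hN' _ n2)); rewrite v_distC hN.
Qed.

Lemma cauchy_prod (a b : nat -> L) s t : series_to a s -> series_to b t ->
  series_to (fun k => \sum_(i < k.+1) a i * b (k - i)%N) (s * t).
Proof.
move=> ha hb.
have [A A0 hA] := series_term_bounded ha.
have [B B0 hB] := series_term_bounded hb.
apply: (series_rearr (u := fun k n => a n * b (k - n)%N) (w := fun n => a n * t) _ _ _).1.
- move=> e e0; have [N1 h1] := series_term0 ha (divr_gt0 e0 B0).
  have [N2 h2] := series_term0 hb (divr_gt0 e0 A0).
  exists (N1 + N2)%N => k n kN nk; rewrite vM.
  have [N1n|nN1] := leqP N1 n.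
    apply: (@le_lt_trans _ _ (v (a n) * B)); first by rewrite ler_wpM2l ?v_ge0.
    by rewrite -ltr_pdivlMr // h1.
  apply: (@le_lt_trans _ _ (A * v (b (k - n)%N))); first by rewrite ler_wpM2r ?v_ge0.
  by rewrite mulrC -ltr_pdivlMr // h2 // leq_subRL // (leq_trans _ kN) // leq_add2r ltnW.
- move=> n; apply: series_ext (seriesZ (a n) hb) => m; by rewrite addKn.
- exact: seriesMr.
Qed.

End UltrametricSeries.

(** * Completeness of finite-dimensional subspaces *)

Section FiniteDimensionalCompleteness.
Variables (R : realType) (p : nat) (K : mixedCharField R p) (L : algClosure K).

Local Notation v := (@acl_abs R p K L).
Local Notation emb := (acl_emb L).

(* L need not be complete, but the values at a point x of the elements of H_K(X) lie
   in K(x), which is: this is what makes limits in H_K(X) exist. *)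
Definition Kspan (s : seq L) (x : L) : Prop :=
  exists c : nat -> K, x = \sum_(i < size s) emb (c i) * s`_i.

Definition cauchy_seq (u : nat -> L) : Prop :=
  forall e, 0 < e -> exists N, forall m n, (N <= m)%N -> (N <= n)%N ->
    v (u m - u n) < e.

Definition cvg_seq (u : nat -> L) (l : L) : Prop :=
  forall e, 0 < e -> exists N, forall n, (N <= n)%N -> v (u n - l) < e.

Lemma Kspan_lin s (a : K) x y : Kspan s x -> Kspan s y -> Kspan s (emb a * x + y).
Proof.
move=> [c ->] [d ->]; exists (fun i => a * c i + d i).
rewrite mulr_sumr -big_split /=; apply: eq_bigr => i _.
by rewrite rmorphD rmorphM /= mulrDl mulrA.
Qed.

Lemma Kspan0 s : Kspan s 0.
Proof. by exists (fun=> 0); rewrite big1 // => i _; rewrite rmorph0 mul0r. Qed.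

Lemma KspanZ s (a : K) x : Kspan s x -> Kspan s (emb a * x).
Proof. by move=> h; rewrite -[_ * x]addr0; apply: Kspan_lin h (Kspan0 s). Qed.

Lemma KspanD s x y : Kspan s x -> Kspan s y -> Kspan s (x + y).
Proof. by move=> hx; have := Kspan_lin 1 hx; rewrite rmorph1 mul1r; exact. Qed.

Lemma KspanB s x y : Kspan s x -> Kspan s y -> Kspan s (x - y).
Proof.
by move=> hx /(KspanZ (-1)) hy; rewrite -mulN1r -(rmorphN1 emb); apply: KspanD.
Qed.

Lemma Kspan_cons a s x : Kspan (a :: s) x <->
  exists b w, Kspan s w /\ x = emb b * a + w.
Proof.
split=> [[c ->]|[b [w [[c ->] ->]]]].
  exists (c 0%N), (\sum_(i < size s) emb (c i.+1) * s`_i).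
  by split; [exists (fun i => c i.+1) | rewrite big_ord_recl].
exists (fun i => if i is j.+1 then c j else b).
by rewrite /= big_ord_recl.
Qed.

(** Induction on the generators. If a lies outside the span of s, which is complete and hence
    closed, then a has positive distance d to it, and |b| d <= |b a + w| makes the coefficients
    along a a Cauchy sequence in K. *)
Lemma Kspan_complete s u : cauchy_seq u -> (forall n, Kspan s (u n)) ->
  exists2 l, Kspan s l & cvg_seq u l.
Proof.
elim: s u => [|a s IH] u cu us.
  exists 0; first exact: Kspan0.
  move=> e e0; exists 0%N => n _; have [c ->] := us n.
  by rewrite big_ord0 subrr vL0.
have [as_|nas] := pselect (Kspan s a).
  have us' n : Kspan s (u n).
    by have [b [w [sw ->]]] := (Kspan_cons _ _ _).1 (us n); apply: Kspan_lin.
  have [l sl ul] := IH _ cu us'; exists l => //.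
  by apply/Kspan_cons; exists 0, l; rewrite rmorph0 mul0r add0r.
have [d d0 hd] : exists2 d : R, 0 < d & forall w, Kspan s w -> d <= v (a - w).
  apply: contrapT => nd.
  have ex n : exists w, Kspan s w /\ v (a - w) < n.+1%:R^-1.
    apply: contrapT => nw; apply: nd; exists n.+1%:R^-1; first by rewrite invr_gt0.
    by move=> w sw; rewrite leNgt; apply/negP => h; apply: nw; exists w.
  have [w hw] := choice ex.
  have wa : cvg_seq w a.
    move=> e e0; have [N hN] := ltr_add_invr e0.
    exists N => n Nn; rewrite v_distC; apply: lt_trans (hw n).2 _.
    apply: le_lt_trans hN; rewrite add0r lef_pV2 ?posrE ?ltr0n // ler_nat //.
  have cw : cauchy_seq w.
    move=> e e0; have [N hN] := wa e e0; exists N => m n hm hn.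
    by apply: (v_dist_lt (z := a)); [exact: hN | rewrite v_distC; exact: hN].
  have [l sl wl] := IH w cw (fun n => (hw n).1); apply: nas.
  suff -> : a = l by [].
  apply: v_small_eq => e e0; have [N1 h1] := wa e e0; have [N2 h2] := wl e e0.
  apply: (v_dist_lt (z := w (maxn N1 N2))); first by rewrite v_distC h1 ?leq_maxl.
  by rewrite h2 ?leq_maxr.
have hd' b w : Kspan s w -> mcf_abs b * d <= v (emb b * a + w).
  move=> sw; rewrite -(acl_abs_emb L); have [->|b0] := eqVneq b 0.
    by rewrite rmorph0 vL0 !mul0r v_ge0.
  have eb0 : emb b != 0 by rewrite fmorph_eq0.
  have -> : emb b * a + w = emb b * (a - - emb b^-1 * w).
    by rewrite mulNr opprK mulrDr mulrA -rmorphM /= mulfV // rmorph1 mul1r.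
  rewrite vM ler_wpM2l ?v_ge0 // hd // -rmorphN; exact: KspanZ.
have /choice[b /choice[w hbw]] n : exists b w, Kspan s w /\ u n = emb b * a + w.
  exact/Kspan_cons/us.
have diff m n : u m - u n = emb (b m - b n) * a + (w m - w n).
  by rewrite !(hbw _).2 rmorphB /=; ring.
have [bl hbl] : exists l, forall e, 0 < e -> exists N, forall n, (N <= n)%N ->
    mcf_abs (b n - l) < e.
  apply: (@mcf_complete _ _ K) => e e0; have [N hN] := cu _ (mulr_gt0 e0 d0).
  exists N => m n hm hn; rewrite -(ltr_pM2r d0); apply: le_lt_trans (hN _ _ hm hn).
  by rewrite diff; apply: hd'; apply: KspanB; exact: (hbw _).1.
have ba : cvg_seq (fun n => emb (b n) * a) (emb bl * a).
  move=> e e0; have a1 : 0 < v a + 1 by rewrite ltr_wpDl // v_ge0.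
  have [N hN] := hbl _ (divr_gt0 e0 a1); exists N => n /hN.
  rewrite ltr_pdivlMr // -(acl_abs_emb L) rmorphB /= -mulrBl vM.
  by apply: le_lt_trans; rewrite ler_wpM2l ?v_ge0 // lerDl.
have cw : cauchy_seq w.
  move=> e e0; have [N1 h1] := cu e e0; have [N2 h2] := ba e e0.
  exists (maxn N1 N2) => m n; rewrite !geq_max => /andP[m1 m2] /andP[n1 n2].
  have -> : w m - w n = (u m - u n) -
      ((emb (b m) * a - emb bl * a) - (emb (b n) * a - emb bl * a)).
    by rewrite diff rmorphB /=; ring.
  by apply: v_sub_lt; [exact: h1 | apply: v_sub_lt; exact: h2].
have [wl swl hwl] := IH w cw (fun n => (hbw n).1).
exists (emb bl * a + wl); first by apply/Kspan_cons; exists bl, wl.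
move=> e e0; have [N1 h1] := hwl e e0; have [N2 h2] := ba e e0.
exists (maxn N1 N2) => m; rewrite !geq_max => /andP[m1 m2].
rewrite (hbw m).2 opprD addrACA; apply: v_add_lt; [exact: h2 | exact: h1].
Qed.

Lemma cvg_seq_unique u l l' : cvg_seq u l -> cvg_seq u l' -> l = l'.
Proof.
move=> h h'; apply: v_small_eq => e e0.
have [N1 h1] := h e e0; have [N2 h2] := h' e e0.
apply: (v_dist_lt (z := u (maxn N1 N2))); first by rewrite v_distC h1 ?leq_maxl.
by rewrite h2 ?leq_maxr.
Qed.

Lemma Kspan_closed s u l : cvg_seq u l -> (forall n, Kspan s (u n)) -> Kspan s l.
Proof.
move=> ul us; have [|l' sl' ul'] := @Kspan_complete s u _ us.
  move=> e e0; have [N hN] := ul e e0; exists N => m n hm hn.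
  by apply: (v_dist_lt (z := l)); [exact: hN | rewrite v_distC; exact: hN].
by rewrite (cvg_seq_unique ul ul').
Qed.

(** A polynomial annihilating z, freed of its factor X^n, has the form S X + c with c != 0, so z^-1
    = - S(z) / c. Hence K(z) = K[z]. *)
Lemma algebraic_inv_horner (z : L) : exists P : {poly K}, z^-1 = (map_poly emb P).[z].
Proof.
have [->|z0] := eqVneq z 0; first by exists 0; rewrite rmorph0 horner0 invr0.
have [N N0 Nz] := acl_alg z.
have [n [Q [NE Q0]]] : exists n (Q : {poly K}), N = Q * 'X^n /\ ~~ root Q 0.
  have [n [Q]] := multiplicity_XsubC N 0; rewrite N0 /= subr0 => Qr NE.
  by exists n, Q.
have Qz : (map_poly emb Q).[z] = 0.
  apply/eqP; move: Nz; rewrite NE rmorphM /= map_polyXn /root hornerM hornerXn.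
  by rewrite mulf_eq0 expf_eq0 (negPf z0) andbF orbF.
have [S QE] : exists S : {poly K}, Q = S * 'X + (Q.[0])%:P.
  elim/poly_ind: (Q) => [|S c _]; first by exists 0; rewrite mul0r horner0 addr0.
  by exists S; rewrite hornerMXaddC mulr0 add0r.
have q0 : Q.[0] != 0 by [].
exists (- (Q.[0])^-1 *: S); apply: (mulIf z0); rewrite mulVf //.
move: Qz; rewrite {1}QE rmorphD rmorphM /= map_polyX map_polyC /= hornerMXaddC.
move/eqP; rewrite addr_eq0 => /eqP Sz.
rewrite map_polyZ /= hornerZ -mulrA Sz rmorphN fmorphV /= mulrNN mulVf //.
by rewrite fmorph_eq0.
Qed.

Lemma Kspan_horner (z : L) : exists s, forall P : {poly K}, Kspan s (map_poly emb P).[z].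
Proof.
have [N N0 Nz] := acl_alg z.
exists (mkseq (fun i => z ^+ i) (size N)) => P.
have -> : (map_poly emb P).[z] = (map_poly emb (P %% N)).[z].
  rewrite {1}(divp_eq P N) rmorphD rmorphM /= hornerD hornerM.
  by move/rootP: Nz => ->; rewrite mulr0 add0r.
exists (fun i => (P %% N)`_i); rewrite size_mkseq.
rewrite (@horner_coef_wide _ (size N)) ?size_map_poly; last first.
  by rewrite ltnW // ltn_modp.
by apply: eq_bigr => i _; rewrite coef_map nth_mkseq.
Qed.

Lemma algebraic_quotient (z : L) (P Q : {poly K}) :
  exists S : {poly K}, (map_poly emb P).[z] / (map_poly emb Q).[z] = (map_poly emb S).[z].
Proof.
have [T TE] := algebraic_inv_horner (map_poly emb Q).[z].
exists (P * (T \Po Q)).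
by rewrite TE rmorphM /= hornerM map_comp_poly horner_comp.
Qed.

End FiniteDimensionalCompleteness.

Lemma expr_small (R : realType) (r d : R) : 0 <= r -> r < 1 -> 0 < d ->
  exists N, forall n, (N <= n)%N -> r ^+ n < d.
Proof.
move=> r0 r1 d0; have [->|rn0] := eqVneq r 0.
  by exists 1%N => n n1; rewrite expr0n gtn_eqF.
have {r0 rn0} r0 : 0 < r by rewrite lt_def rn0.
have e0 : 0 < r^-1 - 1 by rewrite subr_gt0 invf_gt1.
(* Bernoulli's inequality, to be used with t = r^-1 - 1. *)
have bern (t : R) n : 0 <= t -> n%:R * t <= (1 + t) ^+ n.
  move=> t0; elim: n => [|n IH]; first by rewrite mul0r expr0 ler01.
  rewrite exprS -natr1 mulrDl [leRHS]mulrDl !mul1r; apply: lerD => //.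
  by rewrite ler_peMr // exprn_ege1 // lerDl.
have hN : d^-1 / (r^-1 - 1) < (Num.bound (d^-1 / (r^-1 - 1)))%:R.
  by apply/archi_boundP; rewrite divr_ge0 ?invr_ge0 // ltW.
exists (Num.bound (d^-1 / (r^-1 - 1))) => n Nn.
rewrite -[X in _ < X]invrK -[X in X < _]invrK ltf_pV2 ?posrE ?invr_gt0 ?exprn_gt0 //.
rewrite -exprVn; have := bern _ n (ltW e0); rewrite addrCA subrr addr0.
apply: lt_le_trans; rewrite -ltr_pdivrMr //; apply: lt_le_trans hN _.
by rewrite ler_nat.
Qed.

(** * Discs inside X, evaluation at points, fields of values *)

Section AffinoidGeometry.
Variables (R : realType) (p : nat) (K : mixedCharField R p).
Variables (L : algClosure K) (X : affinoid K).

Local Notation v := (@acl_abs R p K L).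
Local Notation emb := (acl_emb L).
Local Notation pt := (pts L X).
Local Notation rX := (r_X X).
Local Notation H := (HK L X).

Lemma r_X_gt0 : 0 < rX.
Proof.
rewrite /r_X; elim/big_rec: _ => [|i x _ x0]; first exact: aff_r0_gt0.
by rewrite lt_min x0 aff_r_gt0.
Qed.

Lemma r_X_le0 : rX <= aff_r0 X.
Proof. by rewrite /r_X; elim/big_rec: _ => // i x _ h; rewrite ge_min h orbT. Qed.

Lemma r_X_le i : rX <= aff_r X i.
Proof. by rewrite /r_X (bigD1 i) //= ge_min lexx. Qed.

Lemma rho_X_gt0 : 0 < rho_X X.
Proof. by rewrite lt_max aff_r0_gt0 orbT. Qed.

(** [r_X] is the minimum of all radii: a move shorter than each of them neither leaves the closed
    disc nor enters a removed open disc. *)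
Lemma in_aff_disc (x y : L) : in_aff X x -> v (y - x) < rX -> in_aff X y.
Proof.
move=> /andP[h0 /forallP hi] hxy; apply/andP; split.
  by apply: (v_dist_le (z := x)) => //; apply/ltW/(lt_le_trans hxy)/r_X_le0.
apply/forallP => i; rewrite leNgt; apply/negP => hy; have := hi i.
rewrite leNgt => /negP; apply; apply: (v_dist_lt (z := y)) => //.
by rewrite v_distC; apply: lt_le_trans hxy (r_X_le i).
Qed.

Lemma v_pt_le (x : pt) : v (val x) <= rho_X X.
Proof.
case: x => x /= /andP[h _]; rewrite -(subrK (emb (aff_c0 X)) x) /rho_X.
by apply: v_add_le; rewrite le_max ?h ?orbT // (acl_abs_emb L) lexx.
Qed.

Definition shift (x : pt) (h : L) : pt := insubd x (val x + h).

Lemma val_shift x h : v h < rX -> val (shift x h) = val x + h.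
Proof.
move=> hh; rewrite val_insubd (in_aff_disc (valP x)) //.
by rewrite addrAC subrr add0r.
Qed.

Lemma p_gt1 : (1 < p)%N. Proof. exact/prime_gt1/(mcf_prime K). Qed.

Lemma v_p_lt1 : v p%:R < 1.
Proof. by rewrite -(emb_natr L) acl_abs_emb mcf_residue. Qed.

(** Powers of p do it: p is nonzero in characteristic 0, and |p| < 1. *)
Lemma small_elt (d : R) : 0 < d -> exists2 h : L, h != 0 & v h < d.
Proof.
move=> d0; have p0 : p%:R != 0 :> L by rewrite natL_eq0 -lt0n ltnW ?p_gt1.
have [n /(_ _ (leqnn n)) hn] := expr_small (v_ge0 _) v_p_lt1 d0.
by exists (p%:R ^+ n); rewrite ?expf_neq0 // vX.
Qed.

Lemma pt_not_isolated (y : pt) (d : R) : 0 < d ->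
  exists2 x : pt, val x != val y & v (val x - val y) < d.
Proof.
move=> d0; have m0 : 0 < Num.min d rX by rewrite lt_min d0 r_X_gt0.
have [h h0] := small_elt m0; rewrite lt_min => /andP[hd hr].
exists (shift y h); rewrite val_shift //; last by rewrite addrAC subrr add0r.
by rewrite -subr_eq0 addrAC subrr add0r.
Qed.

Lemma ev_is_zmod_morphism (x : pt) : zmod_morphism (@ev _ _ _ L X x).
Proof. by move=> f g; rewrite /ev rmorphB. Qed.

HB.instance Definition _ (x : pt) :=
  GRing.isZmodMorphism.Build _ _ (@ev _ _ _ L X x) (ev_is_zmod_morphism x).

Lemma ev_is_monoid_morphism (x : pt) : monoid_morphism (@ev _ _ _ L X x).
Proof. by split=> [|f g]; rewrite /ev ?rmorph1 ?rmorphM. Qed.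

HB.instance Definition _ (x : pt) :=
  GRing.isMonoidMorphism.Build _ _ (@ev _ _ _ L X x) (ev_is_monoid_morphism x).

Lemma ev_inj (f g : H) : (forall x, ev x f = ev x g) -> f = g.
Proof. by move=> h; apply/val_inj/funext => x; exact: h. Qed.

Lemma ev_mx_inj m n (A B : 'M[H]_(m, n)) :
  (forall x, map_mx (ev x) A = map_mx (ev x) B) -> A = B.
Proof.
move=> h; apply/matrixP => i j; apply: ev_inj => x.
by have /matrixP/(_ i j) := h x; rewrite !mxE.
Qed.

Lemma ev_const (a : K) (x : pt) : ev x (HK_const L X a) = emb a. Proof. by []. Qed.

Lemma ev_T (x : pt) : ev x (HK_T L X) = val x. Proof. by []. Qed.

Lemma HKP (f : H) : is_HK (fun x => ev x f).
Proof. by have /asboolP := valP f. Qed.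

Definition mkHK (f : pt -> L) (h : is_HK f) : H := Sub f (asboolT h).

Lemma ev_mkHK f h x : ev x (@mkHK f h) = f x. Proof. by []. Qed.

Lemma is_HK_limit (f : pt -> L) :
  (forall e, 0 < e -> exists g : H, forall x, v (f x - ev x g) < e) -> is_HK f.
Proof.
move=> h e e0; have [g hg] := h e e0; have [g' rg' hg'] := HKP g e0.
by exists g' => // x; apply: v_dist_lt (hg x) (hg' x).
Qed.

Lemma HK_bounded (f : H) : exists2 B : R, 0 < B & forall x, v (ev x f) <= B.
Proof.
have [g rg hg] := HKP f ltr01; have [B B0 hB] := rational_bounded rg.
exists (B + 1); first by rewrite addr_gt0.
move=> x; rewrite -(subrK (g x) (ev x f)); apply: v_add_le.
  by apply: le_trans (ltW (hg x)) _; rewrite lerDr ltW.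
by apply: le_trans (hB x) _; rewrite lerDl.
Qed.

(** Rational functions take their values at x in K(x) = K[x], which has finite dimension over the
    complete field K and is therefore closed under limits. *)
Lemma HK_values (x : pt) : exists s, forall f : H, Kspan s (ev x f).
Proof.
have [s hs] := Kspan_horner (val x); exists s => f.
have rs g : rational_fun g -> Kspan s (g x).
  move=> [P [Q /(_ x)[_ ->]]]; have [S ->] := algebraic_quotient (val x) P Q.
  exact: hs.
have /choice[g hg] n : exists g, rational_fun g /\ forall x, v (ev x f - g x) < n.+1%:R^-1.
  by have [|g rg hg] := HKP f (e := n.+1%:R^-1); [rewrite invr_gt0 | exists g].
apply: (Kspan_closed (u := fun n => g n x)) => [e e0|n]; last exact: rs (hg n).1.
have [N hN] := ltr_add_invr e0; rewrite add0r in hN.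
exists N => n Nn; rewrite v_distC; apply: lt_le_trans ((hg n).2 x) _.
by apply: le_trans (ltW hN); rewrite lef_pV2 ?posrE ?ltr0n // ler_nat.
Qed.

End AffinoidGeometry.

(** * Power series and derivatives on X *)

Section PowerSeries.
Variables (R : realType) (p : nat) (K : mixedCharField R p).
Variables (L : algClosure K) (X : affinoid K).

Local Notation v := (@acl_abs R p K L).
Local Notation emb := (acl_emb L).
Local Notation pt := (pts L X).
Local Notation rX := (r_X X).

(** Expansion around a single center, with coefficients in L; [analytic_on_tube] asks instead for
    coefficients in H_K(X), functions of the varying center. *)
Definition psum (z : pt) (rho : R) (c : nat -> L) (f : pt -> L) : Prop :=
  forall x, tube rho x z -> series_to (fun n => c n * (val x - val z) ^+ n) (f x).

Lemma tube_refl rho (z : pt) : 0 < rho -> tube rho z z.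
Proof. by move=> h; rewrite /tube subrr vL0. Qed.

Lemma tube_sym rho (x z : pt) : tube rho x z -> tube rho z x.
Proof. by rewrite /tube v_distC. Qed.

Lemma tube_trans rho (y x z : pt) : tube rho x y -> tube rho y z -> tube rho x z.
Proof. exact: v_dist_lt. Qed.

Lemma tube_shift rho (z : pt) (h : L) : rho <= rX -> v h < rho ->
  tube rho (shift z h) z /\ val (shift z h) = val z + h.
Proof.
move=> hr hh; rewrite /tube val_shift; last exact: lt_le_trans hr.
by rewrite addrAC subrr add0r.
Qed.

Lemma psum_shift rho c f (z : pt) (h : L) : rho <= rX -> v h < rho ->
  psum z rho c f -> series_to (fun n => c n * h ^+ n) (f (shift z h)).
Proof.
move=> hr hh hf; have [ht hv] := tube_shift z hr hh.
by apply: series_ext (hf _ ht) => n; rewrite hv addrAC subrr add0r.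
Qed.

Lemma psum_weaken rho rho' z c f : rho' <= rho -> psum z rho c f -> psum z rho' c f.
Proof. by move=> hr h x xz; apply: h; apply: lt_le_trans xz hr. Qed.

Lemma psum_center rho z c f : 0 < rho -> psum z rho c f -> f z = c 0%N.
Proof.
move=> r0 /(_ z (tube_refl z r0)) h.
apply: (series_unique h); have := @series_finite _ _ _ L (fun n => c n * (val z - val z) ^+ n) 1.
by rewrite big_ord1 expr0 mulr1; apply => -[|n] // _; rewrite subrr expr0n mulr0.
Qed.

Lemma psumM rho z c d f g : psum z rho c f -> psum z rho d g ->
  psum z rho (fun n => \sum_(i < n.+1) c i * d (n - i)%N) (fun x => f x * g x).
Proof.
move=> hf hg x xz; apply: series_ext (cauchy_prod (hf x xz) (hg x xz)) => n.
rewrite mulr_suml; apply: eq_bigr => i _.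
by rewrite mulrACA -exprD subnKC // -ltnS.
Qed.

Lemma psumZ rho z a c f : psum z rho c f ->
  psum z rho (fun n => a * c n) (fun x => a * f x).
Proof.
by move=> hf x xz; apply: series_ext (seriesZ a (hf x xz)) => n; rewrite mulrA.
Qed.

Lemma psum_sum (I : Type) (r : seq I) (P : pred I) rho z (c : I -> nat -> L) f :
  (forall i, P i -> psum z rho (c i) (f i)) ->
  psum z rho (fun n => \sum_(i <- r | P i) c i n) (fun x => \sum_(i <- r | P i) f i x).
Proof.
move=> h x xz; apply: series_ext (series_sum r (fun i Pi => h i Pi x xz)) => n.
by rewrite mulr_suml.
Qed.

Lemma psum_poly rho z (P : {poly L}) :
  psum z rho (fun i => P^`N(i).[val z]) (fun x => P.[val x]).
Proof.
move=> x _; have := @nderiv_taylor L P (val z) (val x - val z) (mulrC _ _).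
rewrite addrC subrK => ->; apply: series_finite => n hn.
by rewrite nderivn_poly0 // horner0 mul0r.
Qed.

(** Geometric series in (x - z) / (z - a). A point a outside X is at distance at least [r_X] from z,
    because the open disc of that radius around z lies in X. *)
Lemma psum_inv_linear (z : pt) (a : L) : ~~ in_aff X a ->
  psum z rX (fun n => (-1) ^+ n / (val z - a) ^+ n.+1) (fun x => (val x - a)^-1).
Proof.
move=> na x xz; set b := val z - a; set u := val x - val z.
have hb : rX <= v b.
  rewrite leNgt; apply/negP => h; move/negP: na; apply.
  by apply: in_aff_disc (valP z) _; rewrite v_distC.
have b0 : b != 0.
  by apply/eqP => b0; move: hb; rewrite b0 vL0 leNgt r_X_gt0.
have vb : 0 < v b by exact: vL_gt0.
have ub : v u < v b by apply: lt_le_trans hb.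
set w := - (u / b); have vw : v w < 1.
  by rewrite vLN vM vLV ltr_pdivrMr // mul1r.
have w1 : 1 - w != 0.
  by apply/eqP/eqP; rewrite subr_eq0; apply: contraTneq vw => <-; rewrite vL1 ltxx.
have xa : val x - a = b * (1 - w).
  by rewrite mulrBr mulr1 mulrN opprK mulrCA mulfV // mulr1 /b /u; ring.
suff h : series_to (fun n => w ^+ n) (1 - w)^-1.
  rewrite xa invfM; apply: series_ext (seriesZ b^-1 h) => n.
  have -> : w = -1 * u * b^-1 by rewrite mulN1r mulNr.
  by rewrite !exprMn exprVn exprS invfM; ring.
move=> e e0; have v1 : 0 < v (1 - w)^-1 by apply: vL_gt0; rewrite invr_eq0.
have [N hN] := expr_small (v_ge0 w) vw (divr_gt0 e0 v1).
exists N => n /hN; rewrite ltr_pdivlMr // -vX -vM.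
suff -> : \sum_(i < n) w ^+ i - (1 - w)^-1 = - (w ^+ n * (1 - w)^-1) by rewrite vLN.
apply: (mulIf w1); rewrite mulrBl mulVf // mulNr divfK //.
by rewrite -(opprB w) mulrN [_ * (w - 1)]mulrC -subrX1; ring.
Qed.

Lemma psum_inv_poly (z : pt) (Q : {poly L}) : (forall x : pt, Q.[val x] != 0) ->
  exists c, psum z rX c (fun x => (Q.[val x])^-1).
Proof.
have [r ->] := closed_field_poly_normal Q; set a := lead_coef Q => hQ.
have hr (w : L) : w \in r -> ~~ in_aff X w.
  move=> wr; apply/negP => hw; have := hQ (Sub w hw).
  rewrite hornerZ SubK; suff -> : (\prod_(w <- r) ('X - w%:P)).[w] = 0.
    by rewrite mulr0 eqxx.
  by apply/rootP; rewrite root_prod_XsubC.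
suff [c hc] : exists c, psum z rX c (fun x => ((\prod_(w <- r) ('X - w%:P)).[val x])^-1).
  exists (fun n => a^-1 * c n) => x xz; rewrite hornerZ invfM.
  exact: psumZ hc x xz.
elim: r hr {hQ} => [|w r IH] hr.
  exists (fun i => 1%:P^`N(i).[val z]) => x xz; rewrite big_nil hornerC invr1.
  by have := psum_poly 1%:P xz; rewrite hornerC.
have [|c hc] := IH; first by move=> y yr; apply: hr; rewrite inE yr orbT.
have nw : ~~ in_aff X w by apply: hr; rewrite inE eqxx.
exists (fun n => \sum_(i < n.+1) ((-1) ^+ i / (val z - w) ^+ i.+1) * c (n - i)%N).
move=> x xz; rewrite big_cons hornerM hornerXsubC invfM.
exact: psumM (psum_inv_linear nw) hc x xz.
Qed.

Lemma psum_rational (z : pt) f : rational_fun f -> exists c, psum z rX c f.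
Proof.
move=> [P [Q hf]].
have [|c hc] := @psum_inv_poly z (map_poly emb Q); first by move=> x; have [] := hf x.
exists (fun n => \sum_(i < n.+1) (map_poly emb P)^`N(i).[val z] * c (n - i)%N).
move=> x xz; rewrite (hf x).2; exact: psumM (psum_poly _) hc x xz.
Qed.

Lemma prim_root_prime_to_p N : coprime p N -> exists z : L, N.-primitive_root z.
Proof.
move=> pN; have N0 : (0 < N)%N.
  by case: N pN => // ; rewrite /coprime gcdn0 => /eqP p1; have := p_gt1 K; rewrite p1.
have [r rE] := closed_field_poly_normal ('X^N - 1 : {poly L}).
have lc : lead_coef ('X^N - 1 : {poly L}) = 1 by rewrite lead_coefXnsubC.
rewrite lc scale1r in rE.
have sr : size r = N.
  by have := size_XnsubC (1 : L) N0; rewrite rE size_prod_XsubC => -[].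
have : has N.-primitive_root r.
  apply: has_prim_root => //; last by rewrite sr.
    apply/allP => w wr; rewrite unity_rootE.
    have : root ('X^N - 1 : {poly L}) w by rewrite rE root_prod_XsubC.
    by rewrite /root !hornerE subr_eq0.
  rewrite -separable_prod_XsubC -rE separable_Xn_sub_1 //.
  by rewrite natL_eq0 -lt0n.
by move=> /hasP[w _ hw]; exists w.
Qed.

(** Otherwise a Bezout relation would write 1 as a combination of p and N, both of absolute value <
    1. *)
Lemma v_nat_coprime N : coprime p N -> v N%:R = 1.
Proof.
move=> pN; apply/eqP; rewrite eq_le v_nat_le1 leNgt; apply/negP => h.
have p0 : (0 < p)%N by rewrite ltnW ?(p_gt1 K).
have [a b ab _] := egcdnP N p0; move: ab; rewrite (eqP pN) => ab.
have : v (1 : L) < 1.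
  have -> : (1 : L) = a%:R * p%:R - b%:R * N%:R.
    by rewrite -!natrM ab natrD addrAC subrr add0r.
  apply: v_sub_lt; rewrite vM; apply: le_lt_trans (_ : _ < 1).
  - by apply: ler_wpM2r (v_nat_le1 _ a); exact: v_ge0.
  - by rewrite mul1r v_p_lt1.
  - by apply: ler_wpM2r (v_nat_le1 _ b); exact: v_ge0.
  - by rewrite mul1r.
by rewrite vL1 ltxx.
Qed.

(* Cauchy's estimate, by averaging over the N-th roots of unity for a large N
   prime to the residue characteristic. *)
Lemma psum_cauchy rho z c f M (w : L) n : rho <= rX -> psum z rho c f -> v w < rho ->
  (forall x, tube rho x z -> v (f x) <= M) -> v (c n * w ^+ n) <= M.
Proof.
move=> rr hf wr hM.
have M0 : 0 <= M.
  apply: le_trans (v_ge0 _) (hM z (tube_refl z _)).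
  exact: le_lt_trans (v_ge0 _) wr.
rewrite leNgt; apply/negP => Mc.
have e0 : 0 < v (c n * w ^+ n) by apply: le_lt_trans Mc.
have e2 : 0 < v (c n * w ^+ n) / 2 by rewrite divr_gt0.
have [N0 hN0] := series_term0 (psum_shift rr wr hf) e2.
(* N is prime to p, so that |N| = 1, exceeds n, and is so large that all terms of index at least N
   are below half of |c_n w^n|. *)
set N := (p * (n + N0).+1).+1.
have p0 : (0 < p)%N by rewrite ltnW ?(p_gt1 K).
have nN : (n + N0 < N)%N by rewrite ltnS; apply: leq_trans (leq_pmull _ p0).
have pN : coprime p N by rewrite /N mulnC -addn1 /coprime gcdnMDl gcdn1.
clearbody N; have [y hy] := prim_root_prime_to_p pN.
have yN : y ^+ N = 1 by exact: prim_expr_order hy.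
have vy : v y = 1.
  by apply/eqP; rewrite -(@pexpr_eq1 _ (v y) N) ?v_ge0 ?(leq_ltn_trans _ nN) // -vX yN vL1.
(* The weight y^(i (N - n)) is y^(- i n): the sum isolates the terms of degree congruent to n modulo
   N. *)
pose S := \sum_(i < N) y ^+ (i * (N - n)) * f (shift z (y ^+ i * w)).
have vS : v S <= M.
  apply: v_sum_le => // i _; rewrite vM vX vy expr1n mul1r; apply: hM.
  by apply: (tube_shift _ rr _).1; rewrite vM vX vy expr1n mul1r.
have hS : series_to (fun k => \sum_(i < N) y ^+ (i * (N - n)) * (c k * (y ^+ i * w) ^+ k)) S.
  apply: series_sum => i _; apply: seriesZ; apply: psum_shift hf => //.
  by rewrite vM vX vy expr1n mul1r.
have hT k : \sum_(i < N) y ^+ (i * (N - n)) * (c k * (y ^+ i * w) ^+ k) =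
    c k * w ^+ k * (if (N %| N - n + k)%N then N%:R else 0).
  transitivity (c k * w ^+ k * \sum_(i < N) (y ^+ (N - n + k)) ^+ i).
    rewrite mulr_sumr; apply: eq_bigr => i _.
    by rewrite exprMn -!exprM mulnDl exprD ![((N - n) * i)%N]mulnC ![(k * i)%N]mulnC; ring.
  congr (_ * _); rewrite (prim_order_dvd hy); case: eqP => [->|/eqP t1].
    by rewrite (eq_bigr (fun=> 1)) ?sumr_const ?card_ord // => i _; rewrite expr1n.
  have := subrX1 (y ^+ (N - n + k)) N; rewrite -exprM mulnC exprM yN expr1n subrr.
  by move/esym/eqP; rewrite mulf_eq0 subr_eq0 (negPf t1) => /eqP.
have hS' := series_ext hT hS.
have nN' : (n < N)%N by apply: leq_ltn_trans nN; exact: leq_addr.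
(* Below N only the degree n survives; the other surviving degrees are at least N, where the terms
   are small. *)
have part : \sum_(k < N) c k * w ^+ k * (if (N %| N - n + k)%N then N%:R else 0) =
    c n * w ^+ n * N%:R.
  have hz (i : 'I_N) : i != n :> nat -> (N %| N - n + i)%N = false.
    move=> ne; have iN := ltn_ord i; apply/negP => /dvdnP[[|[|t]]].
    - by rewrite mul0n; lia.
    - by rewrite mul1n; lia.
    - by rewrite !mulSn; lia.
  rewrite (bigD1 (Ordinal nN')) // (subnK (ltnW nN')) dvdnn.
  by rewrite big1 => [|i ni]; [rewrite /= addr0 | rewrite hz ?mulr0].
have := hM z (tube_refl z (le_lt_trans (v_ge0 _) wr)).
have : v (c n * w ^+ n * N%:R - S) < v (c n * w ^+ n).
  apply: (@le_lt_trans _ _ (v (c n * w ^+ n) / 2)).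
    rewrite -part; apply: series_tail hS' (ltW e2) _ => m Nm.
    case: ifP => _; last by rewrite mulr0 vL0 ltW.
    rewrite vM -[leRHS]mulr1; apply: ler_pM; rewrite ?v_ge0 ?v_nat_le1 //.
    apply/ltW/hN0; apply: leq_trans Nm; apply: leq_trans (ltnW nN); exact: leq_addl.
  by rewrite ltr_pdivrMr // mulr_natr mulr2n ltrDl.
move=> h1 _; have : v (c n * w ^+ n * N%:R) < v (c n * w ^+ n).
  rewrite -[X in v X](subrK S); apply: v_add_lt => //; exact: le_lt_trans Mc.
by rewrite vM v_nat_coprime // mulr1 ltxx.
Qed.

End PowerSeries.

(** * Differentiation of power series and rational functions *)

Section Derivatives.
Variables (R : realType) (p : nat) (K : mixedCharField R p).
Variables (L : algClosure K) (X : affinoid K).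

Local Notation v := (@acl_abs R p K L).
Local Notation emb := (acl_emb L).
Local Notation pt := (pts L X).
Local Notation rX := (r_X X).

Lemma pt_sub_neq0 (x y : pt) : y != x -> val y - val x != 0.
Proof. by apply: contra; rewrite subr_eq0 => /eqP/val_inj->. Qed.

Lemma is_derivative_unique f (x : pt) l l' :
  is_derivative f x l -> is_derivative f x l' -> l = l'.
Proof.
move=> h h'; apply: v_small_eq => e e0.
have [d d0 hd] := h e e0; have [d' d'0 hd'] := h' e e0.
have [|y yx] := @pt_not_isolated _ _ _ L X x (Num.min d d').
  by rewrite lt_min d0.
rewrite lt_min => /andP[yd yd'].
have yx' : y != x by apply: contra yx => /eqP->.
apply: (v_dist_lt (z := (f y - f x) / (val y - val x))); last exact: hd'.
by rewrite v_distC; exact: hd.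
Qed.

Lemma is_derivativeD f g (x : pt) l m : is_derivative f x l -> is_derivative g x m ->
  is_derivative (fun y => f y + g y) x (l + m).
Proof.
move=> h h' e e0; have [d d0 hd] := h e e0; have [d' d'0 hd'] := h' e e0.
exists (Num.min d d') => [|y yx]; first by rewrite lt_min d0.
rewrite lt_min => /andP[yd yd'].
rewrite opprD addrACA mulrDl opprD addrACA; apply: v_add_lt; [exact: hd | exact: hd'].
Qed.

Lemma is_derivativeN f (x : pt) l : is_derivative f x l ->
  is_derivative (fun y => - f y) x (- l).
Proof.
move=> h e e0; have [d d0 hd] := h e e0; exists d => // y yx yd.
by rewrite -opprD mulNr -opprD vLN; apply: hd.
Qed.

Lemma is_derivative_ext f g (x : pt) l : f =1 g -> is_derivative f x l ->
  is_derivative g x l.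
Proof. by move=> /funext ->. Qed.

Lemma v_term_le (c h w : L) C k m : w != 0 -> v (c * w ^+ k) <= C -> v h <= v w ->
  (m <= k)%N -> v (c * h ^+ k) <= C * (v h / v w) ^+ m.
Proof.
move=> w0 hC hw mk; have vw : 0 < v w by exact: vL_gt0.
have -> : c * h ^+ k = c * w ^+ k * (h / w) ^+ k.
  by rewrite expr_div_n -mulrA [h ^+ k / _]mulrC mulVKf // expf_neq0.
rewrite vM [v (_ ^+ k)]vX [v (h / w)]vM vLV; apply: ler_pM; rewrite ?v_ge0 ?exprn_ge0 ?divr_ge0 ?v_ge0 //.
apply: ler_wiXn2l => //; first by rewrite divr_ge0 ?v_ge0.
by rewrite ler_pdivrMr // mul1r.
Qed.

(** The terms of degree at least 2 contribute at most C (|h| / |w|)^2, which is of second order in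
    h. *)
Lemma psum_derivative rho (z : pt) c f : 0 < rho -> rho <= rX -> psum z rho c f ->
  is_derivative f z (c 1%N).
Proof.
move=> r0 rr hf.
have [w w0 wr] := small_elt L r0; have vw : 0 < v w by exact: vL_gt0.
have [C C0 hC] := series_term_bounded (psum_shift rr wr hf).
move=> e e0; have e1 : 0 < e / (C / v w ^+ 2) by rewrite !divr_gt0 ?exprn_gt0.
exists (Num.min (v w) (e / (C / v w ^+ 2))) => [|y yz]; first by rewrite lt_min vw.
rewrite lt_min; set h := val y - val z => /andP[hw he].
have h0 : h != 0 by exact: pt_sub_neq0.
have -> : (f y - f z) / h - c 1%N = (f y - f z - c 1%N * h) / h.
  by rewrite [in RHS]mulrBl mulfK.
have yt : tube rho y z by apply: lt_trans hw wr.
have est : v (f y - f z - c 1%N * h) <= C * (v h / v w) ^+ 2.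
  have -> : f y - f z - c 1%N * h = - (\sum_(i < 2) c i * h ^+ i - f y).
    by rewrite (psum_center r0 hf) !big_ord_recl big_ord0 /=; ring.
  rewrite vLN; apply: series_tail (hf y yt) _ _ => [|m hm].
    by rewrite mulr_ge0 ?exprn_ge0 ?divr_ge0 ?v_ge0 // ltW.
  by apply: v_term_le => //; exact: ltW.
have vh : 0 < v h by exact: vL_gt0.
rewrite vM vLV ltr_pdivrMr //; apply: le_lt_trans est _.
have -> : C * (v h / v w) ^+ 2 = C / v w ^+ 2 * v h * v h.
  by rewrite exprMn exprVn expr2; ring.
by rewrite ltr_pM2r // mulrC -ltr_pdivlMr // divr_gt0 // exprn_gt0.
Qed.

(** The remainder satisfies |t| <= |w|^(k - 2), a bound independent of h; multiplying by w^2 avoids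
    negative exponents for k < 2. *)
Lemma pow_difference_quotient (u h w : L) k : v u <= v w -> v h <= v w ->
  exists2 t : L, (u + h) ^+ k = u ^+ k + h * (k%:R * u ^+ k.-1) + h ^+ 2 * t &
    v (t * w ^+ 2) <= v w ^+ k.
Proof.
move=> uw hw; elim: k => [|k [t IH ht]].
  by exists 0; [rewrite !expr0; ring | rewrite mul0r vL0 expr0 ler01].
exists (k%:R * u ^+ k.-1 + (u + h) * t).
  rewrite [(u + h) ^+ k.+1]exprS IH -natr1 /= !exprS expr0.
  case: k {IH ht} => [|k] /=; first by rewrite expr0; ring.
  by rewrite !exprS -!natr1; ring.
rewrite mulrDl; apply: v_add_le.
  case: k {IH ht} => [|k] /=; first by rewrite !mul0r vL0 exprn_ge0 ?v_ge0.
  rewrite -mulrA vM; apply: (@le_trans _ _ (1 * v (u ^+ k * w ^+ 2))).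
    by rewrite ler_wpM2r ?v_ge0 ?v_nat_le1.
  rewrite mul1r vM !vX -[k.+2]addn2 exprD; apply: ler_wpM2r; first by rewrite exprn_ge0 ?v_ge0.
  by rewrite lerXn2r ?nnegrE ?v_ge0.
rewrite -mulrA vM [v w ^+ k.+1]exprS; apply: (@le_trans _ _ (v w * v (t * w ^+ 2))).
  by rewrite ler_wpM2r ?v_ge0 //; exact: v_add_le.
by rewrite ler_wpM2l ?v_ge0.
Qed.

(** The derivative l is given beforehand because, L being possibly incomplete, a termwise
    differentiated series has no automatic sum. The difference quotient is close to l and, by the
    bound on second-order remainders, to the partial sums. *)
Lemma psum_termwise_derivative rho (z : pt) c f x l : rho <= rX -> psum z rho c f ->
  tube rho x z -> is_derivative f x l ->
  series_to (fun k => k.+1%:R * c k.+1 * (val x - val z) ^+ k) l.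
Proof.
move=> rr hf xz hl; set u := val x - val z.
have r0 : 0 < rho by apply: le_lt_trans (v_ge0 _) xz.
have [w [w0 uw wr]] : exists w : L, [/\ w != 0, v u <= v w & v w < rho].
  have [u0|u0] := eqVneq u 0; last by exists u.
  by have [w w0 wr] := small_elt L r0; exists w; split; rewrite // u0 vL0 v_ge0.
have vw : 0 < v w by exact: vL_gt0.
have [C C0 hC] := series_term_bounded (psum_shift rr wr hf).
move=> e e0; have [d d0 hd] := hl e e0.
have e1 : 0 < e / (C / v w ^+ 2) by rewrite !divr_gt0 ?exprn_gt0.
(* A single increment suffices: h is so small that the difference quotient is within e of l and
   every second-order remainder is below e. *)
have [|h h0] := @small_elt _ _ _ L (Num.min (Num.min (v w) d) (e / (C / v w ^+ 2))).
  by rewrite !lt_min vw d0.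
rewrite !lt_min => /andP[/andP[hw hdd] he].
have [ht hv] : tube rho (shift x h) x /\ val (shift x h) = val x + h.
  by apply: tube_shift => //; exact: lt_trans wr.
set y := shift x h in ht hv.
have yx : y != x.
  by apply/eqP => yx; move/eqP: hv; rewrite yx -subr_eq0 opprD addrA subrr sub0r oppr_eq0 (negPf h0).
have yh : val y - val x = h by rewrite hv addrAC subrr add0r.
have := hd y yx; rewrite yh => /(_ hdd) hq.
have yz : tube rho y z by exact: tube_trans ht xz.
have /choice[t ht'] k : exists t : L,
    (u + h) ^+ k = u ^+ k + h * (k%:R * u ^+ k.-1) + h ^+ 2 * t /\
    v (t * w ^+ 2) <= v w ^+ k.
  by have [t] := pow_difference_quotient k uw (ltW hw); exists t.
pose b k : L := c k * (k%:R * u ^+ k.-1).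
have hs : series_to (fun k => b k + c k * (h * t k)) ((f y - f x) / h).
  have := seriesMr h^-1 (seriesB (hf y yz) (hf x xz)); apply: series_ext => k.
  have -> : val y - val z = u + h by rewrite hv /u; ring.
  by rewrite (ht' k).1 -/u /b; field.
have [N hN] := hs e e0; exists N => n Nn.
have -> : \sum_(i < n) i.+1%:R * c i.+1 * u ^+ i = \sum_(i < n.+1) b i.
  rewrite big_ord_recl {1}/b !mul0r mulr0 add0r; apply: eq_bigr => i _.
  by rewrite /b lift0 /=; ring.
apply: (v_dist_lt (z := (f y - f x) / h)) hq.
have small k : v (c k * (h * t k)) < e.
  have -> : c k * (h * t k) = h * (c k * (t k * w ^+ 2)) / w ^+ 2.
    by field.
  rewrite !vM vLV vX ltr_pdivrMr ?exprn_gt0 //.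
  apply: (@le_lt_trans _ _ (v h * C)).
    rewrite ler_wpM2l ?v_ge0 //; apply: le_trans (hC k); rewrite !vM vX.
    by rewrite ler_wpM2l ?v_ge0 // -vM -(vX w k); have := (ht' k).2; rewrite !vM !vX.
  by move: he; rewrite ltr_pdivlMr ?divr_gt0 ?exprn_gt0 // mulrA ltr_pdivrMr ?exprn_gt0.
have -> : \sum_(i < n.+1) b i = \sum_(i < n.+1) (b i + c i * (h * t i)) -
    \sum_(i < n.+1) c i * (h * t i) by rewrite big_split /= addrK.
rewrite addrAC; apply: v_sub_lt; first by apply: hN; exact: leqW.
exact: v_sum_lt.
Qed.

(** Since f has an expansion at x, the quotient rule follows from f Q = P by comparing coefficients
    of degree 1. *)
Lemma rational_derivative f : rational_fun f ->
  exists2 g, rational_fun g & forall x : pt, is_derivative f x (g x).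
Proof.
move=> [P [Q hf]].
exists (fun x => (map_poly emb (P^`() * Q - P * Q^`())).[val x] /
                 (map_poly emb (Q ^+ 2)).[val x]).
  exists (P^`() * Q - P * Q^`()), (Q ^+ 2) => x; split => //.
  by rewrite rmorphXn /= horner_exp expf_neq0 //; case: (hf x).
move=> x; have [c hc] : exists c, psum x rX c f.
  by apply: psum_rational; exists P, Q.
have hP := @psum_poly _ _ _ L X rX x (map_poly emb P).
have hQ := @psum_poly _ _ _ L X rX x (map_poly emb Q).
have r0 := r_X_gt0 X.
have dc := psum_derivative r0 (lexx _) hc.
have Q0 (y : pt) : (map_poly emb Q).[val y] != 0 by case: (hf y).
have dP := psum_derivative r0 (lexx _) hP.
have dfQ := psum_derivative r0 (lexx _) (psumM hc hQ).
have fQ : (fun y : pt => f y * (map_poly emb Q).[val y]) =1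
    (fun y => (map_poly emb P).[val y]).
  by move=> y; rewrite (hf y).2 divfK.
have := is_derivative_unique (is_derivative_ext fQ dfQ) dP.
rewrite !big_ord_recl big_ord0 /= !nderivn1 -(psum_center r0 hc) (hf x).2 addr0.
rewrite /bump /= addn0 subnn nderivn0 !deriv_map.
move: (Q0 x); set q := (map_poly emb Q).[_]; set a := (map_poly emb P).[_] => q0 E.
suff -> : (map_poly emb (P^`() * Q - P * Q^`())).[val x] /
    (map_poly emb (Q ^+ 2)).[val x] = c 1%N by [].
rewrite rmorphB rmorphXn !rmorphM /= horner_exp hornerD hornerN !hornerM -E -/q -/a.
by field.
Qed.

End Derivatives.

(** * Differential calculus on H_K(X) *)

Section HKCalculus.
Variables (R : realType) (p : nat) (K : mixedCharField R p).
Variables (L : algClosure K) (X : affinoid K).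

Local Notation v := (@acl_abs R p K L).
Local Notation pt := (pts L X).
Local Notation rX := (r_X X).
Local Notation H := (HK L X).
Local Notation ddT := (@Defs.ddT R p K L X).

(** The constant term of the expansion at z cancels, and Cauchy's estimate at radius |w| bounds all
    the others. *)
Lemma rational_lipschitz f M (w : L) : rational_fun f -> (forall x : pt, v (f x) <= M) ->
  w != 0 -> v w < rX -> forall x z : pt, v (val x - val z) <= v w ->
  v (f x - f z) <= M * (v (val x - val z) / v w).
Proof.
move=> rf hM w0 wr x z xz; have r0 := r_X_gt0 X.
have [c hc] := psum_rational z rf.
have M0 : 0 <= M by apply: le_trans (hM x); exact: v_ge0.
have -> : f x - f z = - (\sum_(i < 1) c i * (val x - val z) ^+ i - f x).
  by rewrite (psum_center r0 hc) big_ord1 /=; ring.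
rewrite vLN; apply: series_tail (hc x (le_lt_trans xz wr)) _ _ => [|m hm].
  by rewrite mulr_ge0 ?divr_ge0 ?v_ge0.
rewrite -[_ / _]expr1; apply: v_term_le => //.
exact: psum_cauchy (lexx _) hc wr (fun x _ => hM x).
Qed.

(** The constant M survives the uniform limit because errors enter through a maximum, not a sum: if
    the difference D exceeded the bound, a rational approximation within D / 2 would already
    contradict it. *)
Lemma HK_lipschitz (f : H) M (w : L) : (forall x, v (ev x f) <= M) ->
  w != 0 -> v w < rX -> forall x z : pt, v (val x - val z) <= v w ->
  v (ev x f - ev z f) <= M * (v (val x - val z) / v w).
Proof.
move=> hM w0 wr x z xz; have vw : 0 < v w by exact: vL_gt0.
have M0 : 0 <= M by apply: le_trans (hM x); exact: v_ge0.
set t := _ / _; have t0 : 0 <= t by rewrite divr_ge0 ?v_ge0.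
have t1 : t <= 1 by rewrite ler_pdivrMr // mul1r.
rewrite leNgt; apply/negP => hD.
have D0 : 0 < v (ev x f - ev z f) by apply: le_lt_trans hD; exact: mulr_ge0.
set D := v (ev x f - ev z f) in hD D0 *.
have : D < D; last by rewrite ltxx.
pose e := Num.max M (D / 2); have D2 : 0 < D / 2 by rewrite divr_gt0.
have D2D : D / 2 < D by rewrite ltr_pdivrMr // mulr_natr mulr2n ltrDl.
have [g rg hg] := HKP f D2.
have gB y : v (g y) <= e.
  rewrite -(subrK (ev y f) (g y)); apply: v_add_le; rewrite /e le_max.
    by rewrite v_distC (ltW (hg y)) orbT.
  by rewrite hM.
apply: (@le_lt_trans _ _ (Num.max (D / 2) (M * t))); last by rewrite gt_max D2D hD.
rewrite {1}/D; have -> : ev x f - ev z f = (ev x f - g x) - (ev z f - g z) + (g x - g z) by ring.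
apply: v_add_le.
  by apply: v_sub_le; rewrite le_max (ltW (hg _)).
apply: le_trans (rational_lipschitz rg gB w0 wr xz) _.
rewrite -/t /e maxr_pMl // ge_max !le_max lexx orbT /=.
by rewrite ler_piMr // ltW.
Qed.

Lemma derivative_bound (f : H) M (w : L) x l : (forall x, v (ev x f) <= M) ->
  w != 0 -> v w < rX -> is_derivative (fun y => ev y f) x l -> v l <= M / v w.
Proof.
move=> hM w0 wr hl; have vw : 0 < v w by exact: vL_gt0.
rewrite leNgt; apply/negP => hc; have [d d0 hd] := hl _ (le_lt_trans (divr_ge0 (le_trans (v_ge0 _) (hM x)) (ltW vw)) hc).
have [|y yx] := @pt_not_isolated _ _ _ L X x (Num.min d (v w)); first by rewrite lt_min d0.
rewrite lt_min => /andP[yd yw].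
have yx' : y != x by apply: contra yx => /eqP->.
have := hd y yx' yd; set h := val y - val x; set Q := _ / _ => hQ.
have vh : 0 < v h by apply: vL_gt0; rewrite subr_eq0.
have Qb : v Q <= M / v w.
  rewrite /Q vM vLV ler_pdivrMr //; apply: le_trans (HK_lipschitz hM w0 wr (ltW yw)) _.
  by rewrite -/h mulrA mulrAC.
have : v l < v l; last by rewrite ltxx.
rewrite -[X in v X < _](subrK Q) -(addrC Q); apply: v_add_lt; last by rewrite v_distC.
exact: le_lt_trans hc.
Qed.

Lemma inv_succ_small (e : R) : 0 < e -> exists N, forall n, (N <= n)%N -> n.+1%:R^-1 < e.
Proof.
move=> e0; have [N hN] := ltr_add_invr e0; rewrite add0r in hN.
exists N => n Nn; apply: le_lt_trans hN; rewrite lef_pV2 ?posrE ?ltr0n //.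
by rewrite ler_nat.
Qed.

(** By [derivative_bound], the derivatives of rational approximations g_n are uniformly Cauchy;
    their pointwise limits exist by [HK_values] and form an element of H_K(X). The Lipschitz bound
    on f - g_N shows that this limit is the derivative of f. *)
Lemma HK_derivative (f : H) :
  exists d : H, forall x, is_derivative (fun y => ev y f) x (ev x d).
Proof.
have r0 := r_X_gt0 X; have [w w0 wr] := small_elt L r0.
have vw : 0 < v w by exact: vL_gt0.
have /choice[g hg] n : exists g : H, rational_fun (fun x => ev x g) /\
    forall x, v (ev x f - ev x g) <= n.+1%:R^-1.
  have [|g rg hg] := HKP f (e := n.+1%:R^-1); first by rewrite invr_gt0.
  by exists (mkHK (rational_is_HK rg)); split => // x; exact: ltW.
have /choice[d hd] n : exists d : H, forall x, is_derivative (fun y => ev y (g n)) x (ev x d).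
  have [d rd hd] := rational_derivative (hg n).1.
  by exists (mkHK (rational_is_HK rd)).
have dd N n m x : (N <= n)%N -> (N <= m)%N ->
    v (ev x (d n) - ev x (d m)) <= N.+1%:R^-1 / v w.
  move=> Nn Nm; apply: (@derivative_bound (g n - g m) _ w x) => //.
    move=> y; rewrite rmorphB /=; apply: (v_dist_le (z := ev y f)).
      rewrite v_distC; apply: le_trans ((hg n).2 y) _.
      by rewrite lef_pV2 ?posrE ?ltr0n // ler_nat.
    apply: le_trans ((hg m).2 y) _.
    by rewrite lef_pV2 ?posrE ?ltr0n // ler_nat.
  apply: is_derivative_ext (is_derivativeD (hd n x) (is_derivativeN (hd m x))) => y.
  by rewrite rmorphB.
have small e : 0 < e -> exists N, N.+1%:R^-1 / v w < e.
  move=> e0; have [N hN] := inv_succ_small (mulr_gt0 e0 vw).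
  by exists N; rewrite ltr_pdivrMr // hN.
have /choice[l hl] x : exists l, cvg_seq (fun n => ev x (d n)) l.
  have [s hs] := HK_values x.
  have cd : cauchy_seq (fun n => ev x (d n)).
    by move=> e /small[N hN]; exists N => n m Nn Nm; apply: le_lt_trans hN; exact: dd.
  by have [l _ ?] := Kspan_complete cd (fun n => hs _); exists l.
have ld N x : v (l x - ev x (d N)) <= N.+1%:R^-1 / v w.
  rewrite leNgt; apply/negP => hc.
  have c0 : 0 < v (l x - ev x (d N)).
    by apply: le_lt_trans hc; rewrite divr_ge0 ?invr_ge0 // ltW.
  have [m hm] := hl x _ c0.
  have := hm _ (leq_maxl m N); set M := maxn m N => hM.
  have : v (l x - ev x (d N)) < v (l x - ev x (d N)); last by rewrite ltxx.
  apply: (v_dist_lt (z := ev x (d M))); first by rewrite v_distC.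
  by apply: le_lt_trans hc; apply: dd => //; exact: leq_maxr.
have lH : is_HK l.
  apply: is_HK_limit => e /small[N hN]; exists (d N) => x; exact: le_lt_trans (ld N x) hN.
exists (mkHK lH) => x e e0; rewrite ev_mkHK; have [N hN] := small e e0.
have [t t0 ht] := hd N x e e0.
exists (Num.min t (v w)) => [|y yx]; first by rewrite lt_min t0.
rewrite lt_min => /andP[yt yw]; set h := val y - val x.
have h0 : h != 0 by exact: pt_sub_neq0.
have vh : 0 < v h by exact: vL_gt0.
have -> : (ev y f - ev x f) / h - l x =
   (ev y (f - g N) - ev x (f - g N)) / h +
   (((ev y (g N) - ev x (g N)) / h - ev x (d N)) - (l x - ev x (d N))).
  by rewrite !rmorphB /=; ring.
apply: v_add_lt.
  rewrite vM vLV ltr_pdivrMr //.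
  have hB y' : v (ev y' (f - g N)) <= N.+1%:R^-1 by rewrite rmorphB (hg N).2.
  apply: le_lt_trans (HK_lipschitz hB w0 wr (ltW yw)) _.
  by rewrite -/h mulrA mulrAC ltr_pM2r.
by apply: v_sub_lt; [exact: ht | exact: le_lt_trans (ld N x) hN].
Qed.

(** Neither of the two default values in the definition of [ddT] is ever taken: the derivative
    exists at every point and belongs to H_K(X). *)
Lemma ddTP (f : H) x : is_derivative (fun y => ev y f) x (ev x (ddT f)).
Proof.
have [d hd] := HK_derivative f; suff -> : ddT f = d by exact: hd.
apply: val_inj; rewrite /Defs.ddT val_insubd.
have -> : (fun x : pt => xget 0 [set l | is_derivative (val f) x l]) = val d.
  apply/funext => y; apply: is_derivative_unique (hd y).
  by have := xgetI 0 (hd y : [set l | is_derivative (val f) y l] (ev y d)).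
by rewrite (valP d).
Qed.

Lemma ddT_eq (f g : H) : (forall x, is_derivative (fun y => ev y f) x (ev x g)) ->
  ddT f = g.
Proof. by move=> h; apply: ev_inj => x; apply: is_derivative_unique (ddTP f x) (h x). Qed.

Lemma ddTD (f g : H) : ddT (f + g) = ddT f + ddT g.
Proof.
apply: ddT_eq => x; rewrite rmorphD.
apply: is_derivative_ext (is_derivativeD (ddTP f x) (ddTP g x)) => y.
by rewrite rmorphD.
Qed.

Lemma ddTN (f : H) : ddT (- f) = - ddT f.
Proof.
apply: ddT_eq => x; rewrite rmorphN.
by apply: is_derivative_ext (is_derivativeN (ddTP f x)) => y; rewrite rmorphN.
Qed.

Lemma ddTB (f g : H) : ddT (f - g) = ddT f - ddT g.
Proof. by rewrite ddTD ddTN. Qed.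

Lemma ddT_bound (f : H) M (w : L) : (forall x, v (ev x f) <= M) ->
  w != 0 -> v w < rX -> forall x, v (ev x (ddT f)) <= M / v w.
Proof. by move=> hM w0 wr x; apply: derivative_bound hM w0 wr (ddTP f x). Qed.

Lemma iter_ddTB n (f g : H) : iter n ddT (f - g) = iter n ddT f - iter n ddT g.
Proof. by elim: n => //= n ->; rewrite ddTB. Qed.

Lemma iter_ddT_bound n (f : H) M (w : L) : (forall x, v (ev x f) <= M) ->
  w != 0 -> v w < rX -> forall x, v (ev x (iter n ddT f)) <= M / v w ^+ n.
Proof.
move=> hM w0 wr; elim: n => [|n IH] x /=; first by rewrite expr0 divr1.
apply: le_trans (ddT_bound IH w0 wr x) _; rewrite exprS invfM mulrA.
by rewrite mulrAC.
Qed.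

Definition tay (f : H) (y : pt) (j : nat) : L := ev y (iter j ddT f) / (j`!)%:R.

Lemma psum_iter_ddT rho z c (f : H) j : 0 < rho -> rho <= rX ->
  psum z rho c (fun x => ev x f) ->
  psum z rho (fun k => ((k + j) ^_ j)%:R * c (k + j)%N) (fun x => ev x (iter j ddT f)).
Proof.
move=> r0 rr hf; elim: j => [|j IH] x xz.
  by apply: series_ext (hf x xz) => k; rewrite ffactn0 addn0 mul1r.
apply: series_ext (psum_termwise_derivative rr IH xz (ddTP (iter j ddT f) x)) => k.
rewrite -addSnnS mulrA -natrM; congr (_%:R * _ * _).
have := ffactnSr (k.+1 + j) j; rewrite addnK => ->; exact: mulnC.
Qed.

Lemma psum_tay rho (z : pt) c (f : H) j : 0 < rho -> rho <= rX ->
  psum z rho c (fun x => ev x f) -> c j = tay f z j.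
Proof.
move=> r0 rr hf; rewrite /tay (psum_center r0 (psum_iter_ddT j r0 rr hf)) add0n ffactnn.
by rewrite mulrC mulKf // fact_neq0.
Qed.

Lemma tayB (f g : H) y j : tay (f - g) y j = tay f y j - tay g y j.
Proof. by rewrite /tay iter_ddTB rmorphB mulrBl. Qed.

(** Here f is not yet known to be the sum of its Taylor series, so [psum_cauchy] is applied to a
    rational g close to f. The coefficient of f - g has only a crude bound, with a loss B depending
    on j, which the choice of g for this fixed j absorbs. *)
Lemma tay_cauchy (f : H) M (w : L) y j : (forall x, v (ev x f) <= M) -> v w < rX ->
  v (tay f y j * w ^+ j) <= M.
Proof.
move=> hM wr; have r0 := r_X_gt0 X; have [u u0 ur] := small_elt L r0.
have vu : 0 < v u by exact: vL_gt0.
rewrite leNgt; apply/negP => hc; set D := v _ in hc.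
have M0 : 0 <= M by apply: le_trans (hM y); exact: v_ge0.
have D0 : 0 < D by apply: le_lt_trans hc.
pose B := v (w ^+ j / (j`!)%:R) / v u ^+ j + 1.
have B0 : 0 < B by rewrite ltr_wpDl // divr_ge0 ?exprn_ge0 ?v_ge0.
pose e := Num.min (D / 2) (D / 2 / B).
have D2 : 0 < D / 2 by rewrite divr_gt0.
have D2D : D / 2 < D by rewrite ltr_pdivrMr // mulr_natr mulr2n ltrDl.
have e0 : 0 < e by rewrite lt_min D2 divr_gt0.
have eD : e <= D / 2 by rewrite /e ge_min lexx.
have eB : e <= D / 2 / B by rewrite /e ge_min lexx orbT.
have [g0 rg hg] := HKP f e0; pose g := mkHK (rational_is_HK rg).
have [c hc'] := psum_rational y rg.
have : D < D; last by rewrite ltxx.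
rewrite {1}/D; have -> : tay f y j = tay g y j + tay (f - g) y j by rewrite tayB; ring.
rewrite mulrDl; apply: v_add_lt.
  rewrite -(psum_tay (f := g) j r0 (lexx _) hc').
  apply: (@le_lt_trans _ _ (Num.max M (D / 2))); last by rewrite gt_max hc.
  apply: psum_cauchy (lexx _) hc' wr _ => x _.
  rewrite -(subrK (ev x f) (g0 x)); apply: v_add_le; rewrite le_max; last by rewrite hM.
  by rewrite v_distC (le_trans (ltW (hg x)) eD) orbT.
have hB x : v (ev x (f - g)) <= e by rewrite rmorphB; exact: ltW (hg x).
rewrite /tay mulrAC -mulrA vM.
apply: (@le_lt_trans _ _ (e / v u ^+ j * v (w ^+ j / (j`!)%:R))).
  by rewrite ler_wpM2r ?v_ge0 // (iter_ddT_bound j hB u0 ur).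
apply: (@le_lt_trans _ _ (e * B)).
  by rewrite -mulrA ler_pM2l // mulrC lerDl.
by apply: le_lt_trans D2D; rewrite -ler_pdivlMr.
Qed.

(** Cauchy's estimate bounds every Taylor term of f - g by the sup-norm of f - g, uniformly in the
    degree, so the expansion passes from rational functions to their uniform limits. *)
Lemma psum_HK (f : H) y : psum y rX (tay f y) (fun x => ev x f).
Proof.
move=> x xy e e0; have r0 := r_X_gt0 X; have e2 : 0 < e / 2 by rewrite divr_gt0.
have e2e : e / 2 < e by rewrite ltr_pdivrMr // mulr_natr mulr2n ltrDl.
have [g0 rg hg] := HKP f e2; pose g := mkHK (rational_is_HK rg).
have [c hc] := psum_rational y rg.
have [N hN] := hc x xy e e0; exists N => n Nn.
have hB x' : v (ev x' (f - g)) <= e / 2 by rewrite rmorphB; exact: ltW (hg x').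
have -> : \sum_(i < n) tay f y i * (val x - val y) ^+ i - ev x f =
  (\sum_(i < n) c i * (val x - val y) ^+ i - g0 x) +
  (\sum_(i < n) tay (f - g) y i * (val x - val y) ^+ i - ev x (f - g)).
  rewrite rmorphB addrACA -big_split /= opprB ev_mkHK; congr (_ + _); last by ring.
  apply: eq_bigr => i _; rewrite tayB (psum_tay (f := g) i r0 (lexx _) hc); ring.
apply: v_add_lt; first exact: hN.
apply: le_lt_trans e2e; apply: v_sub_le => //.
apply: v_sum_le => [|i _]; [exact: ltW | exact: tay_cauchy].
Qed.

Lemma ddTM (f g : H) : ddT (f * g) = ddT f * g + f * ddT g.
Proof.
apply: ddT_eq => x; have r0 := r_X_gt0 X.
have := psum_derivative r0 (lexx _) (psumM (@psum_HK f x) (@psum_HK g x)).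
rewrite !big_ord_recl big_ord0 /= /bump /= subnn /tay /= !fact0 divr1 addr0.
rewrite !divr1 rmorphD !rmorphM /= [in X in _ -> X]addrC.
by apply: is_derivative_ext => y; rewrite rmorphM.
Qed.

End HKCalculus.

(** * Dilations and Newton series *)

Section Dilations.
Variables (R : realType) (p : nat) (K : mixedCharField R p).
Variables (L : algClosure K) (X : affinoid K).

Local Notation v := (@acl_abs R p K L).
Local Notation emb := (acl_emb L).
Local Notation pt := (pts L X).
Local Notation rX := (r_X X).
Local Notation H := (HK L X).
Local Notation U := (fun r : R => discK (1 : K) (r / rho_X X)).

Lemma r_X_le_rho : rX <= rho_X X.
Proof. by rewrite (le_trans (r_X_le0 X)) // le_max lexx orbT. Qed.

Lemma near1P r q : U r q <-> v (emb q - 1) < r / rho_X X.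
Proof. by rewrite /discK /= -(acl_abs_emb L) rmorphB rmorph1. Qed.

Lemma near1_le r r' q : r <= r' -> U r q -> U r' q.
Proof.
by move=> rr' /lt_le_trans; apply; rewrite ler_pM2r // invr_gt0 rho_X_gt0.
Qed.

Lemma near1_lt1 r q : r <= rX -> U r q -> v (emb q - 1) < 1.
Proof.
move=> rr /near1P h; apply: lt_le_trans h _.
by rewrite ler_pdivrMr ?rho_X_gt0 // mul1r (le_trans rr r_X_le_rho).
Qed.

Lemma near1_v r q : r <= rX -> U r q -> v (emb q) = 1.
Proof.
move=> rr /(near1_lt1 rr) h; apply/eqP; rewrite eq_le; apply/andP; split.
  by rewrite -(subrK 1 (emb q)); apply: v_add_le; [exact: ltW | rewrite vL1].
rewrite leNgt; apply/negP => h'; have := v_sub_lt h' h.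
by rewrite opprB addrCA subrr addr0 vL1 ltxx.
Qed.

Lemma near1_neq0 r q : r <= rX -> U r q -> q != 0.
Proof.
move=> rr /(near1_v rr) h; apply/eqP => q0; move: h.
by rewrite q0 rmorph0 vL0 => /esym/eqP; rewrite oner_eq0.
Qed.

Lemma near1_1 r : 0 < r -> U r 1.
Proof.
by move=> r0; apply/near1P; rewrite rmorph1 subrr vL0 divr_gt0 ?rho_X_gt0.
Qed.

Lemma near1_M r q q' : r <= rX -> U r q -> U r q' -> U r (q * q').
Proof.
move=> rr hq hq'; apply/near1P.
have -> : emb (q * q') - 1 = emb q * (emb q' - 1) + (emb q - 1).
  by rewrite rmorphM /=; ring.
by apply: v_add_lt; [rewrite vM (near1_v rr hq) mul1r|]; apply/near1P.
Qed.

Lemma near1_V r q : r <= rX -> U r q -> U r q^-1.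
Proof.
move=> rr hq; apply/near1P; have q0 := near1_neq0 rr hq.
have eq0 : emb q != 0 by rewrite fmorph_eq0.
have -> : emb q^-1 - 1 = - (emb q)^-1 * (emb q - 1).
  by rewrite fmorphV mulrBr mulNr mulVf // mulr1 addrC opprK.
by rewrite vM vLN vLV (near1_v rr hq) invr1 mul1r; apply/near1P.
Qed.

(** Hence a module over this disc only needs operators indexed by the disc itself. *)
Lemma gen_near1 r : r <= rX -> 0 < r -> gen (U r) = U r.
Proof.
move=> rr r0; apply/seteqP; split=> [q hq|q hq G [_ sG]]; last exact: sG.
apply: (hq (U r)); split => //.
split; [exact: near1_1 | by move=> a b; apply: near1_M | by move=> a; apply: near1_V].
Qed.

(** This is the origin of the radius r / max(|c_0|, R_0): the denominator bounds |x| on X. *)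
Lemma near1_move r q (x : pt) : U r q -> v (emb q * val x - val x) < r.
Proof.
move=> /near1P; rewrite ltr_pdivlMr ?rho_X_gt0 // => h.
rewrite -[X in _ - X]mul1r -mulrBl vM; apply: le_lt_trans h.
by rewrite ler_wpM2l ?v_ge0 // v_pt_le.
Qed.

Lemma near1_in_aff r q (x : pt) : r <= rX -> U r q -> in_aff X (emb q * val x).
Proof.
by move=> rr hq; apply: in_aff_disc (valP x) (lt_le_trans (near1_move x hq) rr).
Qed.

Lemma val_dilate r q (x : pt) : r <= rX -> U r q -> val (dilate q x) = emb q * val x.
Proof. by move=> rr hq; rewrite val_insubd (near1_in_aff x rr hq). Qed.

Lemma tube_dilate r q (x : pt) : r <= rX -> U r q -> tube r (dilate q x) x.
Proof. by move=> rr hq; rewrite /tube (val_dilate x rr hq) near1_move. Qed.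

Lemma dilateM r q q' (x : pt) : r <= rX -> U r q -> U r q' ->
  dilate (q * q') x = dilate q (dilate q' x).
Proof.
move=> rr hq hq'; apply: val_inj.
by rewrite !(val_dilate _ rr) //; [rewrite rmorphM mulrA | exact: near1_M].
Qed.

Lemma dilate1 (x : pt) : dilate 1 x = x.
Proof.
by apply: val_inj; rewrite val_insubd rmorph1 mul1r; case: ifP.
Qed.

Lemma rational_comp_scale q (f : pt -> L) (d : pt -> pt) :
  (forall x, val (d x) = emb q * val x) -> rational_fun f -> rational_fun (f \o d).
Proof.
move=> hd [P [Q hf]]; exists (P \Po (q *: 'X)), (Q \Po (q *: 'X)) => x /=.
rewrite !map_comp_poly map_polyZ map_polyX /= !horner_comp !hornerE -hd.
exact: hf.
Qed.

Lemma near1_HK r q (f : H) : r <= rX -> U r q -> is_HK (val f \o dilate q).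
Proof.
move=> rr hq e e0; have [g rg hg] := HKP f e0.
exists (g \o dilate q); last by move=> x; apply: hg.
by apply: rational_comp_scale rg => x; apply: val_dilate rr hq.
Qed.

Lemma ev_sigma r q (x : pt) (f : H) : r <= rX -> U r q ->
  ev x (sigma q f) = ev (dilate q x) f.
Proof.
move=> rr hq; rewrite /ev /sigma val_insubd; case: ifP => // /negP[].
exact/asboolP/(near1_HK f rr hq).
Qed.

Lemma sigma1 (f : H) : sigma 1 f = f.
Proof.
apply: ev_inj => x; rewrite (ev_sigma x f (lexx _) (near1_1 (r_X_gt0 X))).
by rewrite dilate1.
Qed.

Lemma sigmaM_near1 r q q' (f : H) : r <= rX -> U r q -> U r q' ->
  sigma (q * q') f = sigma q (sigma q' f).
Proof.
move=> rr hq hq'; apply: ev_inj => x.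
rewrite !(ev_sigma _ _ rr) //; last exact: near1_M.
by rewrite mulrC (dilateM x rr hq' hq).
Qed.

Lemma near1_Q1 r : r <= rX -> U r `<=` Q1_X L X.
Proof.
move=> rr q hq; split; last first.
  by rewrite /discK /= -(acl_abs_emb L) rmorphB rmorph1; exact: near1_lt1 rr hq.
have q0 := near1_neq0 rr hq; have hV := near1_V rr hq.
split => // [x|f|]; [exact: near1_in_aff rr hq | exact: near1_HK rr hq |].
exists (sigma q^-1) => f; rewrite -(sigmaM_near1 f rr) ?mulVf ?mulfV // sigma1 //.
Qed.

Lemma near1_open r : openK (U r).
Proof.
move=> q hq; exists (r / rho_X X); first by apply: le_lt_trans hq; rewrite -(acl_abs_emb L) v_ge0.
move=> q' hq'; apply/near1P; have -> : emb q' - 1 = emb (q' - q) + (emb q - 1).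
  by rewrite rmorphB /=; ring.
by apply: v_add_lt; [rewrite acl_abs_emb | apply/near1P].
Qed.

Lemma near1_pow_sub r q n : r <= rX -> U r q -> v (emb q ^+ n - 1) <= v (emb q - 1).
Proof.
move=> rr hq; rewrite subrX1 vM -[leRHS]mulr1 ler_wpM2l ?v_ge0 //.
by apply: v_sum_le => // i _; rewrite vX (near1_v rr hq) expr1n.
Qed.

End Dilations.

(** * Newton series with nodes q^i y *)

Section Newton.
Variables (R : realType) (p : nat) (K : mixedCharField R p).
Variables (L : algClosure K) (X : affinoid K).

Local Notation v := (@acl_abs R p K L).
Local Notation emb := (acl_emb L).
Local Notation pt := (pts L X).
Local Notation rX := (r_X X).
Local Notation U := (fun r : R => discK (1 : K) (r / rho_X X)).
Let vL := acl_absP L.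

(* The coefficient of (x - y)_{q,n} in (x - z)^k. *)
Fixpoint newton_coef (q : K) (y z : L) (k n : nat) : L :=
  if k is k'.+1 then
    (if n is n'.+1 then newton_coef q y z k' n' else 0) +
    (emb q ^+ n * y - z) * newton_coef q y z k' n
  else (n == 0%N)%:R.

Lemma newton_coef_gt q y z k n : (k < n)%N -> newton_coef q y z k n = 0.
Proof.
elim: k n => [|k IH] [|n] //= kn; rewrite !IH ?mulr0 ?addr0 //; exact: ltnW.
Qed.

(** Each further factor is split as x - z = (x - q^n y) + (q^n y - z): the first summand turns (x -
    y)_{q,n} into (x - y)_{q,n+1}, the second is a scalar. *)
Lemma newton_expand q (x y z : L) k :
  (x - z) ^+ k = \sum_(n < k.+1) newton_coef q y z k n * qpoch q x y n.
Proof.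
elim: k => [|k IH]; first by rewrite big_ord1 /qpoch big_ord0 expr0 mulr1.
transitivity (\sum_(i < k.+1) newton_coef q y z k i * qpoch q x y i.+1 +
  \sum_(i < k.+1) (emb q ^+ i * y - z) * newton_coef q y z k i * qpoch q x y i).
  rewrite exprSr IH mulr_suml -big_split /=; apply: eq_bigr => i _.
  by rewrite [qpoch q x y i.+1]/qpoch big_ord_recr /= -/(qpoch q x y i); ring.
transitivity (\sum_(i < k.+2) (if i : nat is i'.+1 then newton_coef q y z k i' else 0) *
    qpoch q x y i +
  \sum_(i < k.+2) (emb q ^+ i * y - z) * newton_coef q y z k i * qpoch q x y i).
  congr (_ + _); first by rewrite [RHS]big_ord_recl mul0r add0r.
  by rewrite [RHS]big_ord_recr /= newton_coef_gt // mulr0 mul0r addr0.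
by rewrite -big_split; apply: eq_bigr => i _ /=; rewrite [RHS]mulrDl.
Qed.

(** Both summands of the recursion respect the weight W^(k - n); the product form avoids dividing by
    W. *)
Lemma v_newton_coef q y z W k n : 0 <= W ->
  (forall i, v (emb q ^+ i * y - z) <= W) -> v (newton_coef q y z k n) * W ^+ n <= W ^+ k.
Proof.
move=> W0 hW; elim: k n => [|k IH] n /=.
  by case: n => [|n] /=; rewrite ?vL1 ?mulr1 // vL0 mul0r.
set a := (X in v (X + _)); set b := (X in v (_ + X)).
have [h|h] : v (a + b) <= v a \/ v (a + b) <= v b.
  have := abs_ultra vL a b; rewrite le_max => /orP[]; by [left | right].
  apply: le_trans (ler_wpM2r (exprn_ge0 _ W0) h) _.
  rewrite /a; case: n {a b h} => [|n]; first by rewrite vL0 mul0r exprn_ge0.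
  by rewrite exprS mulrCA [leRHS]exprS ler_wpM2l.
apply: le_trans (ler_wpM2r (exprn_ge0 _ W0) h) _.
rewrite /b vM exprS -mulrA; apply: le_trans (ler_wpM2r _ (hW n)) _.
  by rewrite mulr_ge0 ?exprn_ge0 ?v_ge0.
exact: ler_wpM2l.
Qed.

Lemma v_qpoch q (x y : L) W n : (forall i, v (x - emb q ^+ i * y) <= W) ->
  v (qpoch q x y n) <= W ^+ n.
Proof.
move=> hW; elim: n => [|n IH]; first by rewrite /qpoch big_ord0 vL1 expr0.
by rewrite /qpoch big_ord_recr /= vM exprSr ler_pM ?v_ge0.
Qed.

(** The operator d_q on arbitrary functions. At the point 0, if it belongs to X, the quotient takes
    the default value 0. *)
Definition dq (q : K) (f : pt -> L) (x : pt) : L :=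
  (f (dilate q x) - f x) / ((emb q - 1) * val x).

Lemma iter_dq_orbit q (f g : pt -> L) y n :
  (forall i, f (iter i (dilate q) y) = g (iter i (dilate q) y)) ->
  forall i, iter n (dq q) f (iter i (dilate q) y) = iter n (dq q) g (iter i (dilate q) y).
Proof.
move=> h; elim: n => [|n IH] i //=; rewrite /dq IH.
by rewrite -[dilate q (iter i _ y)]/(iter i.+1 (dilate q) y) IH.
Qed.

Lemma iter_dqZ q (f : pt -> L) a n x :
  iter n (dq q) (fun x => f x * a) x = iter n (dq q) f x * a.
Proof. by elim: n x => //= n IH x; rewrite /dq !IH; ring. Qed.

Lemma iter_dq_sum q (I : Type) (s : seq I) (f : I -> pt -> L) n x :
  iter n (dq q) (fun x => \sum_(i <- s) f i x) x = \sum_(i <- s) iter n (dq q) (f i) x.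
Proof.
elim: n x => //= n IH x.
by rewrite /dq !IH -sumrB mulr_suml.
Qed.

Lemma series_iter_dq rho q (z : pt) (g : nat -> pt -> L) (f : pt -> L) n :
  rho <= rX -> U rho q ->
  (forall x, tube rho x z -> series_to (fun k => g k x) (f x)) ->
  forall x, tube rho x z -> series_to (fun k => iter n (dq q) (g k) x) (iter n (dq q) f x).
Proof.
move=> rr hq h; elim: n => [|n IH] x xz; first exact: h.
apply: series_ext (seriesMr _ (seriesB (IH (dilate q x) _) (IH x xz))) => [k|] //.
exact: tube_trans (tube_dilate x rr hq) xz.
Qed.

Definition qnum (q : K) n : L := emb ((q ^+ n - 1) / (q - 1)).

Lemma dq_qpoch rho q (x : pt) (y : L) n : rho <= rX -> U rho q -> q != 1 ->
  val x != 0 ->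
  (qpoch q (val (dilate q x)) y n - qpoch q (val x) y n) / ((emb q - 1) * val x) =
  qnum q n * qpoch q (val x) y n.-1.
Proof.
move=> rr hq q1 x0; rewrite (val_dilate x rr hq).
have q1' : emb q - 1 != 0 by rewrite -(rmorph1 emb) -rmorphB fmorph_eq0 subr_eq0.
case: n => [|n] /=.
  by rewrite /qnum /qpoch !big_ord0 subrr mul0r expr0 subrr mul0r rmorph0 mul0r.
have shiftE : qpoch q (emb q * val x) y n.+1 =
    (emb q * val x - y) * (emb q ^+ n * qpoch q (val x) y n).
  rewrite /qpoch big_ord_recl /= expr0 mul1r; congr (_ * _).
  elim: n => [|n IH]; first by rewrite !big_ord0 expr0 mulr1.
  rewrite big_ord_recr /= IH [in RHS]big_ord_recr /= /bump /= add1n !exprS; ring.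
rewrite shiftE [qpoch q (val x) y n.+1]/qpoch big_ord_recr /= -/(qpoch q (val x) y n).
rewrite /qnum fmorph_div !rmorphB rmorphXn rmorph1 /= exprS.
have x0' : sval x != 0 := x0.
by field; rewrite ?x0' ?q1'.
Qed.

(** For n > m the subtraction m - n truncates, but the product then contains [qnum q 0], which is
    0. *)
Lemma iter_dq_qpoch rho q (x : pt) (y : L) m n : rho <= rX -> U rho q -> q != 1 ->
  val x != 0 ->
  iter n (dq q) (fun x => qpoch q (val x) y m) x =
  (\prod_(i < n) qnum q (m - i)) * qpoch q (val x) y (m - n).
Proof.
move=> rr hq q1; elim: n x => [|n IH] x x0; first by rewrite big_ord0 mul1r subn0.
have qx0 : val (dilate q x) != 0.
  by rewrite (val_dilate x rr hq) mulf_neq0 // fmorph_eq0 (near1_neq0 L rr hq).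
rewrite /= /dq !IH // big_ord_recr /= subnS -mulrA -(dq_qpoch y (m - n) rr hq q1 x0); ring.
Qed.

Lemma qfactE q n : emb (qfact q n) = \prod_(i < n) qnum q (n - i).
Proof.
rewrite /qfact rmorph_prod /= big_add1 big_mkord (reindex_inj rev_ord_inj) /=.
by apply: eq_bigr => i _; rewrite /qnum subnSK.
Qed.

Lemma qfact_neq0 q n : ~ is_root_of_unity q -> emb (qfact q n) != 0.
Proof.
move=> nq; have h k : (0 < k)%N -> q ^+ k - 1 != 0.
  by move=> k0; apply/eqP => /eqP; rewrite subr_eq0 => /eqP hk; apply: nq; exists k.
rewrite fmorph_eq0 /qfact big_seq; elim/big_ind: _ => [|a b|i]; [exact: oner_neq0 | exact: mulf_neq0 | ].
rewrite mem_index_iota => /andP[i0 _]; rewrite mulf_neq0 ?h // invr_eq0.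
by rewrite -[q]expr1 h.
Qed.

Lemma qpoch_diag q (y : L) n : qpoch q y y n = (n == 0%N)%:R.
Proof.
case: n => [|n]; first by rewrite /qpoch big_ord0.
by rewrite /qpoch big_ord_recl expr0 mul1r subrr mul0r.
Qed.

(** After n applications of d_q, evaluation at x = y kills every (x - y)_{q,m} except m = n. *)
Lemma iter_dq_pow rho q (y : pt) (z : L) k n : rho <= rX -> U rho q -> q != 1 ->
  val y != 0 ->
  iter n (dq q) (fun x => (val x - z) ^+ k) y = newton_coef q (val y) z k n * emb (qfact q n).
Proof.
move=> rr hq q1 y0.
have -> : (fun x : pt => (val x - z) ^+ k) = fun x : pt => \sum_(m < k.+1)
    qpoch q (val x) (val y) m * newton_coef q (val y) z k m.
  apply/funext => x; rewrite (newton_expand q (val x) (val y)).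
  by apply: eq_bigr => i _; rewrite mulrC.
rewrite iter_dq_sum.
have term (m : 'I_k.+1) : iter n (dq q) (fun x => qpoch q (val x) (val y) m *
    newton_coef q (val y) z k m) y =
    if m == n :> nat then newton_coef q (val y) z k n * emb (qfact q n) else 0.
  rewrite iter_dqZ (iter_dq_qpoch _ _ _ rr hq q1 y0) qpoch_diag; case: (ltngtP m n) => mn.
  - by rewrite (bigD1 (Ordinal mn)) //= subnn /qnum expr0 subrr mul0r rmorph0 !mul0r.
  - by rewrite subn_eq0 leqNgt mn mulr0 mul0r.
  - by rewrite mn subnn eqxx mulr1 mulrC qfactE.
rewrite (eq_bigr _ (fun m _ => term m)); have [kn|nk] := ltnP k n.
  by rewrite newton_coef_gt // mul0r big1 // => i _; case: eqP.
rewrite -ltnS in nk; rewrite (bigD1 (Ordinal nk)) //= eqxx big1 => [|i ni]; first by rewrite addr0.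
by case: (nat_of_ord i =P n) => // h; case/negP: ni; apply/eqP/val_inj.
Qed.

Lemma series_shift (u : nat -> L) s n : (forall k, (k < n)%N -> u k = 0) ->
  series_to u s -> series_to (fun m => u (n + m)%N) s.
Proof.
move=> hu hs e e0; have [N hN] := hs e e0; exists N => m Nm.
have := hN (n + m)%N (leq_trans Nm (leq_addl _ _)).
by rewrite big_split_ord /= big1 ?add0r // => i _; apply: hu.
Qed.

(** The largest of (q - 1) y, y - z and x - z serves as w. An element of L is wanted, not a real
    radius, because the decay of the coefficients is read off from convergence at an actual point of
    the disc. *)
Lemma newton_radius rho q (x y z : pt) : rho <= rX -> U rho q -> q != 1 ->
  val y != 0 -> tube rho y z -> tube rho x z ->
  exists w : L, [/\ w != 0, v w < rho,
    forall i, v (emb q ^+ i * val y - val z) <= v w &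
    forall i, v (val x - emb q ^+ i * val y) <= v w].
Proof.
move=> rr hq q1 y0 yz xz.
have q1' : emb q - 1 != 0 by rewrite -(rmorph1 emb) -rmorphB fmorph_eq0 subr_eq0.
pose a := (emb q - 1) * val y.
have a0 : a != 0 by rewrite mulf_neq0.
have ar : v a < rho.
  by have := near1_move y hq; rewrite -[X in _ - X]mul1r -mulrBl.
have [w [wr aw yw xw]] : exists w : L, [/\ v w < rho, v a <= v w,
    v (val y - val z) <= v w & v (val x - val z) <= v w].
  have [h1|/ltW h1] := leP (v a) (v (val y - val z)).
    have [h2|/ltW h2] := leP (v (val y - val z)) (v (val x - val z)).
      by exists (val x - val z); split=> //; exact: le_trans h2.
    by exists (val y - val z); split.
  have [h2|/ltW h2] := leP (v a) (v (val x - val z)).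
    by exists (val x - val z); split=> //; exact: le_trans h2.
  by exists a; split.
have w0 : w != 0.
  by apply/eqP => w0; have := lt_le_trans (vL_gt0 a0) aw; rewrite w0 vL0 ltxx.
have yi i : v (emb q ^+ i * val y - val z) <= v w.
  have -> : emb q ^+ i * val y - val z = (emb q ^+ i - 1) * val y + (val y - val z) by ring.
  apply: v_add_le => //; apply: le_trans aw; rewrite !vM.
  by rewrite ler_wpM2r ?v_ge0 // (near1_pow_sub L i rr hq).
exists w; split=> // i.
have -> : val x - emb q ^+ i * val y = (val x - val z) - (emb q ^+ i * val y - val z) by ring.
exact: v_sub_le.
Qed.

(** Each power (x - z)^k is expanded in the polynomials (x - y)_{q,n} and the double series is
    rearranged; all its terms of row k are bounded by |c_k w^k|. The column sums need no further
    analysis, since d_q is a finite difference and commutes with pointwise sums. *)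
Lemma newton_series rho q (z : pt) c f (y : pt) : rho <= rX -> U rho q ->
  ~ is_root_of_unity q -> val y != 0 -> psum z rho c f -> tube rho y z ->
  forall x, tube rho x z ->
  series_to (fun n => iter n (dq q) f y / emb (qfact q n) * qpoch q (val x) (val y) n) (f x).
Proof.
move=> rr hq nq y0 hf yz x xz.
have q1 : q != 1 by apply/eqP => q1; apply: nq; exists 1%N; rewrite expr1.
have [w [w0 wr yw xw]] := newton_radius rr hq q1 y0 yz xz.
apply: (series_rearr (u := fun k n => c k *
  (newton_coef q (val y) (val z) k n * qpoch q (val x) (val y) n)) _ _ _).2; last first.
- apply: series_ext (hf x xz) => k.
  by rewrite (newton_expand q (val x) (val y)) mulr_sumr.
- move=> n; have := series_iter_dq n rr hq hf yz.
  move=> /(seriesMr (qpoch q (val x) (val y) n / emb (qfact q n))).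
  have -> : iter n (dq q) f y * (qpoch q (val x) (val y) n / emb (qfact q n)) =
    iter n (dq q) f y / emb (qfact q n) * qpoch q (val x) (val y) n by ring.
  have E k : iter n (dq q) (fun x => c k * (val x - val z) ^+ k) y *
      (qpoch q (val x) (val y) n / emb (qfact q n)) =
      c k * (newton_coef q (val y) (val z) k n * qpoch q (val x) (val y) n).
    have -> : (fun x : pt => c k * (val x - val z) ^+ k) =
      fun x : pt => (val x - val z) ^+ k * c k by apply/funext => t; exact: mulrC.
    rewrite iter_dqZ (iter_dq_pow (val z) k n rr hq q1 y0).
    by field; exact: qfact_neq0.
  move=> /(series_ext E); apply: series_shift => k kn.
  by rewrite newton_coef_gt // mul0r mulr0.
- move=> e e0; have [N hN] := series_term0 (psum_shift rr wr hf) e0.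
  exists N => k n Nk nk; apply: le_lt_trans (hN k Nk).
  rewrite !vM vX ler_wpM2l ?v_ge0 //.
  apply: le_trans (v_newton_coef k n (v_ge0 w) yw).
  by rewrite ler_wpM2l ?v_ge0 // v_qpoch.
Qed.

(* The Newton coefficients at y only depend on the values on the orbit q^i y,
   so no accumulation argument is needed. *)
Lemma newton_identity rho q (z z' : pt) c d f g (y : pt) : rho <= rX -> U rho q ->
  ~ is_root_of_unity q -> val y != 0 -> psum z rho c f -> psum z' rho d g ->
  tube rho y z -> tube rho y z' ->
  (forall i, f (iter i (dilate q) y) = g (iter i (dilate q) y)) ->
  forall x, tube rho x z -> f x = g x.
Proof.
move=> rr hq nq y0 hf hg yz yz' fg x xz.
have xz' : tube rho x z'.
  by apply: tube_trans yz'; apply: tube_trans xz _; exact: tube_sym.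
apply: series_unique (newton_series rr hq nq y0 hf yz xz) _.
apply: series_ext (newton_series rr hq nq y0 hg yz' xz') => n.
by rewrite (iter_dq_orbit n (fun i => esym (fg i)) 0).
Qed.

End Newton.

(** * Solutions of q-difference equations *)

Section TaylorSolutions.
Variables (R : realType) (p : nat) (K : mixedCharField R p).
Variables (L : algClosure K) (X : affinoid K).

Local Notation v := (@acl_abs R p K L).
Local Notation emb := (acl_emb L).
Local Notation pt := (pts L X).
Local Notation rX := (r_X X).
Local Notation H := (HK L X).
Local Notation U := (fun r : R => discK (1 : K) (r / rho_X X)).
Local Notation sigma := (@Defs.sigma R p K L X).

(** Completeness of H_K(X) for the sup-norm, in the form needed for series; the pointwise sums exist
    by [HK_values]. *)
Lemma HK_series (u : nat -> H) :
  (forall e, 0 < e -> exists N, forall n, (N <= n)%N -> forall x, v (ev x (u n)) < e) ->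
  exists f : H, forall x, series_to (fun n => ev x (u n)) (ev x f).
Proof.
move=> hu.
have tail N n x e : 0 < e -> (forall n, (N <= n)%N -> forall x, v (ev x (u n)) < e) ->
    (N <= n)%N -> v (\sum_(i < n) ev x (u i) - \sum_(i < N) ev x (u i)) <= e.
  by move=> e0 hN Nn; apply: (v_tail (u := fun i => ev x (u i)) Nn (ltW e0)) => m Nm; exact/ltW/hN.
have half (e : R) : 0 < e -> 0 < e / 2 /\ e / 2 < e.
  by move=> e0; rewrite divr_gt0 // ltr_pdivrMr // mulr_natr mulr2n ltrDl.
have evs x n : ev x (\sum_(i < n) u i) = \sum_(i < n) ev x (u i) by rewrite raddf_sum.
have /choice[f hf] x : exists l, series_to (fun n => ev x (u n)) l.
  have [s hs] := HK_values x.
  have [|n|l _ hl] := @Kspan_complete _ _ _ L s (fun n => ev x (\sum_(i < n) u i)).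
  - move=> e /half[e20 e2e]; have [N hN] := hu _ e20; exists N => m n Nm Nn.
    apply: le_lt_trans e2e; rewrite !evs.
    apply: (v_dist_le (z := \sum_(i < N) ev x (u i))); first exact: tail.
    by rewrite v_distC; exact: tail.
  - exact: hs.
  exists l => e /hl[N hN]; exists N => n /hN.
  by rewrite evs.
suff fH : is_HK f by exists (mkHK fH).
apply: is_HK_limit => e /half[e20 e2e]; have [N hN] := hu _ e20.
exists (\sum_(i < N) u i) => x; apply: le_lt_trans e2e; rewrite evs v_distC.
by apply: series_tail (hf x) (ltW e20) _ => m Nm; apply/ltW/hN.
Qed.

Lemma ev_qT q (x : pt) : ev x (qT L X q) = (emb q - 1) * val x.
Proof. by rewrite /qT rmorphM /= ev_const ev_T rmorphB rmorph1. Qed.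

Lemma mx_psum_mul m n o rho (z : pt) (F : pt -> 'M[L]_(m, n)) (G : pt -> 'M[L]_(n, o)) :
  (forall i j, exists c, psum z rho c (fun x => F x i j)) ->
  (forall i j, exists c, psum z rho c (fun x => G x i j)) ->
  forall i j, exists c, psum z rho c (fun x => (F x *m G x) i j).
Proof.
move=> hF hG i j.
have /choice[c hc] l : exists c, psum z rho c (fun x => F x i l * G x l j).
  have [c hc] := hF i l; have [d hd] := hG l j; eexists; exact: psumM hc hd.
exists (fun k => \sum_l c l k) => x xz; rewrite mxE.
exact: psum_sum (fun l _ => hc l) x xz.
Qed.

Lemma mx_psum_const m n rho (z : pt) (M : 'M[L]_(m, n)) i j :
  exists c, psum z rho c (fun x : pt => M i j).
Proof.
eexists => x xz; have := @psum_poly _ _ _ L X rho z (M i j)%:P x xz.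
by rewrite hornerC; apply.
Qed.

Lemma mx_psum_HK m n rho (z : pt) (F : 'M[H]_(m, n)) : rho <= rX -> forall i j,
  exists c, psum z rho c (fun x => map_mx (ev x) F i j).
Proof.
move=> rr i j; exists (tay (F i j) z) => x xz; rewrite mxE.
exact: psum_weaken rr (@psum_HK _ _ _ L X (F i j) z) x xz.
Qed.

(** Two centers are allowed because the cocycle relation compares Y(x, y) Y(y, z), expanded around
    y, with Y(x, z), expanded around z. *)
Lemma dilate_mx_identity m n rho q (z z' y : pt) (B : pt -> 'M[L]_m)
    (F G : pt -> 'M[L]_(m, n)) : rho <= rX -> U rho q -> ~ is_root_of_unity q ->
  val y != 0 ->
  (forall i j, exists c, psum z rho c (fun x => F x i j)) ->
  (forall i j, exists c, psum z' rho c (fun x => G x i j)) ->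
  tube rho y z -> tube rho y z' ->
  (forall x, tube rho x z -> F (dilate q x) = B x *m F x) ->
  (forall x, tube rho x z -> G (dilate q x) = B x *m G x) ->
  F y = G y -> forall x, tube rho x z -> F x = G x.
Proof.
move=> rr hq nq y0 hF hG yz yz' qF qG FGy x xz.
apply/matrixP => i j; have [c hc] := hF i j; have [d hd] := hG i j.
apply: (newton_identity rr hq nq y0 hc hd yz yz') xz => k.
suff [_ ->] : tube rho (iter k (dilate q) y) z /\
    F (iter k (dilate q) y) = G (iter k (dilate q) y) by [].
elim: k => [|k [tk IH]] //=; split; last by rewrite qF // qG // IH.
exact: tube_trans (tube_dilate _ rr hq) tk.
Qed.

Lemma dilate0 r q (x : pt) : r <= rX -> U r q -> val x = 0 -> dilate q x = x.
Proof. by move=> rr hq x0; apply: val_inj; rewrite (val_dilate x rr hq) x0 mulr0. Qed.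

Section Solution.
Variables (n : nat) (rho : R) (Y : pt -> pt -> 'M[L]_n).
Hypotheses (rho_le : rho <= rX) (rho0 : 0 < rho).
Hypothesis Yan : analytic_mx_on_tube rho Y.
Hypothesis Y1 : forall x, Y x x = 1%:M.

Lemma solution_psum z i j : exists c, psum z rho c (fun x => Y x z i j).
Proof.
have [a [_ ha]] := Yan i j; exists (fun k => ev z (a k)) => x xz.
exact: ha.
Qed.

Lemma solves_at_diag q (A : 'M[H]_n) x : solves_at rho q A Y ->
  map_mx (ev x) A = Y (dilate q x) x.
Proof. by move=> hA; rewrite hA ?Y1 ?mulmx1 //; exact: tube_refl. Qed.

(* The middle point is taken nonzero because q-difference arguments divide by
   (q - 1) y; nothing is lost, since dilations fix 0. *)
Definition cocycle : Prop := forall x y z, val y != 0 -> tube rho y z -> tube rho x z ->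
  Y x y *m Y y z = Y x z.

Lemma sigma_cocycle q (A : 'M[H]_n) : U rho q -> ~ is_root_of_unity q ->
  solves_at rho q A Y -> cocycle.
Proof.
move=> hq nq hA x y z y0 yz xz.
apply: (@dilate_mx_identity _ _ rho q y z y (fun x => map_mx (ev x) A)
  (fun x => Y x y *m Y y z) (fun x => Y x z)) => //.
- apply: mx_psum_mul => i j; first exact: solution_psum.
  exact: mx_psum_const.
- by move=> i j; exact: solution_psum.
- exact: tube_refl.
- by move=> t ty; rewrite hA // mulmxA.
- by move=> t ty; rewrite hA //; exact: tube_trans ty yz.
- by rewrite Y1 mul1mx.
- by apply: tube_trans xz _; exact: tube_sym.
Qed.

Hypothesis Yco : cocycle.
Variables (r : R).
Hypothesis r_le : r <= rho.

Let r_leX : r <= rX. Proof. exact: le_trans rho_le. Qed.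

Lemma cocycle_dilate q x y : U r q -> tube rho x y ->
  Y (dilate q x) y = Y (dilate q x) x *m Y x y.
Proof.
move=> hq xy; have [x0|x0] := eqVneq (val x) 0.
  by rewrite (dilate0 r_leX hq x0) Y1 mul1mx.
rewrite Yco //; apply: tube_trans xy; apply: lt_le_trans r_le.
exact: tube_dilate r_leX hq.
Qed.

(** Analyticity on U_rho controls the coefficients only at radii strictly below rho, so a bound
    uniform in x is required. The value rho / 2 keeps W positive when q = 1. *)
Lemma near1_radius q : U r q -> exists2 W : R, 0 < W < rho &
  forall x : pt, v ((emb q - 1) * val x) <= W.
Proof.
move=> hq; have hqr : v (emb q - 1) * rho_X X < rho.
  apply: lt_le_trans r_le; rewrite -ltr_pdivlMr ?rho_X_gt0 //; exact/near1P.
have rho2 : 0 < rho / 2 by rewrite divr_gt0.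
exists (Num.max (v (emb q - 1) * rho_X X) (rho / 2)).
  by rewrite lt_max rho2 orbT gt_max hqr ltr_pdivrMr // mulr_natr mulr2n ltrDl.
by move=> x; rewrite le_max vM ler_wpM2l ?v_ge0 ?v_pt_le.
Qed.

(** Substituting x = q y into the expansion of Y(x, y) gives the series of a_k ((q - 1) T)^k, which
    converges uniformly on X. *)
Lemma extended_matrix q : U r q ->
  exists A : 'M[H]_n, forall x, map_mx (ev x) A = Y (dilate q x) x.
Proof.
move=> hq; have [W /andP[W0 Wr] hW] := near1_radius hq.
have /choice[A hA] (ij : 'I_n * 'I_n) : exists f : H, forall x, ev x f = Y (dilate q x) x ij.1 ij.2.
  case: ij => i j /=; have [a [ha hY]] := Yan i j.
  have [|f hf] := @HK_series (fun k => a k * qT L X q ^+ k).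
    move=> e e0; have [N hN] := ha W W0 Wr e e0; exists N => k Nk x.
    apply: le_lt_trans (hN k Nk x); rewrite rmorphM rmorphXn /= vM vX ler_wpM2l ?v_ge0 //.
    rewrite lerXn2r ?nnegrE ?v_ge0 ?(ltW W0) //.
    by rewrite ev_qT.
  exists f => x; apply: series_unique (hf x) _.
  have tx : tube rho (dilate q x) x.
    by apply: lt_le_trans r_le; exact: tube_dilate r_leX hq.
  apply: series_ext (hY _ _ tx) => k; rewrite rmorphM rmorphXn /=; congr (_ * _ ^+ _).
  by rewrite (val_dilate x r_leX hq) ev_qT mulrBl mul1r.
exists (\matrix_(i, j) A (i, j)) => x; apply/matrixP => i j.
by rewrite !mxE hA.
Qed.

Lemma extended_solves q (A : 'M[H]_n) : U r q ->
  (forall x, map_mx (ev x) A = Y (dilate q x) x) -> solves_at rho q A Y.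
Proof. by move=> hq hA x y xy; rewrite hA; exact: cocycle_dilate. Qed.

Lemma extended_matrixM q q' (A A' A'' : 'M[H]_n) : U r q -> U r q' ->
  (forall x, map_mx (ev x) A = Y (dilate q x) x) ->
  (forall x, map_mx (ev x) A' = Y (dilate q' x) x) ->
  (forall x, map_mx (ev x) A'' = Y (dilate (q * q') x) x) ->
  A'' = map_mx (sigma q) A' *m A.
Proof.
move=> hq hq' hA hA' hA''; apply: ev_mx_inj => x; rewrite map_mxM hA'' hA.
have -> : map_mx (ev x) (map_mx (sigma q) A') = map_mx (ev (dilate q x)) A'.
  by apply/matrixP => i j; rewrite !mxE (ev_sigma x _ r_leX hq).
rewrite hA' mulrC (dilateM x r_leX hq' hq) -cocycle_dilate //.
by apply: lt_le_trans r_le; exact: tube_dilate r_leX hq.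
Qed.

Lemma newton_coef_HK q k m : exists b : H, forall x,
  ev x b = newton_coef q (val x) (val x) k m.
Proof.
elim: k m => [|k IH] m.
  by exists (m == 0%N)%:R => x; rewrite rmorph_nat.
have [b hb] := IH m.
have [b' hb'] : exists b' : H, forall x, ev x b' =
    if m is m'.+1 then newton_coef q (val x) (val x) k m' else 0.
  by case: m {b hb} => [|m]; [exists 0 => x; rewrite rmorph0 | exact: IH].
exists (b' + (HK_const L X (q ^+ m) * HK_T L X - HK_T L X) * b) => x /=.
by rewrite rmorphD rmorphM rmorphB rmorphM /= hb hb' ev_const ev_T rmorphXn.
Qed.

(** The matrices H_k are defined by converting the power series of Y(x, y) in x - y into a Newton
    series, so that they lie in H_K(X) and are defined at 0 as well; the recursion is then verified
    point by point. *)
Lemma extended_qTaylor q (A : 'M[H]_n) : U r q -> ~ is_root_of_unity q ->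
  (forall x, map_mx (ev x) A = Y (dilate q x) x) -> is_qTaylor_sol rho q A Y.
Proof.
move=> hq nq hA; have [W /andP[W0 Wr] hW] := near1_radius hq.
have hqr : U rho q by exact: near1_le hq.
have q1 : q != 1 by apply/eqP => q1; apply: nq; exists 1%N; rewrite expr1.
have q1' : emb q - 1 != 0 by rewrite -(rmorph1 emb) -rmorphB fmorph_eq0 subr_eq0.
have hWn (x : pt) i : v (emb q ^+ i * val x - val x) <= W.
  apply: le_trans (hW x); rewrite -[X in _ - X]mul1r -mulrBl !vM.
  by rewrite ler_wpM2r ?v_ge0 // (near1_pow_sub L i r_leX hq).
have [a ha] : exists a : 'I_n * 'I_n -> nat -> H, forall ij,
    (forall rho', 0 < rho' -> rho' < rho -> forall e : R, 0 < e ->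
       exists N, forall k, (N <= k)%N -> forall y, v (ev y (a ij k)) * rho' ^+ k < e) /\
    (forall z, psum z rho (fun k => ev z (a ij k)) (fun x => Y x z ij.1 ij.2)).
  suff /choice[a ha] ij : exists a : nat -> H,
    (forall rho', 0 < rho' -> rho' < rho -> forall e : R, 0 < e ->
       exists N, forall k, (N <= k)%N -> forall y, v (ev y (a k)) * rho' ^+ k < e) /\
    (forall z, psum z rho (fun k => ev z (a k)) (fun x => Y x z ij.1 ij.2)) by exists a.
  by have [a [h1 h2]] := Yan ij.1 ij.2; exists a; split => // z x xz; exact: h2.
have /choice[T hT] (kij : nat * ('I_n * 'I_n)) : exists f : H, forall x,
    series_to (fun m => ev x (a kij.2 m) * newton_coef q (val x) (val x) m kij.1 *
      emb (qfact q kij.1)) (ev x f).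
  case: kij => k ij /=; have /choice[b hb] m := newton_coef_HK q m k.
  have [|f hf] := @HK_series (fun m => a ij m * b m * HK_const L X (qfact q k)).
    have Wk : 0 < W ^+ k by rewrite exprn_gt0.
    (* The m-th term is at most |a_m| W^(m - k) times the absolute value of the q-factorial of k;
       adding 1 keeps C positive. *)
    pose C := v (emb (qfact q k)) / W ^+ k + 1.
    have C0 : 0 < C by rewrite ltr_wpDl // divr_ge0 ?v_ge0 // ltW.
    move=> e e0; have [N hN] := (ha ij).1 W W0 Wr _ (divr_gt0 e0 C0).
    exists N => m Nm x; rewrite !rmorphM /= hb ev_const !vM.
    have := hN m Nm x; rewrite ltr_pdivlMr //; apply: le_lt_trans.
    apply: (@le_trans _ _ (v (ev x (a ij m)) * (W ^+ m / W ^+ k) * v (emb (qfact q k)))).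
      rewrite ler_wpM2r ?v_ge0 // ler_wpM2l ?v_ge0 // ler_pdivlMr //.
      by apply: v_newton_coef (ltW W0) _; exact: hWn.
    have -> : v (ev x (a ij m)) * (W ^+ m / W ^+ k) * v (emb (qfact q k)) =
      v (ev x (a ij m)) * W ^+ m * (v (emb (qfact q k)) / W ^+ k) by ring.
    by rewrite ler_wpM2l ?mulr_ge0 ?v_ge0 ?exprn_ge0 ?(ltW W0) // lerDl.
  exists f => x; apply: series_ext (hf x) => m.
  by rewrite !rmorphM /= hb.
pose Hm k : 'M[H]_n := \matrix_(i, j) T (k, (i, j)).
have sol x y : tube rho x y -> forall i j,
    series_to (fun k => ev y (Hm k i j) * (qpoch q (val x) (val y) k / emb (qfact q k)))
              (Y x y i j).
  move=> xy i j; pose W' := Num.max W (v (val x - val y)).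
  have W'0 : 0 < W' by rewrite lt_max W0.
  have W'r : W' < rho by rewrite gt_max Wr.
  apply: (series_rearr (u := fun k m => ev y (a (i, j) k) *
    (newton_coef q (val y) (val y) k m * qpoch q (val x) (val y) m)) _ _ _).2; last first.
  - apply: series_ext ((ha (i, j)).2 y x xy) => k.
    by rewrite (newton_expand q (val x) (val y)) mulr_sumr.
  - move=> k; rewrite mxE.
    have := seriesMr (qpoch q (val x) (val y) k / emb (qfact q k)) (hT (k, (i, j)) y).
    have E m : ev y (a (i, j) m) * newton_coef q (val y) (val y) m k * emb (qfact q k) *
        (qpoch q (val x) (val y) k / emb (qfact q k)) =
        ev y (a (i, j) m) * (newton_coef q (val y) (val y) m k * qpoch q (val x) (val y) k).
      by field; exact: qfact_neq0.
    move=> /(series_ext E); apply: series_shift => m mk.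
    by rewrite newton_coef_gt // mul0r mulr0.
  - move=> e e0; have [N hN] := (ha (i, j)).1 W' W'0 W'r e e0.
    exists N => k m Nk mk; apply: le_lt_trans (hN k Nk y).
    rewrite !vM ler_wpM2l ?v_ge0 //.
    have hy t : v (emb q ^+ t * val y - val y) <= W' by rewrite le_max hWn.
    apply: le_trans (v_newton_coef k m (ltW W'0) hy).
    rewrite ler_wpM2l ?v_ge0 // v_qpoch // => t.
    apply: (v_dist_le (z := val y)); first by rewrite le_max lexx orbT.
    by rewrite v_distC.
(* Away from 0, H_k(y) is d_q^k applied to Y(x, y) in the variable x, taken at x = y. *)
have Hdq k (y : pt) i j : val y != 0 ->
    ev y (Hm k i j) = iter k (dq q) (fun x => Y x y i j) y.
  move=> y0; rewrite mxE; apply: series_unique (hT (k, (i, j)) y) _ => /=.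
  apply: series_ext (series_iter_dq k rho_le hqr ((ha (i, j)).2 y) (tube_refl y rho0)) => m.
  have -> : (fun x : pt => ev y (a (i, j) m) * (val x - val y) ^+ m) =
      fun x : pt => (val x - val y) ^+ m * ev y (a (i, j) m).
    by apply/funext => t; exact: mulrC.
  by rewrite iter_dqZ (iter_dq_pow (val y) m k rho_le hqr q1 y0); ring.
have H0 : Hm 0%N = 1%:M.
  apply: ev_mx_inj => y; rewrite map_mx1 -(Y1 y); apply/matrixP => i j; rewrite [LHS]mxE.
  apply: series_unique (sol y y (tube_refl y rho0) i j).
  have := @series_finite _ _ _ L (fun k => ev y (Hm k i j) *
     (qpoch q (val y) (val y) k / emb (qfact q k))) 1.
  rewrite big_ord1 qpoch_diag /qfact big_nil rmorph1 divr1 mulr1; apply => -[|k] // _.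
  by rewrite qpoch_diag mul0r mulr0.
(* The Taylor recursion multiplied by (q - 1) T, with H_1 eliminated. It is d_q^k in x of Y(x, y) =
   Y(x, q y) Y(q y, y), taken at x = q y. *)
have rec k : qT L X q *: Hm k.+1 + Hm k = map_mx (sigma q) (Hm k) *m A.
  apply: ev_mx_inj => y; rewrite map_mxM hA.
  have -> : map_mx (ev y) (map_mx (sigma q) (Hm k)) = map_mx (ev (dilate q y)) (Hm k).
    by apply/matrixP => i j; rewrite !mxE (ev_sigma y _ r_leX hq).
  have -> : map_mx (ev y) (qT L X q *: Hm k.+1 + Hm k) =
      ((emb q - 1) * val y) *: map_mx (ev y) (Hm k.+1) + map_mx (ev y) (Hm k).
    by apply/matrixP => i j; rewrite !mxE rmorphD rmorphM /= ev_qT.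
  (* At 0 the factor (q - 1) T vanishes, q y = y and A = 1, so both sides are H_k(0). *)
  have [y0|y0] := eqVneq (val y) 0.
    by rewrite (dilate0 r_leX hq y0) Y1 mulmx1 y0 mulr0 scale0r add0r.
  have qy0 : val (dilate q y) != 0.
    by rewrite (val_dilate y r_leX hq) mulf_neq0 // fmorph_eq0 (near1_neq0 L r_leX hq).
  apply/matrixP => i j; rewrite [LHS]mxE [X in X + _]mxE ![map_mx _ _ i j]mxE !Hdq //.
  rewrite /= /dq mulrC divfK ?mulf_neq0 // subrK [RHS]mxE.
  transitivity (iter k (dq q) (fun x => \sum_l Y x (dilate q y) i l * Y (dilate q y) y l j)
      (dilate q y)).
    have tq : tube rho (dilate q y) y by exact: tube_dilate rho_le hqr.
    apply: (iter_dq_orbit k _ 0) => t.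
    have <- // : (Y (iter t (dilate q) (dilate q y)) (dilate q y) *m Y (dilate q y) y) i j =
       \sum_l Y (iter t (dilate q) (dilate q y)) (dilate q y) i l * Y (dilate q y) y l j.
      by rewrite mxE.
    rewrite Yco //.
    elim: t => //= t IH; exact: tube_trans (tube_dilate _ rho_le hqr) IH.
  rewrite iter_dq_sum; apply: eq_bigr => l _.
  by rewrite iter_dqZ [map_mx _ _ i l]mxE Hdq.
have H1 : qT L X q *: Hm 1%N = A - 1%:M.
  have := rec 0%N; rewrite H0.
  have -> : map_mx (sigma q) 1%:M = 1%:M :> 'M[H]_n.
    apply: ev_mx_inj => y; apply/matrixP => i j; rewrite !mxE (ev_sigma y _ r_leX hq).
    by rewrite !rmorph_nat.
  by rewrite mul1mx => <-; rewrite addrK.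
exists Hm => //; split => // k.
(* d_q(H_k) is defined as the difference imposed by the recursion: dividing
   sigma_q(H_k) - H_k by (q - 1) T is not possible directly if 0 is in X. *)
exists (Hm k.+1 - map_mx (sigma q) (Hm k) *m Hm 1%N); last by rewrite subrK.
rewrite /is_dq scalerBr scalemxAr H1 mulmxBr mulmx1 -rec opprB addrCA.
by rewrite opprD addNKr.
Qed.

End Solution.

Lemma qTaylor_diag n rho q (A : 'M[H]_n) Y : 0 < rho -> is_qTaylor_sol rho q A Y ->
  forall x, Y x x = 1%:M.
Proof.
move=> rho0 [Hm [H0 _ _] sol] y; apply/matrixP => i j.
apply: series_unique (sol y y (tube_refl y rho0) i j) _.
have := @series_finite _ _ _ L (fun k => ev y (Hm k i j) *
   (qpoch q (val y) (val y) k / emb (qfact q k))) 1.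
rewrite big_ord1 qpoch_diag /qfact big_nil rmorph1 divr1 mulr1 H0 !mxE rmorph_nat.
apply => -[|k] // _.
by rewrite qpoch_diag mul0r mulr0.
Qed.

Lemma sigma_intertwine m n rho q (A : 'M[H]_m) (A' : 'M[H]_n)
    (Y : pt -> pt -> 'M[L]_m) (Y' : pt -> pt -> 'M[L]_n) (F : 'M[H]_(m, n)) :
  0 < rho -> rho <= rX -> U rho q -> ~ is_root_of_unity q ->
  (forall z i j, exists c, psum z rho c (fun x => Y x z i j)) ->
  (forall z i j, exists c, psum z rho c (fun x => Y' x z i j)) ->
  (forall x, Y x x = 1%:M) -> (forall x, Y' x x = 1%:M) ->
  solves_at rho q A Y -> solves_at rho q A' Y' ->
  A *m F = map_mx (sigma q) F *m A' ->
  forall x y, val y != 0 -> tube rho x y ->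
  map_mx (ev x) F *m Y' x y = Y x y *m map_mx (ev y) F.
Proof.
move=> rho0 rr hq nq hY hY' Y1 Y'1 hA hA' AF x y y0 xy.
apply: (@dilate_mx_identity _ _ rho q y y y (fun x => map_mx (ev x) A)
  (fun x => map_mx (ev x) F *m Y' x y) (fun x => Y x y *m map_mx (ev y) F)) => //.
- by apply: mx_psum_mul => // i j; exact: mx_psum_HK.
- by apply: mx_psum_mul => // i j; exact: mx_psum_const.
- exact: tube_refl.
- exact: tube_refl.
- move=> t ty; rewrite hA' // !mulmxA -map_mxM AF map_mxM; congr (_ *m _ *m _).
  by apply/matrixP => i j; rewrite !mxE /= (ev_sigma t _ rr hq).
- by move=> t ty; rewrite hA // mulmxA.
- by rewrite Y1 Y'1 mulmx1 mul1mx.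
Qed.

End TaylorSolutions.

(** * Solutions of differential equations *)

Section Leibniz.
Variables (A : comPzRingType) (d : A -> A).
Hypothesis dD : {morph d : a b / a + b}.
Hypothesis dM : forall a b, d (a * b) = d a * b + a * d b.

Lemma derivation0 : d 0 = 0.
Proof. by apply: (addIr (d 0)); rewrite -dD !add0r. Qed.

Lemma derivation_sum (I : Type) (s : seq I) (F : I -> A) :
  d (\sum_(i <- s) F i) = \sum_(i <- s) d (F i).
Proof. exact: (big_morph d dD derivation0). Qed.

Lemma map_derivationD m n (B C : 'M[A]_(m, n)) :
  map_mx d (B + C) = map_mx d B + map_mx d C.
Proof. by apply/matrixP => i j; rewrite !mxE dD. Qed.

Lemma map_derivation0 m n : map_mx d 0 = 0 :> 'M[A]_(m, n).
Proof. by apply/matrixP => i j; rewrite !mxE derivation0. Qed.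

Lemma map_derivation_sum m n (I : Type) (s : seq I) (F : I -> 'M[A]_(m, n)) :
  map_mx d (\sum_(i <- s) F i) = \sum_(i <- s) map_mx d (F i).
Proof. exact: (big_morph _ (@map_derivationD m n) (map_derivation0 m n)). Qed.

Lemma map_derivationMn m n (B : 'M[A]_(m, n)) k : map_mx d (B *+ k) = map_mx d B *+ k.
Proof.
by elim: k => [|k IH]; rewrite ?mulr0n ?map_derivation0 // !mulrS map_derivationD IH.
Qed.

Lemma map_derivationM m n o (B : 'M[A]_(m, n)) (C : 'M[A]_(n, o)) :
  map_mx d (B *m C) = map_mx d B *m C + B *m map_mx d C.
Proof.
apply/matrixP => i j; rewrite !mxE derivation_sum -big_split; apply: eq_bigr => k _ /=.
by rewrite !mxE dM.
Qed.

Lemma mulmxMnl m n o (B : 'M[A]_(m, n)) (C : 'M[A]_(n, o)) k :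
  (B *+ k) *m C = (B *m C) *+ k.
Proof. by elim: k => [|k IH]; rewrite ?mulr0n ?mul0mx // !mulrS mulmxDl IH. Qed.

(** If Y' = H_1 Y, then (B Y)' is [nabla H1 B] times Y; its iterates therefore yield the Taylor
    coefficients of B Y. *)
Definition nabla m n (H1 : 'M[A]_n) (B : 'M[A]_(m, n)) : 'M[A]_(m, n) :=
  map_mx d B + B *m H1.

Lemma map_mx_iter m n (B : 'M[A]_(m, n)) k i j :
  iter k (map_mx d) B i j = iter k d (B i j).
Proof. by elim: k => //= k IH; rewrite mxE IH. Qed.

Variables (n : nat) (Hm : nat -> 'M[A]_n).
Hypothesis Hm0 : Hm 0%N = 1%:M.
Hypothesis HmS : forall k, Hm k.+1 = map_mx d (Hm k) + Hm k *m Hm 1%N.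

Lemma iter_nabla_coef k m : iter k (nabla (Hm 1%N)) (Hm m) = Hm (m + k)%N.
Proof. by elim: k => [|k IH]; rewrite ?addn0 // iterS IH addnS (HmS (m + k)). Qed.

(** Leibniz's formula: each application sends B^(j) H_{k-j} to B^(j+1) H_{k-j} + B^(j) H_{k-j+1},
    and Pascal's rule collects the terms. *)
Lemma iter_nabla m (B : 'M[A]_(m, n)) k :
  iter k (nabla (Hm 1%N)) B =
  \sum_(j < k.+1) (iter j (map_mx d) B *m Hm (k - j)%N) *+ 'C(k, j).
Proof.
elim: k => [|k IH]; first by rewrite big_ord1 /= Hm0 mulmx1.
have step j : (j <= k)%N ->
    nabla (Hm 1%N) (iter j (map_mx d) B *m Hm (k - j)%N) =
    iter j.+1 (map_mx d) B *m Hm (k - j)%N + iter j (map_mx d) B *m Hm (k.+1 - j)%N.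
  by move=> jk; rewrite /nabla map_derivationM subSn // (HmS (k - j)) mulmxDr !mulmxA addrA.
rewrite iterS IH /nabla map_derivation_sum mulmx_suml -big_split /=.
rewrite (eq_bigr (fun j : 'I_k.+1 =>
  (iter j.+1 (map_mx d) B *m Hm (k.+1 - j.+1)%N) *+ 'C(k, j) +
  (iter j (map_mx d) B *m Hm (k.+1 - j)%N) *+ 'C(k, j))); last first.
  move=> j _; rewrite map_derivationMn mulmxMnl -!mulrnDl; congr (_ *+ _).
  by rewrite subSS; apply: step; rewrite -ltnS.
rewrite big_split /= [RHS]big_ord_recl bin0.
rewrite [in RHS](eq_bigr (fun j : 'I_k.+1 =>
  (iter j.+1 (map_mx d) B *m Hm (k.+1 - j.+1)%N) *+ 'C(k, j.+1) +
  (iter j.+1 (map_mx d) B *m Hm (k.+1 - j.+1)%N) *+ 'C(k, j))); last first.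
  by move=> j _; rewrite lift0 binS mulrnDr.
rewrite big_split /= addrC addrA; congr (_ + _).
rewrite big_ord_recl /= bin0; congr (_ + _).
by rewrite [RHS]big_ord_recr /= bin_small // mulr0n addr0.
Qed.

End Leibniz.

Section DifferentialSolutions.
Variables (R : realType) (p : nat) (K : mixedCharField R p).
Variables (L : algClosure K) (X : affinoid K).

Local Notation v := (@acl_abs R p K L).
Local Notation pt := (pts L X).
Local Notation rX := (r_X X).
Local Notation H := (HK L X).
Local Notation ddT := (@Defs.ddT R p K L X).

(** Clear away from 0; at 0, f is continuous by the Lipschitz bound and 0 is not isolated in X. This
    allows identities between connection matrices G = T H_1 to be divided by T. *)
Lemma HK_T_regular (f : H) : HK_T L X * f = 0 -> f = 0.
Proof.
move=> Tf; have f0 (x : pt) : val x != 0 -> ev x f = 0.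
  move=> x0; have := congr1 (ev x) Tf; rewrite rmorphM rmorph0 /= ev_T => /eqP.
  by rewrite mulf_eq0 (negPf x0) => /eqP.
apply: ev_inj => x; rewrite rmorph0; have [x0|/f0//] := eqVneq (val x) 0.
have [M M0 hM] := HK_bounded f; have [w w0 wr] := small_elt L (r_X_gt0 X).
have vw : 0 < v w by exact: vL_gt0.
apply: v_small_eq0 => e e0.
have [|y yx] := @pt_not_isolated _ _ _ L X x (Num.min (v w) (e / (M / v w))).
  by rewrite lt_min vw divr_gt0 // divr_gt0.
rewrite lt_min => /andP[yw ye].
have := HK_lipschitz hM w0 wr (ltW yw).
have y0 : val y != 0 by move: yx; rewrite x0.
rewrite (f0 y y0) sub0r vLN; move/le_lt_trans; apply.
by move: ye; rewrite ltr_pdivlMr ?divr_gt0 // mulrC mulrAC mulrA.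
Qed.

Local Notation nablaH := (@nabla H ddT _ _).

Section Solution.
Variables (n : nat) (Hm : nat -> 'M[H]_n).
Hypothesis Hm0 : Hm 0%N = 1%:M.
Hypothesis HmS : forall k, Hm k.+1 = map_mx ddT (Hm k) + Hm k *m Hm 1%N.
Variables (rho : R) (Y : pt -> pt -> 'M[L]_n).
Hypotheses (rho_le : rho <= rX) (rho0 : 0 < rho).
Hypothesis Ysol : forall y i j,
  psum y rho (fun k => ev y (Hm k i j) / (k`!)%:R) (fun x => Y x y i j).

(** The Cauchy product of the Taylor series of F and Y, whose coefficients Leibniz's formula for the
    iterates recombines. *)
Lemma psum_nabla m (F : 'M[H]_(m, n)) y i j :
  psum y rho (fun k => ev y (iter k (nablaH (Hm 1%N)) F i j) / (k`!)%:R)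
             (fun x => (map_mx (ev x) F *m Y x y) i j).
Proof.
move=> x xy; rewrite mxE.
have hF l : psum y rho (tay (F i l) y) (fun x => map_mx (ev x) F i l).
  by move=> t ty; rewrite mxE; exact: psum_weaken rho_le (@psum_HK _ _ _ L X (F i l) y) t ty.
have := psum_sum (index_enum _) (fun l (_ : true) => psumM (hF l) (@Ysol y l j)) xy.
apply: series_ext => k; congr (_ * _); rewrite (iter_nabla (@ddTD R p K L X) (@ddTM R p K L X) Hm0 HmS) summxE raddf_sum exchange_big /=.
rewrite mulr_suml; apply: eq_bigr => a _.
have ak : (a <= k)%N by rewrite -ltnS.
rewrite mulmxnE mxE raddfMn raddf_sum -[X in X / _]mulr_natl mulrAC mulr_sumr /=.
apply: eq_bigr => l _; rewrite map_mx_iter rmorphM /= /tay.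
by rewrite -(bin_fact ak) !natrM; field; rewrite !fact_neq0 natL_eq0 -lt0n bin_gt0 ak.
Qed.

(** Recentering: (x - z)^k is expanded binomially in x - y and y - z. The coefficient of (x - y)^a /
    a! is the Taylor series around z of H_a(y) Y(y, z), whose derivatives at z are the
    H_{a+m}(z). *)
Lemma sd_cocycle x y z : tube rho y z -> tube rho x z -> Y x y *m Y y z = Y x z.
Proof.
move=> yz xz; have xy : tube rho x y by apply: tube_trans xz _; exact: tube_sym.
apply/matrixP => i j; apply/esym/(series_unique (Ysol i j xz)).
pose c k := ev z (Hm k i j) / (k`!)%:R.
have wE : series_to (fun a => (map_mx (ev y) (Hm a) *m Y y z) i j / (a`!)%:R *
    (val x - val y) ^+ a) ((Y x y *m Y y z) i j).
  rewrite mxE.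
  have := series_sum (index_enum _) (fun l (_ : true) => seriesMr (Y y z l j) (Ysol i l xy)).
  apply: series_ext => a; rewrite mxE !mulr_suml; apply: eq_bigr => l _.
  by rewrite mxE; ring.
apply: series_ext ((series_rearr (u := fun k a => c k * 'C(k, a)%:R *
  (val x - val y) ^+ a * (val y - val z) ^+ (k - a)) _ _ _).1 wE) => [k|e e0|a].
- have -> : val x - val z = (val y - val z) + (val x - val y) by ring.
  rewrite -/(c k) exprDn mulr_sumr.
  by apply: eq_bigr => a _; rewrite -[in RHS]mulr_natl; ring.
- have [w [wr xw yw]] : exists w : L, [/\ v w < rho, v (val x - val y) <= v w &
      v (val y - val z) <= v w].
    have [h|/ltW h] := leP (v (val x - val y)) (v (val y - val z)).
      by exists (val y - val z).
    by exists (val x - val y).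
  have [N hN] := series_term0 (psum_shift rho_le wr (@Ysol z i j)) e0.
  exists N => k a Nk ak; apply: le_lt_trans (hN k Nk); rewrite -/(c k) !vM !vX.
  have hw : v (val x - val y) ^+ a * v (val y - val z) ^+ (k - a) <= v w ^+ k.
    have -> : v w ^+ k = v w ^+ a * v w ^+ (k - a) by rewrite -exprD subnKC.
    by rewrite ler_pM ?exprn_ge0 ?v_ge0 // lerXn2r ?nnegrE ?v_ge0.
  rewrite -!mulrA; do 2 (apply: ler_wpM2l; first exact: v_ge0).
  apply: (le_trans _ hw); rewrite -[leRHS]mul1r; apply: ler_wpM2r; last exact: v_nat_le1.
  by rewrite mulr_ge0 ?exprn_ge0 ?v_ge0.
- have := seriesMr ((val x - val y) ^+ a / (a`!)%:R) (psum_nabla (Hm a) i j yz).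
  rewrite mulrA mulrAC; apply: series_ext => m.
  rewrite (iter_nabla_coef HmS) addKn /c.
  have -> : 'C(a + m, a)%:R = (a + m)`!%:R / (a`!%:R * m`!%:R) :> L.
    rewrite -(bin_fact (leq_addr m a)) addKn natrM natrM mulfK //.
    by rewrite mulf_neq0 ?fact_neq0.
  by field; rewrite !fact_neq0.
Qed.

End Solution.

Lemma sd_intertwine m n rho (Hm : nat -> 'M[H]_m) (Hm' : nat -> 'M[H]_n)
    (Y : pt -> pt -> 'M[L]_m) (Y' : pt -> pt -> 'M[L]_n) (F : 'M[H]_(m, n)) :
  rho <= rX ->
  Hm 0%N = 1%:M -> (forall k, Hm k.+1 = map_mx ddT (Hm k) + Hm k *m Hm 1%N) ->
  Hm' 0%N = 1%:M -> (forall k, Hm' k.+1 = map_mx ddT (Hm' k) + Hm' k *m Hm' 1%N) ->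
  (forall y i j, psum y rho (fun k => ev y (Hm k i j) / (k`!)%:R) (fun x => Y x y i j)) ->
  (forall y i j, psum y rho (fun k => ev y (Hm' k i j) / (k`!)%:R) (fun x => Y' x y i j)) ->
  map_mx ddT F + F *m Hm' 1%N = Hm 1%N *m F ->
  forall x y, tube rho x y ->
  map_mx (ev x) F *m Y' x y = Y x y *m map_mx (ev y) F.
Proof.
move=> rr H0 HS H'0 H'S hY hY' hF x y xy; apply/matrixP => i j.
have it k : iter k (nablaH (Hm' 1%N)) F = Hm k *m F.
  elim: k => [|k IH]; first by rewrite H0 mul1mx.
  rewrite iterS IH /nabla (map_derivationM (@ddTD R p K L X) (@ddTM R p K L X)) (HS k) mulmxDl -!addrA; congr (_ + _).
  by rewrite -!mulmxA -mulmxDr hF.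
apply: series_unique (psum_nabla H'0 H'S rr hY' F i j xy) _.
rewrite mxE.
have := series_sum (index_enum _) (fun l (_ : true) =>
  seriesMr (map_mx (ev y) F l j) (hY y i l x xy)).
apply: series_ext => k; rewrite it [(Hm k *m F) i j]mxE raddf_sum !mulr_suml.
by apply: eq_bigr => l _; rewrite mxE /= rmorphM /=; ring.
Qed.

Lemma Taylor_sol_psum n rho (G : 'M[H]_n) Y : 0 < rho -> is_Taylor_sol rho G Y ->
  exists Hm : nat -> 'M[H]_n, [/\ Hm 0%N = 1%:M, HK_T L X *: Hm 1%N = G,
    forall k, Hm k.+1 = map_mx ddT (Hm k) + Hm k *m Hm 1%N,
    forall y i j, psum y rho (fun k => ev y (Hm k i j) / (k`!)%:R) (fun x => Y x y i j) &
    forall x, Y x x = 1%:M].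
Proof.
move=> rho0 [Hm [H0 H1 HS] sol].
have hs y i j : psum y rho (fun k => ev y (Hm k i j) / (k`!)%:R) (fun x => Y x y i j).
  move=> x xy; apply: series_ext (sol x y xy i j) => k; ring.
exists Hm; split=> // x; apply/matrixP => i j.
by rewrite (psum_center rho0 (hs x i j)) H0 fact0 divr1 !mxE rmorph_nat.
Qed.

End DifferentialSolutions.

(** * Modules and equivalence of categories *)

Section Modules.
Variables (R : realType) (p : nat) (K : mixedCharField R p).
Variables (L : algClosure K) (X : affinoid K).

Local Notation v := (@acl_abs R p K L).
Local Notation pt := (pts L X).
Local Notation rX := (r_X X).
Local Notation H := (HK L X).
Local Notation U := (fun r : R => discK (1 : K) (r / rho_X X)).
Local Notation sigma := (@Defs.sigma R p K L X).

Section Near1Sigma.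
Variables (r : R) (q : K).
Hypotheses (rr : r <= rX) (hq : U r q).

Lemma sigmaD (f g : H) : sigma q (f + g) = sigma q f + sigma q g.
Proof. by apply: ev_inj => x; rewrite rmorphD /= !(ev_sigma x _ rr hq) rmorphD. Qed.

Lemma sigmaM (f g : H) : sigma q (f * g) = sigma q f * sigma q g.
Proof. by apply: ev_inj => x; rewrite rmorphM /= !(ev_sigma x _ rr hq) rmorphM. Qed.

Lemma sigma_nat k : sigma q k%:R = k%:R.
Proof. by apply: ev_inj => x; rewrite (ev_sigma x _ rr hq) !rmorph_nat. Qed.

Lemma sigma_sum (I : Type) (s : seq I) (F : I -> H) :
  sigma q (\sum_(i <- s) F i) = \sum_(i <- s) sigma q (F i).
Proof.
elim: s => [|i s IH]; last by rewrite !big_cons sigmaD IH.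
by rewrite !big_nil (sigma_nat 0).
Qed.

Lemma map_sigmaD m n (A B : 'M[H]_(m, n)) :
  map_mx (sigma q) (A + B) = map_mx (sigma q) A + map_mx (sigma q) B.
Proof. by apply/matrixP => i j; rewrite !mxE sigmaD. Qed.

Lemma map_sigmaZ m n a (A : 'M[H]_(m, n)) :
  map_mx (sigma q) (a *: A) = sigma q a *: map_mx (sigma q) A.
Proof. by apply/matrixP => i j; rewrite !mxE sigmaM. Qed.

Lemma map_sigmaM m n o (A : 'M[H]_(m, n)) (B : 'M[H]_(n, o)) :
  map_mx (sigma q) (A *m B) = map_mx (sigma q) A *m map_mx (sigma q) B.
Proof.
apply/matrixP => i j; rewrite !mxE sigma_sum; apply: eq_bigr => k _.
by rewrite !mxE sigmaM.
Qed.

Lemma map_sigma_delta m n (i : 'I_m) (j : 'I_n) :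
  map_mx (sigma q) (delta_mx i j) = delta_mx i j.
Proof. by apply/matrixP => k l; rewrite !mxE sigma_nat. Qed.

End Near1Sigma.

Definition comb (M : lmodType H) n (e : 'I_n -> M) (c : 'rV[H]_n) : M :=
  \sum_i c 0 i *: e i.

Lemma combD (M : lmodType H) n (e : 'I_n -> M) c d : comb e (c + d) = comb e c + comb e d.
Proof. by rewrite -big_split; apply: eq_bigr => i _; rewrite mxE scalerDl. Qed.

Lemma combZ (M : lmodType H) n (e : 'I_n -> M) a c : comb e (a *: c) = a *: comb e c.
Proof. by rewrite scaler_sumr; apply: eq_bigr => i _; rewrite mxE scalerA. Qed.

Lemma comb_delta (M : lmodType H) n (e : 'I_n -> M) i : comb e (delta_mx 0 i) = e i.
Proof.
rewrite /comb (bigD1 i) //= mxE !eqxx scale1r big1 ?addr0 // => j ji.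
by rewrite mxE (negPf ji) andbF scale0r.
Qed.

Lemma comb_mul (M : lmodType H) n m (e : 'I_n -> M) (e' : 'I_m -> M) c (A : 'M[H]_(n, m)) :
  (forall i, e i = comb e' (row i A)) -> comb e c = comb e' (c *m A).
Proof.
move=> h; rewrite /comb.
transitivity (\sum_i \sum_j (c 0 i * A i j) *: e' j).
  apply: eq_bigr => i _; rewrite h /comb scaler_sumr; apply: eq_bigr => j _.
  by rewrite mxE scalerA.
rewrite exchange_big; apply: eq_bigr => j _.
by rewrite mxE scaler_suml.
Qed.

Section Basis.
Variables (M : lmodType H) (n : nat) (e : 'I_n -> M).
Hypothesis he : is_basis e.

Lemma comb_surj m : exists c, m = comb e c.
Proof. by have [c [-> _]] := he m; exists c. Qed.

Lemma comb_inj : injective (comb e).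
Proof.
move=> c d cd; have [c' [_ hc']] := he (comb e c).
by rewrite -(hc' c erefl) -(hc' d cd).
Qed.

Lemma is_matrix_ofE f (A : 'M[H]_n) : is_matrix_of e f A <-> forall i, f (e i) = comb e (row i A).
Proof.
split=> h i; rewrite h; apply: eq_bigr => j _; by rewrite mxE.
Qed.

Section Semilinear.
Variables (r : R) (q : K) (N : lmodType H) (m : nat) (e' : 'I_m -> N).
Hypotheses (rr : r <= rX) (hq : U r q).

Lemma semilinear_comb (f : M -> N) (A : 'M[H]_(n, m)) :
  {morph f : x y / x + y} -> (forall a x, f (a *: x) = sigma q a *: f x) ->
  (forall i, f (e i) = comb e' (row i A)) ->
  forall c, f (comb e c) = comb e' (map_mx (sigma q) c *m A).
Proof.
move=> fD fZ fA c.
have f0 : f 0 = 0 by apply: (addIr (f 0)); rewrite -fD !add0r.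
have fS : f (comb e c) = \sum_i sigma q (c 0 i) *: f (e i).
  rewrite /comb (big_morph f fD f0); apply: eq_bigr => i _; exact: fZ.
rewrite fS -(comb_mul (e := fun i => f (e i))) //.
by apply: eq_bigr => i _; rewrite mxE.
Qed.

End Semilinear.

Lemma linear_comb (N : lmodType H) (m : nat) (e' : 'I_m -> N) (f : M -> N) (A : 'M[H]_(n, m)) :
  linear f -> (forall i, f (e i) = comb e' (row i A)) ->
  forall c, f (comb e c) = comb e' (c *m A).
Proof.
move=> fl fA c; have fD : {morph f : x y / x + y}.
  by move=> x y; rewrite -[x in LHS]scale1r fl scale1r.
have f0 : f 0 = 0 by apply: (addIr (f 0)); rewrite -fD !add0r.
rewrite -(comb_mul (e := fun i => f (e i))) // /comb (big_morph f fD f0).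
by apply: eq_bigr => i _; rewrite -[_ *: _]addr0 fl f0 addr0.
Qed.

End Basis.

Lemma matrix_bounded m n (A : 'M[H]_(m, n)) :
  exists2 B : R, 0 < B & forall i j x, v (ev x (A i j)) <= B.
Proof.
have /choice[b hb] (ij : 'I_m * 'I_n) : exists B : R, 0 < B /\ forall x, v (ev x (A ij.1 ij.2)) <= B.
  by have [B B0 hB] := HK_bounded (A ij.1 ij.2); exists B.
exists (1 + \sum_ij b ij).
  by rewrite ltr_pwDl // sumr_ge0 // => ij _; exact: ltW (hb ij).1.
move=> i j x; apply: le_trans ((hb (i, j)).2 x) _.
rewrite (bigD1 (i, j)) //= addrCA lerDl addr_ge0 // sumr_ge0 // => ij _.
exact: ltW (hb ij).1.
Qed.

Lemma basis_matrix (M N : lmodType H) n m (e : 'I_n -> M) (e' : 'I_m -> N) (f : M -> N) :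
  is_basis e' -> exists A : 'M[H]_(n, m), forall i, f (e i) = comb e' (row i A).
Proof.
move=> he'; have /choice[c hc] i := comb_surj he' (f (e i)).
exists (\matrix_i c i) => i; by rewrite rowK.
Qed.

(** Composition with a dilation of X does not increase the sup-norm, so a bound on the matrix
    entries is a Lipschitz constant. *)
Lemma semilinear_continuous r q (M : lmodType H) (f : M -> M) : r <= rX -> U r q ->
  {morph f : x y / x + y} -> (forall a x, f (a *: x) = sigma q a *: f x) ->
  mod_continuous f.
Proof.
move=> rr hq fD fZ n e he m eps eps0.
have [A hA] := basis_matrix e f he; have [B B0 hB] := matrix_bounded A.
exists (eps / B) => [|m' [c mc hc]]; first exact: divr_gt0.
exists (map_mx (sigma q) c *m A).
  rewrite -[RHS]/(comb e _) -(semilinear_comb fD fZ hA) -[comb e c]mc fD; congr (_ + _).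
  have f0 : f 0 = 0 by apply: (addIr (f 0)); rewrite -fD !add0r.
  by apply: (addrI (f m')); rewrite -fD !subrr f0.
move=> i x; rewrite mxE raddf_sum; apply: v_sum_le => [|j _]; first exact: ltW.
rewrite mxE /= rmorphM /= (ev_sigma x _ rr hq) vM -[leRHS](divfK (lt0r_neq0 B0)).
by apply: ler_pM; rewrite ?v_ge0.
Qed.

(** The operator at q sends a row c of coordinates to sigma_q(c) A(q, T), so the group law reduces
    to [extended_matrixM]. Outside the disc the matrices are unspecified. *)
Lemma extended_action n (rho r : R) (Y : pt -> pt -> 'M[L]_n) (M : lmodType H)
    (e : 'I_n -> M) : rho <= rX -> 0 < r -> r <= rho ->
  analytic_mx_on_tube rho Y -> (forall x, Y x x = 1%:M) -> cocycle rho Y -> is_basis e ->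
  exists (act : K -> M -> M) (A : K -> 'M[H]_n),
  [/\ forall q, U r q -> [/\ {morph act q : m m' / m + m'},
        forall f m, act q (f *: m) = sigma q f *: act q m,
        mod_continuous (act q) & is_matrix_of e (act q) (A q)],
      forall m, act 1 m = m,
      forall q q', U r q -> U r q' -> forall m, act (q * q') m = act q (act q' m) &
      forall q, U r q -> forall x, map_mx (ev x) (A q) = Y (dilate q x) x].
Proof.
move=> rho_le r0 r_le Yan Y1 Yco he; have rr : r <= rX by exact: le_trans rho_le.
have rho0 : 0 < rho by exact: lt_le_trans r_le.
have /choice[A hA] q : exists A : 'M[H]_n, U r q ->
    forall x, map_mx (ev x) A = Y (dilate q x) x.
  have [hq|nq] := pselect (U r q); last by exists 0.
  by have [A hA] := extended_matrix rho_le rho0 Yan r_le hq; exists A.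
have /choice[coord hc] m := comb_surj he m.
have coordK c : coord (comb e c) = c by apply: (comb_inj he); rewrite -hc.
have cD m m' : coord (m + m') = coord m + coord m'.
  by rewrite {1}(hc m) {1}(hc m') -combD coordK.
have cZ a m : coord (a *: m) = a *: coord m.
  by rewrite {1}(hc m) -combZ coordK.
pose act q m := comb e (map_mx (sigma q) (coord m) *m A q).
have actD q : U r q -> {morph act q : m m' / m + m'}.
  by move=> hq m m'; rewrite /act cD (map_sigmaD rr hq) mulmxDl combD.
have actZ q : U r q -> forall f m, act q (f *: m) = sigma q f *: act q m.
  by move=> hq f m; rewrite /act cZ (map_sigmaZ rr hq) -scalemxAl combZ.
exists act, A; split=> [q hq|m|q q' hq hq' m|]; last by move=> q /hA.
- split; [exact: actD | exact: actZ | |].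
    exact: semilinear_continuous rr hq (actD q hq) (actZ q hq).
  move=> i; rewrite /act -{1}(comb_delta e i) coordK (map_sigma_delta rr hq) -rowE.
  by apply: eq_bigr => j _; rewrite mxE.
- have A1 : A 1 = 1%:M.
    apply: ev_mx_inj => x; rewrite hA; last exact: near1_1.
    by rewrite dilate1 Y1 map_mx1.
  rewrite /act A1 mulmx1 [RHS]hc; congr (comb e _).
  by apply/matrixP => i j; rewrite mxE sigma1.
- rewrite /act coordK (map_sigmaM rr hq) -mulmxA.
  have hqq : U r (q * q') by exact: near1_M.
  rewrite -(extended_matrixM rho_le Y1 Yco r_le hq hq' (hA _ hq) (hA _ hq') (hA _ hqq)).
  congr (comb e (_ *m _)); apply/matrixP => i j.
  by rewrite !mxE (sigmaM_near1 _ rr hq hq').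
Qed.

Lemma semilinear_unique n r q (M : lmodType H) (e : 'I_n -> M) (f g : M -> M) A :
  r <= rX -> U r q -> is_basis e ->
  {morph f : x y / x + y} -> (forall a x, f (a *: x) = sigma q a *: f x) ->
  {morph g : x y / x + y} -> (forall a x, g (a *: x) = sigma q a *: g x) ->
  is_matrix_of e f A -> is_matrix_of e g A -> f =1 g.
Proof.
move=> rr hq he fD fZ gD gZ /(is_matrix_ofE) hf /(is_matrix_ofE) hg m.
have [c ->] := comb_surj he m.
by rewrite (semilinear_comb fD fZ hf) (semilinear_comb gD gZ hg).
Qed.

End Modules.

(** Choice supplies preimages of objects and lifts of morphisms; faithfulness reduces the functor
    laws and the naturality of the unit to identities in D. *)
Lemma fully_faithful_equivalence (C D : category) (F : functor C D) :
  (forall (a b : C) (f g : cat_hom a b), Defs.fmap F f = Defs.fmap F g -> f = g) ->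
  (forall (a b : C) (h : cat_hom (F a) (F b)), exists f : cat_hom a b, Defs.fmap F f = h) ->
  (forall d : D, exists (c : C) (f : cat_hom (F c) d) (g : cat_hom d (F c)),
     cat_comp f g = cat_id d /\ cat_comp g f = cat_id (F c)) ->
  is_equivalence F.
Proof.
move=> faith full ess.
pose G0 d := projT1 (cid (ess d)).
pose ex1 d := cid (projT2 (cid (ess d))).
pose eps d : cat_hom (F (G0 d)) d := projT1 (ex1 d).
pose ex2 d := cid (projT2 (ex1 d)).
pose eta d : cat_hom d (F (G0 d)) := projT1 (ex2 d).
have epsK d : cat_comp (eps d) (eta d) = cat_id d := (projT2 (ex2 d)).1.
have etaK d : cat_comp (eta d) (eps d) = cat_id (F (G0 d)) := (projT2 (ex2 d)).2.
pose lift a b (h : cat_hom (F a) (F b)) : cat_hom a b := projT1 (cid (full a b h)).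
have liftK a b (h : cat_hom (F a) (F b)) : Defs.fmap F (lift _ _ h) = h := projT2 (cid (full a b h)).
pose Gm d d' (f : cat_hom d d') := lift (G0 d) (G0 d') (cat_comp (eta d') (cat_comp f (eps d))).
have Gm1 d : Gm d d (cat_id d) = cat_id (G0 d).
  by apply: faith; rewrite liftK cat_comp1m etaK Defs.fmap1.
have GmM a b c (g : cat_hom b c) (f : cat_hom a b) :
    Gm _ _ (cat_comp g f) = cat_comp (Gm _ _ g) (Gm _ _ f).
  apply: faith; rewrite Defs.fmapM !liftK -!cat_compA; congr (cat_comp _ _).
  by rewrite (cat_compA (eps b)) epsK cat_comp1m.
pose G := @Functor D C G0 Gm Gm1 GmM.
exists G; split; constructor.
- pose u (a : C) : cat_hom a (G (F a)) := lift a (G0 (F a)) (eta (F a)).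
  pose w (a : C) : cat_hom (G (F a)) a := lift (G0 (F a)) a (eps (F a)).
  apply: (@NatIso C C (functor_id C) (functor_comp G F) u w).
  + by move=> a; apply: faith; rewrite Defs.fmapM !liftK epsK Defs.fmap1.
  + by move=> a; apply: faith; rewrite Defs.fmapM !liftK etaK Defs.fmap1.
  + move=> a b f; apply: faith; rewrite /= !Defs.fmapM !liftK -!cat_compA epsK cat_compm1 //.
- apply: (@NatIso D D (functor_comp F G) (functor_id D) eps eta) => //.
  by move=> a b f; rewrite /= liftK cat_compA epsK cat_comp1m.
Qed.

(** * Fullness and essential surjectivity of restriction *)

Section RestrictionEquivalence.
Variables (R : realType) (p : nat) (K : mixedCharField R p).
Variables (L : algClosure K) (X : affinoid K) (q : K).

Local Notation pt := (pts L X).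
Local Notation rX := (r_X X).
Local Notation H := (HK L X).
Local Notation U := (fun r : R => discK (1 : K) (r / rho_X X)).
Local Notation sigma := (@Defs.sigma R p K L X).
Local Notation delta1 := (@Defs.delta1 R p K L X).

Lemma near1_open_nbhd r : r <= rX -> U r q -> open_nbhd L X q (U r).
Proof. by move=> rr hq; split; [exact: near1_Q1 | exact: near1_open | ]. Qed.

Lemma gen1 (S : set K) q' : S q' -> gen S q'.
Proof. by move=> h G [_]; apply. Qed.

Lemma sm_actZ S (M : sigma_module L X S) q' : S q' -> forall a (m : M),
  sm_act q' (a *: m) = sigma q' a *: sm_act q' m.
Proof. by move=> /gen1; apply: sm_act_semilin. Qed.

(** The intertwining relation of the solutions at x = q' y. At y = 0 both sides are F(0), since q'
    fixes 0 and both matrices are the identity there. *)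
Lemma extended_intertwine m n (Y : pt -> pt -> 'M[L]_m) (Y' : pt -> pt -> 'M[L]_n)
    (A : 'M[H]_m) (A' : 'M[H]_n) (F : 'M[H]_(m, n)) s q' : s <= rX -> U s q' ->
  (forall x, Y x x = 1%:M) -> (forall x, Y' x x = 1%:M) ->
  (forall x y, val y != 0 -> tube s x y ->
     map_mx (ev x) F *m Y' x y = Y x y *m map_mx (ev y) F) ->
  (forall x, map_mx (ev x) A = Y (dilate q' x) x) ->
  (forall x, map_mx (ev x) A' = Y' (dilate q' x) x) ->
  A *m F = map_mx (sigma q') F *m A'.
Proof.
move=> sX hq Y1 Y'1 inter hA hA'; apply: ev_mx_inj => y.
rewrite !map_mxM hA hA'.
have -> : map_mx (ev y) (map_mx (sigma q') F) = map_mx (ev (dilate q' y)) F.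
  by apply/matrixP => i j; rewrite !mxE /= (ev_sigma y _ sX hq).
have [y0|y0] := eqVneq (val y) 0.
  by rewrite (dilate0 sX hq y0) Y1 Y'1 mul1mx mulmx1.
by rewrite inter //; exact: tube_dilate sX hq.
Qed.

Lemma hom_matrix_sigma r q' (M N : lmodType H) m n (e : 'I_m -> M) (e' : 'I_n -> N)
    (s : M -> M) (s' : N -> N) (f : M -> N) (F : 'M[H]_(m, n)) A A' :
  r <= rX -> U r q' ->
  {morph s : x y / x + y} -> (forall a x, s (a *: x) = sigma q' a *: s x) ->
  {morph s' : x y / x + y} -> (forall a x, s' (a *: x) = sigma q' a *: s' x) ->
  is_basis e -> is_basis e' ->
  linear f -> (forall i, f (e i) = comb e' (row i F)) ->
  is_matrix_of e s A -> is_matrix_of e' s' A' ->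
  (forall x, f (s x) = s' (f x)) <-> A *m F = map_mx (sigma q') F *m A'.
Proof.
move=> rr hq sD sZ s'D s'Z he he' fl hF /is_matrix_ofE hA /is_matrix_ofE hA'.
have Me := semilinear_comb sD sZ hA.
have Ne := semilinear_comb s'D s'Z hA'.
have fE := linear_comb fl hF.
split=> [h|AF x].
  apply/row_matrixP => i; apply: (comb_inj he').
  rewrite !row_mul -fE -hA h hF Ne; congr (comb e' (_ *m _)).
  by apply/matrixP => j k; rewrite !mxE.
have [c ->] := comb_surj he x.
by rewrite Me !fE Ne (map_sigmaM rr hq) -!mulmxA AF.
Qed.

(** Compatibility at q alone makes F intertwine the two solutions, hence f commutes with every
    operator present in both modules: the intersection of their neighborhoods serves as V. *)
Lemma sigma_Res_full (M N : sigma_germ L X q) (f : M -> N) : ~ is_root_of_unity q ->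
  @is_sigma_hom _ _ _ L X [set q] (sval (sigma_Res_obj M)) (sval (sigma_Res_obj N)) f ->
  is_sigma_germ_hom f.
Proof.
move=> nq [fl fs].
have [_ _ Mq] := sg_nbhd M; have [_ _ Nq] := sg_nbhd N.
have [r [/andP[r0 rr] [Sr [m [e [A [rho [Y [he hA [/andP[r_le rho_le] Yan] hT hS]]]]]]]]] :=
  sg_adm M.
have [r' [/andP[r'0 rr'] [Sr' [n [e' [A' [rho' [Y' [he' hA' [/andP[r'_le rho'_le] Y'an] hT' hS']]]]]]]]] :=
  sg_adm N.
have [F hF] := basis_matrix e f he'.
exists (sg_set M `&` sg_set N), (fun x h => h.1), (fun x h => h.2).
split; first by apply: open_nbhdI; [exact: sg_nbhd | exact: sg_nbhd].
split=> // q' [Mq' Nq'].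
have rho0 : 0 < rho by exact: lt_le_trans r_le.
have rho'0 : 0 < rho' by exact: lt_le_trans r'_le.
pose s := Num.min rho rho'.
have s0 : 0 < s by rewrite lt_min rho0.
have sX : s <= rX by rewrite ge_min rho_le.
(* s is either rho >= r or rho' >= r', and membership in both discs covers both cases. *)
have Us t : U r t -> U r' t -> U s t.
  by rewrite /s; case: (leP rho rho') => _ h1 h2; [exact: near1_le h1 | exact: near1_le h2].
have Y1 := qTaylor_diag rho0 (hT q (conj Mq nq)).
have Y'1 := qTaylor_diag rho'0 (hT' q (conj Nq nq)).
have AF : A q *m F = map_mx (sigma q) F *m A' q.
  apply/(hom_matrix_sigma rr (Sr _ Mq) (sm_actD (gen1 Mq)) (sm_actZ Mq)
    (sm_actD (gen1 Nq)) (sm_actZ Nq) he he' fl hF (hA _ Mq) (hA' _ Nq)).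
  by move=> x; apply: fs.
have inter x y : val y != 0 -> tube s x y ->
    map_mx (ev x) F *m Y' x y = Y x y *m map_mx (ev y) F.
  have sr : s <= rho by rewrite ge_min lexx.
  have sr' : s <= rho' by rewrite ge_min lexx orbT.
  apply: (sigma_intertwine s0 sX (Us _ (Sr _ Mq) (Sr' _ Nq)) nq _ _ Y1 Y'1 _ _ AF).
  - by move=> z i j; have [c hc] := solution_psum Yan z i j; exists c; exact: psum_weaken hc.
  - by move=> z i j; have [c hc] := solution_psum Y'an z i j; exists c; exact: psum_weaken hc.
  - by move=> t z tz; apply: (hS q Mq); exact: lt_le_trans sr.
  - by move=> t z tz; apply: (hS' q Nq); exact: lt_le_trans sr'.
have hq' := Us _ (Sr _ Mq') (Sr' _ Nq').
apply: (hom_matrix_sigma sX hq' (sm_actD (gen1 Mq')) (sm_actZ Mq')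
  (sm_actD (gen1 Nq')) (sm_actZ Nq') he he' fl hF (hA _ Mq') (hA' _ Nq')).2.
apply: (extended_intertwine sX hq' Y1 Y'1 inter) => x.
  by apply: (solves_at_diag (rho := rho)) => //; exact: hS.
by apply: (solves_at_diag (rho := rho')) => //; exact: hS'.
Qed.

(** The module, its basis, the solution Y and the radius r are all kept; only the acting group
    grows, to the disc [U r]. *)
Lemma sigma_Res_ess (M : sigma_adm_cat L X [set q]) : ~ is_root_of_unity q ->
  exists (N : sigma_germ_cat L X q) (f : cat_hom (sigma_Res L X q N) M)
    (g : cat_hom M (sigma_Res L X q N)),
  cat_comp f g = cat_id M /\ cat_comp g f = cat_id (sigma_Res L X q N).
Proof.
move=> nq; case: M => M Madm.
have [r [/andP[r0 rr] [Sr [n [e [A0 [rho [Y [he hA0 [/andP[r_le rho_le] Yan] hT hS]]]]]]]]] :=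
  Madm.
have rho0 : 0 < rho by exact: lt_le_trans r_le.
have hq : U r q by exact: Sr.
have Y1 := qTaylor_diag rho0 (hT q (conj erefl nq)).
have Yco : cocycle rho Y.
  by apply: (sigma_cocycle rho_le rho0 Yan Y1 _ nq (hS q erefl)); exact: near1_le hq.
have [act [A [hact act1 actM hA]]] := extended_action rho_le r0 r_le Yan Y1 Yco he.
have gU := gen_near1 L rr r0.
have pD q' : gen (U r) q' -> {morph act q' : m m' / m + m'} by rewrite gU => /hact[].
have pZ q' : gen (U r) q' -> forall (f : H) m, act q' (f *: m) = sigma q' f *: act q' m.
  by rewrite gU => /hact[].
have pC q' : gen (U r) q' -> mod_continuous (act q') by rewrite gU => /hact[].
have pM q1 q2 : gen (U r) q1 -> gen (U r) q2 -> forall m, act (q1 * q2) m = act q1 (act q2 m).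
  by rewrite gU; exact: actM.
pose Nm := @SigmaModule R p K L X (U r) M act (sm_free M) pD pZ pC act1 pM.
have Nadm : sigma_adm Nm.
  exists r; split; first by rewrite r0.
  split => //; exists n, e, A, rho, Y; split => //.
  - by move=> q' /hact[].
  - by rewrite r_le.
  - move=> q' [Uq' nq']; apply: (extended_qTaylor rho_le rho0 Yan Y1 Yco r_le Uq' nq').
    exact: hA.
  - move=> q' Uq'; apply: (extended_solves rho_le Y1 Yco r_le Uq'); exact: hA.
(* Both operators are semilinear with the same matrix Y(q T, T) in the basis e. *)
have act_q m : act q m = sm_act q m.
  have [aD aZ _ aA] := hact q hq.
  have AA : A q = A0 q.
    by apply: ev_mx_inj => x; rewrite hA // (solves_at_diag rho0 Y1 x (hS q erefl)).
  rewrite AA in aA.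
  exact: (semilinear_unique rr hq he aD aZ (sm_actD (gen1 (erefl q)))
    (sm_actZ (erefl q)) aA (hA0 q erefl)).
pose N := SigmaGerm (near1_open_nbhd rr hq) Nadm.
have hf : is_sigma_hom (id : sval (sigma_Res_obj N) -> M).
  by split=> // _ -> m; exact: act_q.
have hg : is_sigma_hom (id : M -> sval (sigma_Res_obj N)).
  by split=> // _ -> m; exact: esym (act_q m).
by exists N, (exist _ id hf), (exist _ id hg); split; exact: sig_fun_inj.
Qed.

Lemma sd_hom_matrix (M N : lmodType H) m n (e : 'I_m -> M) (e' : 'I_n -> N)
    (d : M -> M) (d' : N -> N) (f : M -> N) (F : 'M[H]_(m, n)) G G' :
  {morph d' : x y / x + y} -> (forall a x, d' (a *: x) = delta1 a *: x + a *: d' x) ->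
  is_basis e' -> linear f -> (forall i, f (e i) = comb e' (row i F)) ->
  is_matrix_of e d G -> is_matrix_of e' d' G' -> (forall x, f (d x) = d' (f x)) ->
  G *m F = map_mx delta1 F + F *m G'.
Proof.
move=> d'D d'Z he' fl hF hG /is_matrix_ofE hG' h.
apply/row_matrixP => i; apply: (comb_inj he').
have d'0 : d' 0 = 0 by apply: (addIr (d' 0)); rewrite -d'D !add0r.
rewrite row_mul raddfD combD /= row_mul.
have -> : comb e' (row i G *m F) = f (d (e i)).
  have fD : {morph f : x y / x + y} by move=> x y; rewrite -[x in LHS]scale1r fl scale1r.
  have f0 : f 0 = 0 by apply: (addIr (f 0)); rewrite -fD !add0r.
  rewrite hG (big_morph f fD f0) -(comb_mul (e := fun i => f (e i))) //.
  apply: eq_bigr => j _; rewrite mxE; apply/esym.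
  by rewrite -[_ *: e j]addr0 fl f0 addr0.
rewrite h hF -(comb_mul (e := fun i => d' (e' i))) // /comb (big_morph d' d'D d'0).
rewrite -big_split; apply: eq_bigr => j _.
by rewrite d'Z !mxE.
Qed.

Lemma sd_Res_full (M N : sd_germ L X q) (f : M -> N) :
  @is_sd_hom _ _ _ L X [set q] (sval (sd_Res_obj M)) (sval (sd_Res_obj N)) f ->
  is_sd_germ_hom f.
Proof.
move=> [[fl fs] fd].
have [_ _ Mq] := dg_nbhd M; have [_ _ Nq] := dg_nbhd N.
have [r [/andP[r0 rr] [Sr [m [e [A [G [rho [Y [he [hA hG] [/andP[r_le rho_le] Yan] hT hS]]]]]]]]]] :=
  dg_adm M.
have [r' [/andP[r'0 rr'] [Sr' [n [e' [A' [G' [rho' [Y' [he' [hA' hG'] [/andP[r'_le rho'_le] Y'an] hT' hS']]]]]]]]]] :=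
  dg_adm N.
have [F hF] := basis_matrix e f he'.
exists (dg_set M `&` dg_set N), (fun x h => h.1), (fun x h => h.2).
split; first by apply: open_nbhdI; [exact: dg_nbhd | exact: dg_nbhd].
split=> //; split=> // q' [Mq' Nq'].
have rho0 : 0 < rho by exact: lt_le_trans r_le.
have rho'0 : 0 < rho' by exact: lt_le_trans r'_le.
pose s := Num.min rho rho'.
have s0 : 0 < s by rewrite lt_min rho0.
have sX : s <= rX by rewrite ge_min rho_le.
have sr : s <= rho by rewrite ge_min lexx.
have sr' : s <= rho' by rewrite ge_min lexx orbT.
have Us t : U r t -> U r' t -> U s t.
  by rewrite /s; case: (leP rho rho') => _ h1 h2; [exact: near1_le h1 | exact: near1_le h2].
have [Hm [H0 H1 HS hY Y1]] := Taylor_sol_psum rho0 hT.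
have [Hm' [H'0 H'1 H'S hY' Y'1]] := Taylor_sol_psum rho'0 hT'.
have GF : G *m F = map_mx delta1 F + F *m G'.
  apply: (sd_hom_matrix (d := @sd_conn _ _ _ _ _ _ M) (d' := @sd_conn _ _ _ _ _ _ N)
    (@sd_connD _ _ _ _ _ _ N) (@sd_leibniz _ _ _ _ _ _ N) he' fl hF hG hG').
  by move=> x; exact: fd.
(* Every term of G F = delta_1(F) + F G' is a multiple of T, which can be cancelled. *)
have dF : map_mx (@ddT R p K L X) F + F *m Hm' 1%N = Hm 1%N *m F.
  apply/eqP; rewrite -subr_eq0; apply/eqP/matrixP => i j; rewrite [RHS]mxE.
  apply: HK_T_regular; move/matrixP/(_ i j): GF.
  rewrite -H1 -H'1 -scalemxAl -scalemxAr => E.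
  have E' : HK_T L X * (Hm 1%N *m F) i j =
      HK_T L X * ddT (F i j) + HK_T L X * (F *m Hm' 1%N) i j.
    by move: E; rewrite [in LHS]mxE => ->; rewrite !mxE.
  rewrite mxE [X in X + _]mxE [X in _ + X]mxE mulrBr mulrDr E' mxE.
  exact: subrr.
have inter x y : val y != 0 -> tube s x y ->
    map_mx (ev x) F *m Y' x y = Y x y *m map_mx (ev y) F.
  move=> _; apply: (sd_intertwine sX H0 HS H'0 H'S _ _ dF).
  - by move=> z i j; exact: psum_weaken (hY z i j).
  - by move=> z i j; exact: psum_weaken (hY' z i j).
have hq' := Us _ (Sr _ Mq') (Sr' _ Nq').
apply: (hom_matrix_sigma sX hq' (sm_actD (gen1 Mq')) (sm_actZ Mq')
  (sm_actD (gen1 Nq')) (sm_actZ Nq') he he' fl hF (hA _ Mq') (hA' _ Nq')).2.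
apply: (extended_intertwine sX hq' Y1 Y'1 inter) => x.
  by apply: (solves_at_diag (rho := rho)) => //; exact: hS.
by apply: (solves_at_diag (rho := rho')) => //; exact: hS'.
Qed.

(** The connection and its Taylor solution are kept unchanged. The cocycle relation that extends the
    action comes from the differential equation, so q may be a root of unity. *)
Lemma sd_Res_ess (M : sd_adm_cat L X [set q]) :
  exists (N : sd_germ_cat L X q) (f : cat_hom (sd_Res L X q N) M)
    (g : cat_hom M (sd_Res L X q N)),
  cat_comp f g = cat_id M /\ cat_comp g f = cat_id (sd_Res L X q N).
Proof.
case: M => M Madm.
have [r [/andP[r0 rr] [Sr [n [e [A0 [G [rho [Y [he [hA0 hG] [/andP[r_le rho_le] Yan] hT hS]]]]]]]]]] :=
  Madm.
have rho0 : 0 < rho by exact: lt_le_trans r_le.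
have hq : U r q by exact: Sr.
have [Hm [H0 H1 HS hY Y1]] := Taylor_sol_psum rho0 hT.
have Yco : cocycle rho Y.
  by move=> x y z _; exact: (sd_cocycle H0 HS rho_le hY).
have [act [A [hact act1 actM hA]]] := extended_action rho_le r0 r_le Yan Y1 Yco he.
have gU := gen_near1 L rr r0.
have pD q' : gen (U r) q' -> {morph act q' : m m' / m + m'} by rewrite gU => /hact[].
have pZ q' : gen (U r) q' -> forall (f : H) m, act q' (f *: m) = sigma q' f *: act q' m.
  by rewrite gU => /hact[].
have pC q' : gen (U r) q' -> mod_continuous (act q') by rewrite gU => /hact[].
have pM q1 q2 : gen (U r) q1 -> gen (U r) q2 -> forall m, act (q1 * q2) m = act q1 (act q2 m).
  by rewrite gU; exact: actM.
pose Nm := @SigmaModule R p K L X (U r) M act (sm_free M) pD pZ pC act1 pM.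
pose Nd := @SDModule R p K L X (U r) Nm (@sd_conn _ _ _ _ _ _ M)
  (@sd_connD _ _ _ _ _ _ M) (@sd_leibniz _ _ _ _ _ _ M).
have Nadm : sd_adm Nd.
  exists r; split; first by rewrite r0.
  split => //; exists n, e, A, G, rho, Y; split => //.
  - by split=> // q' /hact[].
  - by rewrite r_le.
  - move=> q' Uq'; apply: (extended_solves rho_le Y1 Yco r_le Uq'); exact: hA.
have act_q m : act q m = sm_act q m.
  have [aD aZ _ aA] := hact q hq.
  have AA : A q = A0 q.
    by apply: ev_mx_inj => x; rewrite hA // (solves_at_diag rho0 Y1 x (hS q erefl)).
  rewrite AA in aA.
  exact: (semilinear_unique rr hq he aD aZ (sm_actD (gen1 (erefl q)))
    (sm_actZ (erefl q)) aA (hA0 q erefl)).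
pose N := SDGerm (near1_open_nbhd rr hq) Nadm.
have hf : is_sd_hom (id : sval (sd_Res_obj N) -> M).
  by split=> //; split=> // _ -> m; exact: act_q.
have hg : is_sd_hom (id : M -> sval (sd_Res_obj N)).
  by split=> //; split=> // _ -> m; exact: esym (act_q m).
by exists N, (exist _ id hf), (exist _ id hg); split; exact: sig_fun_inj.
Qed.

End RestrictionEquivalence.

Theorem theorem7p6 (R : realType) (p : nat) (K : mixedCharField R p)
    (L : algClosure K) (X : affinoid K) (q : K) (hq : Q1_X L X q) :
  (~ is_root_of_unity q -> is_equivalence (sigma_Res L X q)) /\
  is_equivalence (sd_Res L X q).
Proof.
split=> [nq|]; apply: fully_faithful_equivalence.
(* Restricted morphisms keep their underlying maps, which determine them. *)
- by move=> M N f g /(congr1 sval) fg; apply: sig_fun_inj.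
- move=> M N [f hf]; exists (exist _ f (sigma_Res_full nq hf)); exact: sig_fun_inj.
- by move=> M; exact: sigma_Res_ess.
- by move=> M N f g /(congr1 sval) fg; apply: sig_fun_inj.
- move=> M N [f hf]; exists (exist _ f (sd_Res_full hf)); exact: sig_fun_inj.
- by move=> M; exact: sd_Res_ess.
Qed.
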